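(* Let $p(\cdot)\in\mathcal{P}$ with $p(\cdot)\in LH$. Then, for matrix weights with values in $M_m$, $\mathscr{A}_{p(\cdot)}\subset\mathscr{A}_{p(\cdot),\infty}\subset A_{1,\infty}$. Moreover, if $p_->1$, then $\mathscr{A}_{p(\cdot)}\subsetneqq\mathscr{A}_{p(\cdot),\infty}\subsetneqq A_{1,\infty}$.
   Context: $m,n\in\mathbb{N}$; $M_m$ is the set of $m\times m$ complex matrices, with operator norm $\|\cdot\|$. $\mathcal{P}$ is the set of measurable $p:\mathbb{R}^n\to[1,\infty]$; $p_-:=\operatorname{ess\,inf}_{x\in\mathbb{R}^n}p(x)$; $p'(\cdot)$ is defined by $\frac1{p(x)}+\frac1{p'(x)}=1$. A measurable real-valued function $r$ on $\mathbb{R}^n$ belongs to $LH$ if there is $C_0>0$ with $|r(x)-r(y)|\le -\frac{C_0}{\log|x-y|}$ whenever $|x-y|<\frac12$, and there are positive constants $r_\infty,C_\infty$ with $|r(x)-r_\infty|\le\frac{C_\infty}{\log(e+|x|)}$ for all $x$. For an exponent $q(\cdot)$ and a measurable function $f$, $\|f\|_{L^{q(\cdot)}}:=\inf\{\lambda>0:\rho(f/\lambda)\le1\}$ (with $\inf\emptyset=\infty$), where $\rho(f):=\int_{\{q<\infty\}}|f(x)|^{q(x)}\,dx+\|f\|_{L^\infty(\{q=\infty\})}$; $L^{q(\cdot)}_x$ means that the norm is taken in the variable $x$. Cubes have finite positive edge length and edges parallel to the axes (not necessarily open or closed); $\fint_Q$ denotes the average $\frac1{|Q|}\int_Q$; all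 suprema below are over all cubes. A matrix weight is a function $W:\mathbb{R}^n\to M_m$ such that $W(x)$ is nonnegative definite and invertible for almost every $x$ and all entries of $W$ are locally integrable. $W\in\mathscr{A}_{p(\cdot)}$ means $$\sup_Q|Q|^{-1}\left\|\,\left\|\,\|W(x)W^{-1}(\cdot)\|\,\mathbf{1}_Q(\cdot)\right\|_{L^{p'(\cdot)}}\mathbf{1}_Q(x)\right\|_{L^{p(\cdot)}_x}<\infty.$$ $W\in\mathscr{A}_{p(\cdot),\infty}$ means $$\sup_Q\exp\left(\fint_Q\log\left(\frac{1}{\|\mathbf{1}_Q\|_{L^{p(\cdot)}}}\left\|\,\|W(\cdot)W^{-1}(y)\|\,\mathbf{1}_Q(\cdot)\right\|_{L^{p(\cdot)}}\right)dy\right)<\infty.$$ $W\in A_{1,\infty}$ means $\sup_Q\exp\left(\fint_Q\log\left(\fint_Q\|W(x)W^{-1}(y)\|\,dx\right)dy\right)<\infty$. *)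

(* Defs.v *)
From HB Require Import structures.
From mathcomp Require Import all_boot all_order all_algebra.
From mathcomp Require Import all_classical all_reals all_analysis.
From mathcomp Require Import measurable_realfun ess_sup_inf complex.
Import Order.TTheory GRing.Theory Num.Theory.
Import numFieldNormedType.Exports.

Set Implicit Arguments.
Unset Strict Implicit.
Unset Printing Implicit Defensive.

Local Open Scope classical_set_scope.
Local Open Scope ring_scope.

Section tuple_measure.
Context d (T : measurableType d) (R : realType).
Variable m : {sigma_finite_measure set T -> \bar R}.

Definition cons_tuple n (x : T * n.-tuple T) : n.+1.-tuple T :=
  [tuple of x.1 :: x.2].

Let measurable_cons_tuple n : measurable_fun setT (@cons_tuple n).
Proof. exact: measurable_cons. Qed.

Section cons_measure.
Variables (n : nat) (mu : {sigma_finite_measure set (n.-tuple T) -> \bar R}).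

Definition cons_measure : set (n.+1.-tuple T) -> \bar R :=
  pushforward (m \x mu)%E (@cons_tuple n).

Let cons_measure0 : cons_measure set0 = 0%E.
Proof. by rewrite /cons_measure /pushforward preimage_set0 measure0. Qed.

Let cons_measure_ge0 A : (0 <= cons_measure A)%E.
Proof. by rewrite /cons_measure /pushforward. Qed.

Let cons_measure_sigma_additive : semi_sigma_additive cons_measure.
Proof.
apply: measure_semi_sigma_additive; exact: measurable_cons_tuple.
Qed.

HB.instance Definition _ := isMeasure.Build _ _ _ cons_measure
  cons_measure0 cons_measure_ge0 cons_measure_sigma_additive.

Let cons_measure_sigma_finite : sigma_finite setT cons_measure.
Proof.
have /sigma_finiteP[F [TF ndF Foo]] := sigma_finiteT m.
have /sigma_finiteP[G [TG ndG Goo]] := sigma_finiteT mu.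
pose uncons (t : n.+1.-tuple T) : T * n.-tuple T :=
  (tnth t ord0, [tuple of behead t]).
have muncons : measurable_fun setT uncons.
  apply: measurable_fun_pair; first exact: measurable_tnth.
  exact: measurable_behead.
have consK x : uncons (cons_tuple x) = x.
  by case: x => a t; congr pair; exact/val_inj.
have mFG k : measurable (F k `*` G k).
  by apply: measurableX; [have [] := Foo k|have [] := Goo k].
exists (fun k => uncons @^-1` (F k `*` G k)).
  apply/seteqP; split => // t _.
  have [i _ Fi] : (\bigcup_i F i) (uncons t).1 by rewrite -TF.
  have [j _ Gj] : (\bigcup_i G i) (uncons t).2 by rewrite -TG.
  exists (maxn i j) => //; split.
  - by move: Fi; exact/subsetPset/ndF/leq_maxl.
  - by move: Gj; exact/subsetPset/ndG/leq_maxr.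
move=> k; split; first by rewrite -[X in measurable X]setTI; exact: muncons.
rewrite /cons_measure /pushforward.
rewrite [X in product_measure1 _ _ X](_ : _ = F k `*` G k); last first.
  by apply/funext => x; rewrite -[in RHS](consK x).
have [mF Fk] := Foo k; have [mG Gk] := Goo k.
by rewrite product_measure1E// lte_mul_pinfty// ge0_fin_numE.
Qed.

HB.instance Definition _ :=
  Measure_isSigmaFinite.Build _ _ _ cons_measure cons_measure_sigma_finite.

End cons_measure.

Fixpoint tuple_measure n : {sigma_finite_measure set (n.-tuple T) -> \bar R} :=
  match n with
  | 0 => dirac [tuple]
  | n'.+1 => cons_measure (tuple_measure n')
  end.

Lemma measurable_tupleX n (A : 'I_n -> set T) : (forall i, measurable (A i)) ->
  measurable [set t : n.-tuple T | forall i, A i (tnth t i)].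
Proof.
move=> mA; rewrite (_ : [set _ | _] =
    \big[setI/setT]_(i < n) ((fun t : n.-tuple T => tnth t i) @^-1` A i)).
  apply: bigsetI_measurable => i _.
  by rewrite -[X in measurable X]setTI; exact: measurable_tnth.
apply/seteqP; split => t /=; first by move=> At; rewrite -bigcap_seq => i _ /=.
by rewrite -bigcap_seq => At i; apply: (At i); rewrite /= mem_index_enum.
Qed.

Lemma tuple_measureX n (A : 'I_n -> set T) : (forall i, measurable (A i)) ->
  tuple_measure n [set t | forall i, A i (tnth t i)] = (\prod_i m (A i))%E.
Proof.
elim: n A => [|n IHn] A mA.
  rewrite big_ord0 /= diracE mem_set//.
  by case.
rewrite big_ord_recl -IHn//= /cons_measure /pushforward.
have mA' i : measurable (A (lift ord0 i)) by exact: mA.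
rewrite -(product_measure1E m (tuple_measure n) (mA ord0) (measurable_tupleX mA')).
congr product_measure1; apply/seteqP; split => -[a t] /=.
  move=> At; split; first exact: (At ord0).
  by move=> i; have := At (lift ord0 i); rewrite tnthS.
by move=> [Aa At] i; case: (unliftP ord0 i) => [j|] ->; rewrite ?tnthS.
Qed.

End tuple_measure.

(* Lebesgue measure on R^n is the Caratheodory completion of the n-fold product
   of the Lebesgue measure on the Borel sets of R. Points of R^n are row vectors,
   so that the topology of 'rV[R]_n is available. *)
Section lebesgue_outer.
Context (R : realType) (n : nat).

Definition lebesgue_outer (A : set 'rV[R]_n) : \bar R :=
  ((tuple_measure (@lebesgue_measure R) n)^*)%mu [set t : n.-tuple R | A (\row_i tnth t i)].

Let lebesgue_outer0 : lebesgue_outer set0 = 0%E.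
Proof. exact: outer_measure0. Qed.

Let lebesgue_outer_ge0 A : (0 <= lebesgue_outer A)%E.
Proof. exact: outer_measure_ge0. Qed.

Let le_lebesgue_outer : {homo lebesgue_outer : A B / A `<=` B >-> (A <= B)%E}.
Proof. by move=> A B AB; apply: le_outer_measure => t /AB. Qed.

Let lebesgue_outer_sigma_subadditive : sigma_subadditive lebesgue_outer.
Proof. by move=> F; exact: outer_measure_sigma_subadditive. Qed.

HB.instance Definition _ := isOuterMeasure.Build R 'rV[R]_n lebesgue_outer
  lebesgue_outer0 lebesgue_outer_ge0 le_lebesgue_outer
  lebesgue_outer_sigma_subadditive.

End lebesgue_outer.

Section euclidean_space.
Context (R : realType) (n : nat).

Definition lebesgue_outer_measure : {outer_measure set 'rV[R]_n -> \bar R} :=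
  @lebesgue_outer R n.

Definition Rn := caratheodory_type lebesgue_outer_measure.

HB.instance Definition _ := Measurable.on Rn.

Definition lebesgue_Rn : set Rn -> \bar R := lebesgue_outer_measure.

HB.instance Definition _ := Measure.on lebesgue_Rn.

Lemma lebesgue_Rn_is_complete : measure_is_complete lebesgue_Rn.
Proof. exact: measure_is_complete_caratheodory. Qed.

Definition coord (x : Rn) (i : 'I_n) : R := (x : 'rV[R]_n) ord0 i.

Lemma lebesgue_RnX (A : 'I_n -> set R) : (forall i, measurable (A i)) ->
  lebesgue_Rn [set x | forall i, A i (coord x i)] =
  (\prod_i lebesgue_measure (A i))%E.
Proof.
move=> mA; rewrite -tuple_measureX// /lebesgue_Rn /= /lebesgue_outer.
rewrite (_ : [set t | _] = [set t : n.-tuple R | forall i, A i (tnth t i)]).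
  by rewrite measurable_mu_extE//; exact: measurable_tupleX.
by apply/seteqP; split => t /= + i => /(_ i); rewrite /coord mxE.
Qed.

Definition enorm (x : Rn) : R := Num.sqrt (\sum_i coord x i ^+ 2).

(* [BSide b x] includes or excludes the endpoint [x] according to [b], so each
   side of the cube may be open, closed or half-open. *)
Definition cube (Q : set Rn) : Prop :=
  exists (a : Rn) (l : R) (b1 b2 : 'I_n -> bool), 0 < l /\
    Q = [set x | forall i, coord x i \in
          Interval (BSide (b1 i) (coord a i)) (BSide (b2 i) (coord a i + l))].

Local Open Scope ereal_scope.

Definition average (Q : set Rn) (f : Rn -> \bar R) : \bar R :=
  (lebesgue_Rn Q)^-1 * \int[lebesgue_Rn]_(x in Q) f x.

End euclidean_space.

Section variable_exponents.
Context (R : realType) (n : nat).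
Local Notation Rn := (Rn R n).
Local Notation mu := (@lebesgue_Rn R n).

Definition exponent (p : Rn -> \bar R) : Prop :=
  measurable_fun setT p /\ (forall x, 1 <= p x)%E.

(* At [x = y] the first bound reads [0 <= - C0 / ln 0 = 0], as [ln 0 = 0] and
   [_ / 0 = 0]: it is void there, as with the convention [C0 / log 0 = 0]. *)
Definition log_hoelder (r : Rn -> R) : Prop :=
  [/\ measurable_fun setT r,
      exists2 C0 : R, 0 < C0 &
        forall x y : Rn, enorm (x - y) < 2^-1 ->
          `|r x - r y| <= - (C0 / ln (enorm (x - y))) &
      exists roo Coo : R, [/\ 0 < roo, 0 < Coo &
        forall x : Rn, `|r x - roo| <= Coo / ln (expR 1 + enorm x)]].

(* An exponent in LH is finite everywhere, as LH consists of real-valued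
   functions. *)
Definition LH (p : Rn -> \bar R) : Prop :=
  exists2 r : Rn -> R, log_hoelder r & p = EFin \o r.

Local Open Scope ereal_scope.

Definition modular (q f : Rn -> \bar R) : \bar R :=
  \int[mu]_(x in [set x | q x < +oo]) (`|f x| `^ fine (q x)) +
  'N[mu]_+oo[f \_ [set x | q x = +oo]].

(* Functions are extended-real valued because the inner norm in the definition
   of [matrix_Ap] may be infinite. *)
Definition vnorm (q f : Rn -> \bar R) : \bar R :=
  ereal_inf [set lambda%:E | lambda in
    [set lambda : R | (0 < lambda)%R /\
                      modular q (fun x => f x / lambda%:E) <= 1]].

Definition conjugate_exponent (p : Rn -> \bar R) : Rn -> \bar R :=
  fun x => hoelder_conjugate (p x).

End variable_exponents.

Section complex_matrices.
Context (R : realType) (m : nat).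

Definition cvnorm (v : 'cV[R[i]]_m) : R :=
  Num.sqrt (\sum_i Normc.normc (v i ord0) ^+ 2).

Definition opnorm (A : 'M[R[i]]_m) : R :=
  sup [set cvnorm (A *m v) | v in [set v | cvnorm v <= 1]].

(* [0 <= z] in [R[i]] means that [z] is real and nonnegative; hence this
   entails that [A] is Hermitian. *)
Definition nonneg_definite (A : 'M[R[i]]_m) : Prop :=
  forall v : 'cV[R[i]]_m, 0 <= ((map_mx conjc v)^T *m A *m v) ord0 ord0.

End complex_matrices.

Section matrix_weights.
Context (R : realType) (n m : nat).
Local Notation Rn := (Rn R n).
Local Notation mu := (@lebesgue_Rn R n).
Implicit Types (p : Rn -> \bar R) (W : Rn -> 'M[R[i]]_m).
Local Open Scope ereal_scope.

Definition locally_integrableC (f : Rn -> R[i]) : Prop :=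
  [/\ measurable_fun setT (fun x => complex.Re (f x)),
      measurable_fun setT (fun x => complex.Im (f x)) &
      forall K : set 'rV[R]_n, compact K ->
        \int[mu]_(x in K) (Normc.normc (f x))%:E < +oo].

Definition matrix_weight W : Prop :=
  {ae mu, forall x, nonneg_definite (W x) /\ W x \in unitmx} /\
  forall i j, locally_integrableC (fun x => W x i j).

Definition matrix_Ap p : set (Rn -> 'M[R[i]]_m) :=
  [set W | matrix_weight W /\
    ereal_sup [set (mu Q)^-1 *
      vnorm p (fun x =>
        vnorm (conjugate_exponent p) (fun y =>
          (opnorm (W x *m invmx (W y)))%:E * (\1_Q y)%:E) * (\1_Q x)%:E)
      | Q in @cube R n] < +oo].

Definition matrix_Ap_infty p : set (Rn -> 'M[R[i]]_m) :=
  [set W | matrix_weight W /\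
    ereal_sup [set expeR (average Q (fun y =>
      lne ((vnorm p (fun x => (\1_Q x)%:E))^-1 *
        vnorm p (fun x =>
          (opnorm (W x *m invmx (W y)))%:E * (\1_Q x)%:E))))
      | Q in @cube R n] < +oo].

Definition matrix_A1_infty : set (Rn -> 'M[R[i]]_m) :=
  [set W | matrix_weight W /\
    ereal_sup [set expeR (average Q (fun y =>
      lne (average Q (fun x => (opnorm (W x *m invmx (W y)))%:E))))
      | Q in @cube R n] < +oo].

End matrix_weights.

Arguments matrix_Ap {R n} m p.
Arguments matrix_Ap_infty {R n} m p.
Arguments matrix_A1_infty R n m : clear implicits.

(* Main.v *)
Require Import Defs.
From mathcomp Require Import all_boot all_order all_algebra.
From mathcomp Require Import all_classical all_reals all_analysis.
From mathcomp Require Import measurable_realfun ess_sup_inf complex.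
From mathcomp Require Import perm ring lra.

(** Both inclusions are proved on one cube Q at a time, from two row norms on
    C^m attached to a matrix weight W: N, which sends phi to the norm over Q of
    |phi W(x)^T| in L^p, and N', which sends phi to the norm over Q of
    |phi W^-1(y)| in L^p'. For a finite norm on C^m there is a basis of vectors of norm at
    most 1 in which coordinates are bounded by twice the norm ([almost_auerbach]: rows
    of nearly maximal determinant, and Cramer's rule). Such a basis U for N
    ([reducing_basis]) plays the role of a reducing matrix: the norm
    over Q in L^p of x |-> |W(x) W^-1(y)| is, as a function of y, comparable with the
    explicit measurable function |U^-T W^-1(y)|, with constants depending on m only.

    A_p is contained in A_{p,oo}: the logarithm is at most its argument, and
    Hoelder's inequality bounds the average of |U^-T W^-1| by N'-norms of the rows
    of U^-T. Expanding these rows in a basis for N' and exchanging the two bases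
    turns them into N-norms of vectors z with |z W(x)^T| bounded by the p'-norm of
    y |-> |W(x) W^-1(y)|, which is what A_p controls ([average_log_le_Ap]).

    A_{p,oo} is contained in A_{1,oo}: it suffices to bound averages over a cube by
    normalised L^p norms, uniformly over all cubes ([log_hoelder_average]). This is
    where log-Hoelder continuity is used. The constant s with s^q |Q| = 1 is, up to
    constants, the inverse of the norm of 1_Q, and it also bounds the averages of
    functions of norm at most 1, as long as the powers s^(p(x) - q) are bounded. The
    local condition gives this on small cubes, with q a value of p. The decay
    condition gives it on large cubes, with q the limit at infinity, once s is
    replaced by the maximum of s and an integrable function h of polynomial decay.

    When p_- > 1, choose q > 1 with p >= q almost everywhere. Scalar powers of one
    coordinate t = x_i show that the inclusions are strict. The weight |t| is in A_{p,oo}, because the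
    average of ln (T / |t|) over a cube where |t| <= T is bounded ([average_power]);
    it is not in A_p, because 1 / |t| has infinite norm in L^p'. The weight
    |t|^(-1/q) satisfies the A_1 condition, hence is in A_{1,oo}, but it has infinite
    norm in L^p. Both divergences are [vnorm_power_infty].

    Norms are compared up to constants throughout, so a triangle inequality with a
    constant ([vnorm_sum]) is enough, and the functions that are not known to be
    measurable are only ever compared pointwise with measurable ones
    ([le_integral_pointwise]). *)

Import Order.TTheory GRing.Theory Num.Theory.
Import numFieldNormedType.Exports.
Import Defs.

Set Implicit Arguments.
Unset Strict Implicit.
Unset Printing Implicit Defensive.

Local Open Scope classical_set_scope.
Local Open Scope ring_scope.
Local Open Scope ereal_scope.

(** * Integrals and null sets *)

Section integrals.
Context d (T : measurableType d) (R : realType).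
Variable mu : {measure set T -> \bar R}.

(** The integral is built from suprema over simple functions below the positive and
    the negative part, hence it is monotone on arbitrary functions. Operator norms and
    inner variable-exponent norms are thus handled without proving them measurable. *)
Lemma le_integral_pointwise (D : set T) (f g : T -> \bar R) :
  (forall x, D x -> f x <= g x) ->
  \int[mu]_(x in D) f x <= \int[mu]_(x in D) g x.
Proof.
move=> fg; have fgD x : (f \_ D) x <= (g \_ D) x.
  by rewrite !patchE; case: ifPn => // /set_mem /fg.
rewrite /integral; apply: leeB; apply: le_ereal_sup => _ [h hf <-];
  exists h => // x; apply: (le_trans (hf x)).
- by apply: (@funepos_le _ _ setT) => [y _|]; [exact: fgD|rewrite in_setT].
- by apply: (@funeneg_le _ _ setT) => [y _|]; [exact: fgD|rewrite in_setT].
Qed.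

Lemma measure_setD_null (A Z : set T) : measurable A -> measurable Z ->
  mu Z = 0 -> mu (A `\` Z) = mu A.
Proof.
move=> mA mZ Z0; apply/eqP; rewrite eq_le; apply/andP; split.
  by apply: le_measure; rewrite ?inE//; exact: measurableD.
apply: (@le_trans _ _ (mu ((A `\` Z) `|` Z))).
  apply: le_measure; rewrite ?inE//; first by apply: measurableU => //; exact: measurableD.
  by move=> x Ax; have [Zx|Zx] := pselect (Z x); [right|left].
apply: le_trans (measureU2 _ (measurableD mA mZ) mZ) _.
by change (mu (A `\` Z) + mu Z <= mu (A `\` Z)); rewrite Z0 adde0.
Qed.

(** Turns an almost-everywhere property into a measurable set of positive measure on
    which it holds at every point. *)
Lemma conull_subset (Q : set T) (P : T -> Prop) : measurable Q -> 0 < mu Q ->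
  {ae mu, forall x, P x} ->
  exists E, [/\ measurable E, 0 < mu E, E `<=` Q, mu (Q `\` E) = 0 & forall x, E x -> P x].
Proof.
move=> mQ Q0 [Z [mZ Z0 PZ]]; exists (Q `\` Z); split.
- exact: measurableD.
- by rewrite measure_setD_null.
- by move=> x [].
- apply/eqP; rewrite eq_le measure_ge0 andbT -Z0; apply: le_measure; rewrite ?inE//.
    by apply: measurableD => //; exact: measurableD.
  by move=> x [Qx nQZ]; apply: contrapT => Zx; exact: nQZ.
- by move=> x [_ Zx]; apply: contrapT => nP; apply: Zx; exact: PZ.
Qed.

End integrals.

(** * Boxes and cubes *)

Section coordinates.
Context (R : realType) (n : nat).
Local Notation Rn := (Rn R n).
Local Notation mu := (@lebesgue_Rn R n).

(** The outer measure on row vectors is transported from tuples, where the sets of the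
    product sigma-algebra are Caratheodory measurable. *)
Lemma measurable_RnX (A : 'I_n -> set R) : (forall i, measurable (A i)) ->
  measurable ([set x | forall i, A i (coord x i)] : set Rn).
Proof.
move=> mA.
change (caratheodory_measurable (lebesgue_outer_measure R n) [set x : Rn | forall i, A i (coord x i)]) => X.
pose phi (t : n.-tuple R) : Rn := \row_i tnth t i.
have mS := sub_caratheodory (tuple_measure (@lebesgue_measure R) n)
  (sub_gen_smallest (measurable_tupleX mA)).
have S_E : phi @^-1` [set x | forall i, A i (coord x i)] =
    [set t : n.-tuple R | forall i, A i (tnth t i)].
  by apply/seteqP; split => t /= + i => /(_ i); rewrite /coord mxE.
have := mS (phi @^-1` X); rewrite -S_E; exact.
Qed.

Lemma measurable_coord (i : 'I_n) : measurable_fun setT (fun x : Rn => coord x i).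
Proof.
move=> _ A mA; rewrite setTI.
rewrite (_ : _ @^-1` _ = [set x | forall j, (if j == i then A else setT) (coord x j)]).
  by apply: (measurable_RnX (A := fun j => if j == i then A else setT)) => j; case: ifP.
apply/seteqP; split=> x /=; first by move=> Ax j; case: eqP => // ->.
by move=> /(_ i); rewrite eqxx.
Qed.

(** A cube presented as a product of intervals of common length, the form in which
    [lebesgue_RnX] computes its measure. *)
Definition has_sides (Q : set Rn) (l : R) (I : 'I_n -> interval R) : Prop :=
  [/\ (0 < l)%R, Q = [set x | forall i, coord x i \in I i] &
   forall i, exists a b1 b2, I i = Interval (BSide b1 a) (BSide b2 (a + l)%R)].

Lemma cubeP (Q : set Rn) : cube Q -> exists l I, has_sides Q l I.
Proof.
move=> [a [l [b1 [b2 [l0 ->]]]]].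
exists l, (fun i => Interval (BSide (b1 i) (coord a i)) (BSide (b2 i) (coord a i + l)%R)).
by split => // i; exists (coord a i), (b1 i), (b2 i).
Qed.

Lemma lebesgue_side (I : interval R) l a b1 b2 : (0 < l)%R ->
  I = Interval (BSide b1 a) (BSide b2 (a + l)%R) ->
  lebesgue_measure [set` I] = l%:E.
Proof.
move=> l0 ->; rewrite lebesgue_measure_itv/= lte_fin ltrDl l0 -EFinB.
by congr EFin; ring.
Qed.

Lemma measurable_cube (Q : set Rn) : cube Q -> measurable Q.
Proof.
move=> /cubeP[l [I [l0 -> _]]].
exact: (measurable_RnX (A := fun i => [set` I i])).
Qed.

Lemma lebesgue_cube (Q : set Rn) l I : has_sides Q l I -> mu Q = (l ^+ n)%:E.
Proof.
move=> [l0 -> hI]; rewrite (lebesgue_RnX (A := fun i => [set` I i]))//.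
rewrite (eq_bigr (fun _ => l%:E)); last first.
  by move=> i _; have [a [b1 [b2 /lebesgue_side->]]] := hI i.
by rewrite -(big_morph EFin (@EFinM R) erefl) prodr_const card_ord.
Qed.

Lemma cube_gt0 (Q : set Rn) : cube Q -> 0 < mu Q.
Proof.
by move=> /cubeP[l [I s]]; have [l0 _ _] := s; rewrite (lebesgue_cube s) lte_fin exprn_gt0.
Qed.

Lemma cube_lty (Q : set Rn) : cube Q -> mu Q < +oo.
Proof. by move=> /cubeP[l [I s]]; rewrite (lebesgue_cube s) ltry. Qed.

End coordinates.

(** * The Luxemburg norm of a variable exponent *)

Section vnorm_theory.
Context (R : realType) (n : nat).
Local Notation Rn := (Rn R n).
Local Notation mu := (@lebesgue_Rn R n).
Implicit Types (q f g : Rn -> \bar R) (t : R).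

Lemma lebesgue_Rn_gt0 : 0 < mu setT.
Proof.
have cQ : cube [set x : Rn | forall i, coord x i \in
    Interval (BLeft (coord (0%R : Rn) i)) (BLeft (coord (0%R : Rn) i + 1)%R)].
  by exists 0%R, 1%R, (fun=> true), (fun=> true).
apply: lt_le_trans (cube_gt0 cQ) _.
by apply: le_measure; rewrite ?inE//; exact: measurable_cube.
Qed.

Lemma fine_exponent_ge1 q : exponent q -> forall x, q x < +oo -> (1 <= fine (q x))%R.
Proof.
move=> [_ q1] x qy; have := q1 x; move: qy.
by case: (q x) => //= r _; rewrite lee_fin.
Qed.

Lemma modularE q f : modular q f =
  \int[mu]_(x in [set x | q x < +oo]) (`|f x| `^ fine (q x)) +
  ess_sup mu (fun x => `|(f \_ [set x | q x = +oo]) x|).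
Proof. by rewrite /modular; congr (_ + _); rewrite Lnorm.unlock lebesgue_Rn_gt0. Qed.

Lemma le_modular q f g : exponent q -> (forall x, 0 <= f x <= g x) ->
  modular q f <= modular q g.
Proof.
move=> eq fg; rewrite !modularE leeD//.
  apply: le_integral_pointwise => x /= qx.
  have /andP[f0 fgx] := fg x.
  have g0 := le_trans f0 fgx.
  rewrite !gee0_abs//; apply: gt0_ler_poweR => //.
  - exact: le_trans (fine_exponent_ge1 eq qx).
  - by rewrite in_itv/= f0 leey.
  - by rewrite in_itv/= g0 leey.
apply: le_ess_sup; apply/nearW => x; rewrite !patchE.
have /andP[f0 fgx] := fg x; have g0 := le_trans f0 fgx.
by case: ifP => // _; rewrite !gee0_abs.
Qed.

Lemma divEFinE (x : \bar R) t : (0 < t)%R -> x / t%:E = (t^-1)%:E * x.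
Proof. by move=> t0; rewrite inver gt_eqF// muleC. Qed.

Lemma vnorm_ge0 q f : 0 <= vnorm q f.
Proof. by apply: le_ereal_inf_tmp => _ [t [t0 _] <-]; rewrite lee_fin ltW. Qed.

Lemma vnorm_le q f t : (0 < t)%R ->
  modular q (fun x => f x / t%:E) <= 1 -> vnorm q f <= t%:E.
Proof. by move=> t0 ft; apply: ereal_inf_lbound; exists t. Qed.

(** An admissible level exists below t, and larger levels stay admissible. *)
Lemma vnorm_lt q f t : exponent q -> (forall x, 0 <= f x) -> vnorm q f < t%:E ->
  (0 < t)%R /\ modular q (fun x => f x / t%:E) <= 1.
Proof.
move=> eq f0 /ereal_inf_lt[_ [s [s0 fs] <-]]; rewrite lte_fin => st.
have t0 := lt_trans s0 st; split=> //.
apply: le_trans fs; apply: le_modular => // x.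
rewrite !divEFinE// mule_ge0 ?lee_fin ?invr_ge0 ?(ltW t0)//=.
by rewrite lee_wpmul2r// lee_fin lef_pV2 ?posrE// ltW.
Qed.

Lemma le_vnorm q f g : exponent q -> (forall x, 0 <= f x <= g x) ->
  vnorm q f <= vnorm q g.
Proof.
move=> eq fg; apply: le_ereal_inf => _ [t [t0 gt] <-]; exists t => //; split=> //.
apply: le_trans gt; apply: le_modular => // x.
have /andP[f0 fgx] := fg x.
by rewrite !divEFinE// mule_ge0 ?lee_fin ?invr_ge0 ?(ltW t0)//= lee_wpmul2l ?lee_fin ?invr_ge0 ?(ltW t0).
Qed.

(** The reverse inequality is this one for the function c f and the scalar c^-1. *)
Lemma vnormZ_le q f (c : R) : (0 < c)%R ->
  vnorm q (fun x => c%:E * f x) <= c%:E * vnorm q f.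
Proof.
move=> c0; rewrite -lee_pdivrMl//; apply: le_ereal_inf_tmp => _ [t [t0 ft] <-].
rewrite lee_pdivrMl//; apply: vnorm_le; first exact: mulr_gt0.
rewrite (_ : (fun x => c%:E * f x / (c * t)%:E) = (fun x => f x / t%:E))//; apply/funext => x.
rewrite !divEFinE ?mulr_gt0// muleA -EFinM; congr (_%:E * _).
by rewrite invfM mulrAC mulVf ?mul1r// gt_eqF.
Qed.

(** A finite power at least 1 of an infinite value is infinite, so no level is
    admissible and the infimum is taken over the empty set. *)
Lemma vnorm_eqy q f (E : set Rn) : exponent q -> (forall x, 0 <= f x) ->
  measurable E -> 0 < mu E -> (forall x, E x -> q x < +oo /\ f x = +oo) ->
  vnorm q f = +oo.
Proof.
move=> eq f0 mE E0 Ef; apply/eqP; rewrite -leye_eq; apply: le_ereal_inf_tmp => _ [t [t0 +] <-].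
rewrite leNgt => /negP; rewrite modularE; case.
apply: (@lt_le_trans _ _ +oo); first exact: ltry.
rewrite -[leLHS]adde0 leeD//; last first.
  by apply: ess_sup_gee; [exact: lebesgue_Rn_gt0|apply/nearW].
rewrite -[leLHS](gt0_mulye E0) -[leLHS](integral_cst mu mE).
rewrite [leRHS]integral_mkcond [leLHS]integral_mkcond; apply: le_integral_pointwise => x _.
rewrite !patchE; case: ifPn => [/set_mem Ex|_] /=.
  have [qx fx] := Ef _ Ex; rewrite mem_set// fx divEFinE// mulry gtr0_sg ?invr_gt0// mul1e.
  by rewrite /= gt_eqF// (lt_le_trans _ (fine_exponent_ge1 eq qx)).
by case: ifPn => // _; exact: poweR_ge0.
Qed.

Lemma measurable_powR2 d (T : measurableType d) (f g : T -> R) :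
  measurable_fun setT f -> measurable_fun setT g ->
  measurable_fun setT (fun x => (f x `^ g x)%R).
Proof.
move=> mf mg; rewrite /powR; apply: measurable_fun_ifT.
- exact: measurable_fun_eqr.
- rewrite (_ : (fun x => _) = fun x => if (g x == 0)%R then 1%R else 0%R :> R); last first.
    by apply/funext => x; case: eqP.
  by apply: measurable_fun_ifT => //; exact: measurable_fun_eqr.
- apply: measurableT_comp => //; apply: measurable_funM => //.
  exact: measurableT_comp.
Qed.

Lemma measurable_fun_fine q : measurable_fun setT q -> measurable_fun setT (fine \o q).
Proof. by move=> mq; apply: measurableT_comp. Qed.

Lemma exponent_lt_measurable q : exponent q -> measurable [set x | q x < +oo].
Proof.
move=> [mq _]; rewrite -[X in measurable X]setTI.
exact: emeasurable_fun_infty_o.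
Qed.

End vnorm_theory.

(** * Quasi-triangle inequality *)

Section quasi_triangle.
Context (R : realType) (n : nat).
Local Notation Rn := (Rn R n).
Local Notation mu := (@lebesgue_Rn R n).

(** The sum is at most m times its largest term. This uses up one of the two factors
    m^-1; the other one leaves the power because r >= 1. *)
Lemma powR_sum_le (m : nat) (a : 'I_m -> R) (r : R) : (0 < m)%N -> (1 <= r)%R ->
  (forall i, 0 <= a i)%R ->
  ((\sum_i a i / m%:R ^+ 2) `^ r <= \sum_i m%:R^-1 * a i `^ r)%R.
Proof.
move=> m0 r1 a0; have M0 : (0 < m%:R^-1 :> R)%R by rewrite invr_gt0 ltr0n.
pose i1 : 'I_m := Ordinal m0.
pose i0 := [arg max_(i > i1) a i]%O.
have ai0 i : (a i <= a i0)%R by rewrite /i0; case: arg_maxP => //= j _; exact.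
have r0 : (0 <= r)%R by exact: le_trans r1.
apply: (@le_trans _ _ ((m%:R^-1 * a i0) `^ r)%R).
  apply: ge0_ler_powR => //.
  - by rewrite nnegrE sumr_ge0// => i _; rewrite mulr_ge0// invr_ge0 exprn_ge0.
  - by rewrite nnegrE mulr_ge0// ltW.
  apply: (@le_trans _ _ (\sum_(i < m) a i0 / m%:R ^+ 2)%R).
    by apply: ler_sum => i _; rewrite ler_wpM2r// invr_ge0 exprn_ge0.
  rewrite sumr_const card_ord -mulr_natr le_eqVlt; apply/orP; left; apply/eqP.
  by field; rewrite pnatr_eq0 -lt0n.
apply: (@le_trans _ _ (m%:R^-1 * a i0 `^ r)%R).
  by apply: ge1r_powRZ => //; rewrite M0 invf_le1 ?ltr0n// ler1n.
rewrite (bigD1 i0)//= lerDl sumr_ge0// => i _.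
by rewrite mulr_ge0 ?powR_ge0// ltW.
Qed.

(** Bounding the sum by m times its largest term treats finite and infinite values of
    the exponent alike. *)
Lemma vnorm_sum_lt (q : Rn -> \bar R) (m : nat) (f : 'I_m -> Rn -> R) (b : R) :
  exponent q -> (0 < m)%N -> (forall i, measurable_fun setT (f i)) ->
  (forall i x, 0 <= f i x)%R ->
  (forall i, vnorm q (fun x => (f i x)%:E) < b%:E) ->
  vnorm q (fun x => (\sum_i f i x)%:E) <= (m%:R ^+ 2 * b)%:E.
Proof.
move=> eq m0 mf f0 fb.
have f0' i x : 0 <= (f i x)%:E by rewrite lee_fin.
have b0 : (0 < b)%R by have [] := vnorm_lt eq (f0' (Ordinal m0)) (fb _).
have M0 : (0 < m%:R :> R)%R by rewrite ltr0n.
pose g i x := (f i x / b)%R.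
have g0 i x : (0 <= g i x)%R by rewrite divr_ge0// ltW.
have mg i : measurable_fun setT (g i) by exact: measurable_funM.
have mfq : measurable_fun setT (fine \o q) by apply: measurable_fun_fine; case: eq.
pose D := [set x | q x < +oo].
have mD : measurable D := exponent_lt_measurable eq.
pose I i := \int[mu]_(x in D) (g i x `^ fine (q x))%:E.
pose e i := ess_sup mu (fun x => `|((fun x => (g i x)%:E) \_ [set x | q x = +oo]) x|).
have Ie i : I i + e i <= 1.
  have [_] := vnorm_lt eq (f0' i) (fb i); rewrite modularE.
  have fgE x : (f i x)%:E / b%:E = (g i x)%:E by rewrite divEFinE// -EFinM mulrC.
  have -> : (fun x => (f i x)%:E / b%:E) = (fun x => (g i x)%:E) by exact/funext.
  have -> : I i = \int[mu]_(x in [set x | q x < +oo]) (`|(f i x)%:E / b%:E| `^ fine (q x)).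
    by apply: eq_integral => x _; rewrite fgE gee0_abs ?lee_fin.
  by [].
have I0 i : 0 <= I i by apply: integral_ge0 => x _; rewrite lee_fin powR_ge0.
have e0 i : 0 <= e i.
  by apply: ess_sup_gee; [exact: lebesgue_Rn_gt0|apply/nearW].
have gsum x : ((\sum_i f i x)%:E / (m%:R ^+ 2 * b)%:E = (\sum_i g i x / m%:R ^+ 2)%:E)%E.
  rewrite divEFinE ?mulr_gt0 ?exprn_gt0// -EFinM mulr_sumr; congr EFin.
  by apply: eq_bigr => i _; rewrite /g invfM; ring.
have gsum0 x : (0 <= \sum_i g i x / m%:R ^+ 2)%R.
  by apply: sumr_ge0 => i _; rewrite divr_ge0// exprn_ge0// ltW.
apply: vnorm_le; first by rewrite mulr_gt0// exprn_gt0.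
rewrite modularE.
apply: (@le_trans _ _ ((m%:R^-1)%:E * (\sum_i I i) + (m%:R^-1)%:E * (\sum_i e i))); last first.
  rewrite -muleDr ?ge0_adde_def ?inE ?sume_ge0// -big_split/= lee_pdivrMl// mule1.
  by rewrite -[m in leRHS]card_ord -sum1_card natr_sum -sumEFin; apply: lee_sum.
apply: leeD.
  apply: (@le_trans _ _ (\int[mu]_(x in D) (\sum_i (m%:R^-1 * g i x `^ fine (q x))%:E))).
    apply: le_integral_pointwise => x Dx.
    rewrite gsum gee0_abs ?lee_fin// poweR_EFin sumEFin lee_fin.
    by apply: powR_sum_le => //; exact: fine_exponent_ge1.
  have mgq i : measurable_fun D (fun x => (g i x `^ fine (q x))%:E).
    apply: measurable_funTS; apply/measurable_EFinP.
    exact: (measurable_powR2 (mg i) mfq).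
  have gq0 i x : D x -> 0 <= (g i x `^ fine (q x))%:E by rewrite lee_fin powR_ge0.
  under eq_integral => x _ do under eq_bigr => i _ do rewrite EFinM.
  rewrite (ge0_integral_sum mu mD (f := fun i x => (m%:R^-1)%:E * (g i x `^ fine (q x))%:E));
    last 2 first.
  - by move=> i; apply: emeasurable_funM; [exact: measurable_cst|exact: mgq].
  - by move=> i x Dx; rewrite mule_ge0 ?gq0// lee_fin invr_ge0 ltW.
  rewrite ge0_sume_distrr//; apply: lee_sum => i _.
  rewrite (ge0_integralZl_EFin _ mD (gq0 i) (mgq i)) ?invr_ge0 ?(ltW M0)//.
apply/ess_supP.
have : \forall x \ae mu, forall i, `|((fun x => (g i x)%:E) \_ [set x | q x = +oo]) x| <= e i.
  by apply: filter_forall => i; exact: ess_sup_ge.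
apply: filterS => x gx; rewrite patchE; case: ifPn => qx; last first.
  by rewrite /= normr0 mule_ge0 ?sume_ge0// lee_fin invr_ge0 ltW.
rewrite gsum gee0_abs ?lee_fin// -mulr_suml EFinM muleC.
rewrite lee_pmul ?lee_fin ?invr_ge0 ?exprn_ge0 ?sumr_ge0//.
  by rewrite lef_pV2 ?posrE// ?exprn_gt0// -[leLHS]expr1 ler_weXn2l// ler1n.
rewrite -sumEFin; apply: lee_sum => i _; have := gx i.
by rewrite patchE qx gee0_abs// lee_fin.
Qed.

Lemma vnorm_sum (q : Rn -> \bar R) (m : nat) (f : 'I_m -> Rn -> R) (b : R) :
  exponent q -> (0 < m)%N -> (forall i, measurable_fun setT (f i)) ->
  (forall i x, 0 <= f i x)%R ->
  (forall i, vnorm q (fun x => (f i x)%:E) <= b%:E) ->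
  vnorm q (fun x => (\sum_i f i x)%:E) <= (m%:R ^+ 2 * b)%:E.
Proof.
move=> eq m0 mf f0 fb; apply/lee_addgt0Pr => e e0.
have M0 : (0 < m%:R ^+ 2 :> R)%R by rewrite exprn_gt0// ltr0n.
rewrite -EFinD.
have -> : (m%:R ^+ 2 * b + e = m%:R ^+ 2 * (b + e / m%:R ^+ 2))%R.
  by field; rewrite pnatr_eq0 -lt0n.
apply: vnorm_sum_lt => [//|//|//|//|i]; apply: le_lt_trans (fb i) _.
by rewrite lte_fin ltrDl divr_gt0.
Qed.

End quasi_triangle.

(** * Positivity and Hoelder's inequality *)

Section vnorm_bounds.
Context (R : realType) (n : nat).
Local Notation Rn := (Rn R n).
Local Notation mu := (@lebesgue_Rn R n).

(** Raising a number c >= 1 to a power at least 1 increases it. *)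
Lemma modular_ge (q f : Rn -> \bar R) (F : set Rn) (c : R) : exponent q ->
  measurable F -> (1 <= c)%R -> (forall x, F x -> q x < +oo /\ c%:E <= f x) ->
  c%:E * mu F <= modular q f.
Proof.
move=> eq mF c1 Fqf; rewrite modularE -[leLHS]adde0 leeD//; last first.
  by apply: ess_sup_gee; [exact: lebesgue_Rn_gt0|apply/nearW].
have c0 : (0 <= c)%R by exact: le_trans c1.
rewrite -integral_cst// [leRHS]integral_mkcond [leLHS]integral_mkcond.
apply: le_integral_pointwise => x _; rewrite !patchE.
case: ifPn => [/set_mem Fx|_]; last by case: ifPn => // _; exact: poweR_ge0.
have [qx cf] := Fqf x Fx; rewrite mem_set// /cst.
have q1 := fine_exponent_ge1 eq qx.
apply: (@le_trans _ _ ((c `^ fine (q x))%:E)); first by rewrite lee_fin le1r_powR.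
rewrite -poweR_EFin; apply: gt0_ler_poweR; rewrite ?in_itv/= ?leey ?lee_fin ?c0 ?andbT//.
  exact: le_trans q1.
exact: le_trans cf (lee_abs _).
Qed.

Lemma exists_measure_ge (E : set Rn) (g : Rn -> R) : measurable_fun setT g ->
  measurable E -> 0 < mu E -> (forall x, E x -> 0 < g x)%R ->
  exists2 e : R, (0 < e)%R & 0 < mu (E `&` [set x | e <= g x]%R).
Proof.
move=> mg mE E0 Eg.
pose F (k : nat) := E `&` [set x | k.+1%:R^-1 <= g x]%R.
have mF k : measurable (F k).
  apply: measurableI => //; rewrite -[X in measurable X]setTI.
  exact: (measurable_fun_ler (measurable_cst _) mg).
apply: contrapT => /forall2NP noe.
have EF : E `<=` \bigcup_k F k.
  move=> x Ex; have [k kg] := ltr_add_invr (Eg x Ex); exists k => //; split=> //=.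
  by apply: ltW; rewrite add0r in kg.
suff /(negligibleS EF)[N [mN N0 EN]] : mu.-negligible (\bigcup_k F k).
  by move: E0; rewrite ltNge -N0 le_measure ?inE.
apply: negligible_bigcup => k; apply/negligibleP => //.
have [|/negP] := noe k.+1%:R^-1%R; first by rewrite invr_gt0 ltr0n.
by rewrite -leNgt => Fk; apply/eqP; rewrite eq_le Fk measure_ge0.
Qed.

(** On a part of E of positive measure g is at least some e > 0. Levels much smaller
    than e are not admissible there: where q is finite [modular_ge] makes the integral
    exceed 1, and where q is infinite the essential supremum does. *)
Lemma vnorm_gt0 (q : Rn -> \bar R) (E : set Rn) (g : Rn -> R) : exponent q ->
  measurable_fun setT g -> (forall x, 0 <= g x)%R ->
  measurable E -> 0 < mu E -> (forall x, E x -> 0 < g x)%R ->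
  0 < vnorm q (fun x => (g x)%:E).
Proof.
move=> eq mg g0 mE E0 Eg.
have [e e0] := exists_measure_ge mg mE E0 Eg.
set F := E `&` _ => F0.
have mF : measurable F.
  apply: measurableI => //; rewrite -[X in measurable X]setTI.
  exact: (measurable_fun_ler (measurable_cst _) mg).
pose F1 := F `&` [set x | q x < +oo].
pose F2 := F `&` ~` [set x | q x < +oo].
have mF1 : measurable F1 by apply: measurableI => //; exact: exponent_lt_measurable.
have mF2 : measurable F2.
  by apply: measurableI => //; apply: measurableC; exact: exponent_lt_measurable.
have fE t x : (0 < t)%R -> (g x)%:E / t%:E = (g x / t)%:E.
  by move=> t0; rewrite divEFinE// -EFinM mulrC.
have : 0 < mu F1 + mu F2.
  apply: lt_le_trans F0 _; rewrite -[X in mu X](setUIDK F [set x | q x < +oo]) setDE.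
  exact: measureU2.
suff ex0 : 0 < mu F1 \/ 0 < mu F2 -> exists2 t0 : R, (0 < t0)%R &
    forall t, (0 < t)%R -> modular q (fun x => (g x)%:E / t%:E) <= 1 -> (t0 <= t)%R.
  move=> F12; have [|t0 t00 ht] := ex0.
    have [|F10] := ltP 0 (mu F1); first by left.
    have F1E : mu F1 = 0 by apply/eqP; rewrite eq_le F10 measure_ge0.
    by right; move: F12; rewrite F1E add0e.
  apply: (@lt_le_trans _ _ t0%:E); first by rewrite lte_fin.
  by apply: le_ereal_inf_tmp => _ [t [tp gt] <-]; rewrite lee_fin; exact: ht.
case=> [F10|F20].
  have [d d0 dF] : exists2 d : R, (0 < d)%R & d%:E <= mu F1.
    move: F10; case: (mu F1) => [r|_|//]; last by exists 1%R; rewrite ?leey.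
    by rewrite lte_fin => r0; exists r.
  exists (Num.min e (e * d))%R => [|t t0 gt]; first by rewrite lt_min e0 mulr_gt0.
  rewrite leNgt lt_min; apply/negP => /andP[te ted].
  have : (e / t)%:E * mu F1 <= 1.
    apply: le_trans gt; apply: modular_ge => //; first by rewrite ler_pdivlMr// mul1r ltW.
    by move=> x [[_ /= ex] qx]; rewrite fE// lee_fin ler_pM2r// invr_gt0.
  apply/negP; rewrite -ltNge; apply: (@lt_le_trans _ _ ((e / t)%:E * d%:E)).
    by rewrite -EFinM lte_fin mulrAC ltr_pdivlMr// mul1r.
  by rewrite lee_pmul2l// lte_fin divr_gt0.
exists e => // t t0; rewrite modularE => gt; rewrite leNgt; apply/negP => te.
have : ess_sup mu (fun x => `|((fun x => (g x)%:E / t%:E) \_ [set x | q x = +oo]) x|) <= 1.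
  apply: le_trans gt; rewrite -[leLHS]add0e leeD2r//.
  by apply: integral_ge0 => x _; exact: poweR_ge0.
move=> /ess_supP [N [mN N0 hN]].
have : mu F2 <= mu N.
  apply: le_measure; rewrite ?inE// => x [[_ /= ex] /= /negP]; rewrite -leNgt leye_eq => /eqP qx.
  apply: hN => /=; apply/negP; rewrite -ltNge patchE mem_set//= fE// lte_fin.
  rewrite ger0_norm; last by rewrite divr_ge0// ltW.
  by rewrite ltr_pdivlMr// mul1r (lt_le_trans te).
by rewrite N0 leNgt F20.
Qed.

Lemma vnorm_indic_gt0 (q : Rn -> \bar R) (Q : set Rn) : exponent q ->
  measurable Q -> 0 < mu Q -> 0 < vnorm q (fun x => (\1_Q x)%:E).
Proof.
move=> eq mQ Q0; apply: (vnorm_gt0 (E := Q)) => //.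
by move=> x Qx; rewrite indicE mem_set.
Qed.

Lemma hoelder_conjugate_EFin (r : R) : (1 <= r)%R ->
  hoelder_conjugate r%:E = if r == 1%R then +oo else (r / (r - 1))%:E.
Proof.
move=> r1; case: eqP => [->|/eqP rn1]; first exact: hoelder_conjugate1.
rewrite /hoelder_conjugate/= eqe gt_eqF ?(lt_le_trans _ r1)// inver subr_eq0.
by rewrite (negbTE rn1) EFinM.
Qed.

Lemma exponent_conjugate (p : Rn -> \bar R) : exponent p -> (forall x, p x < +oo) ->
  exponent (conjugate_exponent p).
Proof.
move=> ep py; have [mp p1] := ep.
have pE x : p x = (fine (p x))%:E by move: (py x) (p1 x); case: (p x).
have r1 x : (1 <= fine (p x))%R by exact: fine_exponent_ge1.
have mr := measurable_fun_fine mp.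
split.
  rewrite /conjugate_exponent (_ : (fun x => _) = (fun x => if fine (p x) == 1%R then +oo
      else (fine (p x) / (fine (p x) - 1))%:E)); last first.
    by apply/funext => x; rewrite pE hoelder_conjugate_EFin//= .
  apply: measurable_fun_ifT.
  - exact: (measurable_fun_eqr mr (measurable_cst _)).
  - exact: measurable_cst.
  apply/measurable_EFinP; apply: measurable_funM; first exact: mr.
  have -> : (fun x => (fine (p x) - 1)^-1)%R = (fun x => (fine (p x) - 1) `^ (-1))%R.
    by apply/funext => x; rewrite powR_inv1// subr_ge0.
  apply: measurable_powR2; last exact: measurable_cst.
  by apply: measurable_funB; [exact: mr|exact: measurable_cst].
move=> x; rewrite /conjugate_exponent pE hoelder_conjugate_EFin//.
case: ifPn => [_|rn1]; first by rewrite leey.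
rewrite lee_fin ler_pdivlMr; first by rewrite mul1r gerBl.
by rewrite subr_gt0 lt_neqAle eq_sym rn1 r1.
Qed.

(** Young's inequality for g / a and 1 / b. Where p = 1 the conjugate exponent is
    infinite, and the essential bound g <= a takes its place. The constant 2
    bounds the sum of the two modulars. *)
Lemma vnorm_hoelder (p : Rn -> \bar R) (Q : set Rn) (g : Rn -> R) (a b : R) :
  exponent p -> (forall x, p x < +oo) -> measurable Q ->
  measurable_fun setT g -> (forall x, 0 <= g x)%R ->
  vnorm (conjugate_exponent p) (fun x => (g x * \1_Q x)%:E) < a%:E ->
  vnorm p (fun x => (\1_Q x)%:E) < b%:E ->
  \int[mu]_(x in Q) (g x)%:E <= (2 * (a * b))%:E.
Proof.
move=> ep py mQ mg g0 ga Qb; have [mp p1] := ep.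
have ep' := exponent_conjugate ep py.
have pE x : p x = (fine (p x))%:E by move: (py x) (p1 x); case: (p x).
have r1 x : (1 <= fine (p x))%R by exact: fine_exponent_ge1.
have gQ0 x : (0 <= g x * \1_Q x)%R by rewrite mulr_ge0.
have gQ0' x : 0 <= (g x * \1_Q x)%:E by rewrite lee_fin.
have [a0 ha] := vnorm_lt ep' gQ0' ga.
have Q0' x : 0 <= (\1_Q x)%:E :> \bar R by rewrite lee_fin.
have [b0 hb] := vnorm_lt ep Q0' Qb.
pose p' := conjugate_exponent p.
have [mp' p'1] := ep'.
pose u x := (g x * \1_Q x / a)%R; pose v x := (\1_Q x / b : R)%R.
have u0 x : (0 <= u x)%R by rewrite divr_ge0// ltW.
have v0 x : (0 <= v x)%R by rewrite divr_ge0// ltW.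
have uE x : (g x * \1_Q x)%:E / a%:E = (u x)%:E by rewrite divEFinE// -EFinM mulrC.
have vE x : (\1_Q x)%:E / b%:E = (v x)%:E by rewrite divEFinE// -EFinM mulrC.
have mv : measurable_fun setT v by apply: measurable_funM; [exact: measurable_indic|exact: measurable_cst].
have mu' : measurable_fun setT u.
  apply: measurable_funM; last exact: measurable_cst.
  by apply: measurable_funM; [exact: mg|exact: measurable_indic].
(* the two terms of Young's inequality; only the second one is left where p = 1 *)
pose h1 x := if p' x < +oo then (u x `^ fine (p' x))%R else 0%R.
pose h2 x := (v x `^ fine (p x))%R.
have h10 x : (0 <= h1 x)%R by rewrite /h1; case: ifP => // _; exact: powR_ge0.
have h20 x : (0 <= h2 x)%R by exact: powR_ge0.
have mh1 : measurable_fun setT h1.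
  apply: measurable_fun_ifT; last exact: measurable_cst.
    exact: (measurable_fun_lte mp' (measurable_cst _)).
  by apply: measurable_powR2; [exact: mu'|exact: measurable_fun_fine mp'].
have mh2 : measurable_fun setT h2.
  by apply: measurable_powR2; [exact: mv|exact: measurable_fun_fine mp].
have ih1 : \int[mu]_(x in Q) (h1 x)%:E <= 1.
  apply: le_trans ha; rewrite modularE -[leLHS]adde0 leeD//; last first.
    by apply: ess_sup_gee; [exact: lebesgue_Rn_gt0|apply/nearW].
  rewrite [leRHS]integral_mkcond [leLHS]integral_mkcond; apply: le_integral_pointwise => x _.
  rewrite !patchE uE gee0_abs ?lee_fin//.
  case: ifPn => [_|_]; last by case: ifP => // _; exact: poweR_ge0.
  rewrite /h1; case: ifPn => [px|px]; first by rewrite mem_set.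
  by case: ifP => // _; exact: poweR_ge0.
have ih2 : \int[mu]_(x in Q) (h2 x)%:E <= 1.
  apply: le_trans hb; rewrite modularE -[leLHS]adde0 leeD//; last first.
    by apply: ess_sup_gee; [exact: lebesgue_Rn_gt0|apply/nearW].
  rewrite [leRHS]integral_mkcond [leLHS]integral_mkcond; apply: le_integral_pointwise => x _.
  rewrite !patchE vE gee0_abs ?lee_fin//.
  have -> : x \in [set x | p x < +oo] by exact/mem_set/py.
  by case: ifPn => _; [rewrite poweR_EFin|exact: poweR_ge0].
have aeuv : \forall x \ae mu, Q x -> (u x * v x)%:E <= (h1 x + h2 x)%:E.
  have : ess_sup mu (fun x => `|((fun x => (g x * \1_Q x)%:E / a%:E) \_ [set x | p' x = +oo]) x|) <= 1.
    apply: le_trans ha; rewrite modularE -[leLHS]add0e leeD2r//.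
    by apply: integral_ge0 => x _; exact: poweR_ge0.
  move=> /ess_supP; apply: filterS => x + _; rewrite patchE lee_fin.
  have [px|px] := boolP (p' x < +oo).
    move=> _; rewrite /h1 px.
    have rn1 : fine (p x) != 1%R.
      by apply/negP => /eqP r; move: px; rewrite /p' /conjugate_exponent pE r hoelder_conjugate1.
    have r0 : (0 < fine (p x) - 1)%R by rewrite subr_gt0 lt_neqAle eq_sym rn1 r1.
    have p'E : fine (p' x) = (fine (p x) / (fine (p x) - 1))%R.
      by rewrite /p' /conjugate_exponent pE hoelder_conjugate_EFin// (negbTE rn1).
    have pp : (0 < fine (p x))%R by exact: lt_le_trans (r1 x).
    have p'p : (1 <= fine (p' x))%R by exact: fine_exponent_ge1.
    apply: (le_trans (conjugate_powR (u0 x) (v0 x) (lt_le_trans _ p'p) pp _)) => //.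
      by rewrite p'E; field; rewrite !gt_eqF.
    by apply: lerD; rewrite ler_pdivrMr ?(lt_le_trans _ p'p)// ler_peMr ?powR_ge0.
  have p'y : p' x = +oo by apply/eqP; rewrite -leye_eq leNgt.
  rewrite mem_set// uE gee0_abs ?lee_fin// => u1.
  have pr : fine (p x) = 1%R by have := hoelder_conjugate_eqy p'y => ->.
  rewrite /h1 (negbTE px) add0r /h2 pr powRr1//.
  by rewrite ler_piMl.
have -> : \int[mu]_(x in Q) (g x)%:E = \int[mu]_(x in Q) ((a * b)%:E * (u x * v x)%:E).
  apply: eq_integral => x xQ; rewrite /u /v -EFinM; congr EFin.
  have -> : \1_Q x = 1%R :> R by rewrite indicE xQ.
  by field; rewrite !gt_eqF.
have mEQ (f : Rn -> R) : measurable_fun setT f -> measurable_fun Q (fun x => (f x)%:E).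
  by move=> mf; apply: measurable_funTS; exact/measurable_EFinP.
have muv : measurable_fun Q (fun x => (u x * v x)%:E) := mEQ _ (measurable_funM mu' mv).
rewrite (ge0_integralZl_EFin _ mQ _ muv); last 2 first.
- by move=> x _; rewrite lee_fin mulr_ge0.
- by rewrite mulr_ge0// ltW.
have -> : (2 * (a * b) = a * b * 2)%R by ring.
rewrite (EFinM (a * b)) lee_pmul2l ?lte_fin ?mulr_gt0//.
apply: (@le_trans _ _ (\int[mu]_(x in Q) ((h1 x)%:E + (h2 x)%:E))).
  apply: (ae_ge0_le_integral mQ _ muv).
  - by move=> x _; rewrite lee_fin mulr_ge0.
  - by move=> x _; rewrite -EFinD lee_fin addr_ge0.
  - exact: (mEQ _ (measurable_funD mh1 mh2)).
  - exact: aeuv.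
rewrite (ge0_integralD _ mQ _ (mEQ _ mh1) _ (mEQ _ mh2)); last 2 first.
- by move=> x _; rewrite lee_fin.
- by move=> x _; rewrite lee_fin.
by rewrite (_ : 2%:E = 1 + 1)// leeD.
Qed.

End vnorm_bounds.

(** * Averages and the norm of an indicator *)

Section averages.
Context (R : realType) (n : nat).
Local Notation Rn := (Rn R n).
Local Notation mu := (@lebesgue_Rn R n).

Lemma modular_EFin (r : Rn -> R) (f : Rn -> \bar R) :
  modular (EFin \o r) f = \int[mu]_x (`|f x| `^ r x).
Proof.
rewrite modularE (_ : [set x | (EFin \o r) x < +oo] = setT); last first.
  by apply/seteqP; split => // x _ /=; exact: ltry.
rewrite (_ : [set x | (EFin \o r) x = +oo] = set0); last first.
  by apply/seteqP; split.
rewrite (_ : (fun x => _) = cst 0); last first.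
  by apply/funext => x; rewrite patchE in_set0 /= normr0.
by rewrite ess_sup_cst ?adde0//; exact: lebesgue_Rn_gt0.
Qed.

Lemma modular_indic (r : Rn -> R) (Q : set Rn) (g : Rn -> R) :
  (forall x, 1 <= r x)%R -> (forall x, 0 <= g x)%R ->
  modular (EFin \o r) (fun x => (g x * \1_Q x)%:E) =
  \int[mu]_(x in Q) (g x `^ r x)%:E.
Proof.
move=> r1 g0; rewrite modular_EFin [RHS]integral_mkcond; apply: eq_integral => x _.
rewrite patchE indicE gee0_abs ?lee_fin ?mulr_ge0//.
case: ifPn => xQ; first by rewrite mulr1 poweR_EFin.
by rewrite mulr0 poweR_EFin powR0// gt_eqF// (lt_le_trans _ (r1 x)).
Qed.

(** The section variables are those of one cube Q of measure v. The level s, defined by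
    s^q |Q| = 1, is a candidate for the inverse of the norm of 1_Q; hypothesis rq
    ensures that powers of max (s, h) with exponent r - q or q - r are at most e^D. The correction
    h is 0 on small cubes and takes care of points far from the origin on large ones. *)
Section level_estimate.
Variables (r h : Rn -> R) (Q : set Rn) (q s v D H E : R).
Hypotheses (mr : measurable_fun setT r) (r1 : forall x, (1 <= r x)%R).
Hypotheses (mQ : measurable Q) (Qv : mu Q = v%:E) (v0 : (0 < v)%R).
Hypotheses (q1 : (1 <= q)%R) (s0 : (0 < s)%R) (sqv : (s `^ q * v = 1)%R).
Hypotheses (mh : measurable_fun setT h) (h01 : forall x, (0 <= h x <= 1)%R).
Hypothesis rq : forall x, Q x -> (`|r x - q| * `|ln (Num.max s (h x))| <= D)%R.
Hypotheses (hH : \int[mu]_(x in Q) (h x)%:E <= H%:E) (H0 : (0 <= H)%R)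
  (E0 : (0 <= E)%R) (HE : (H / v <= E * s)%R).

Let sg x := Num.max s (h x).

Let sg0 x : (0 < sg x)%R. Proof. by rewrite lt_max s0. Qed.

Let sg_powR_sub x : Q x -> (sg x `^ (r x - q) <= expR D)%R /\ (sg x `^ (q - r x) <= expR D)%R.
Proof.
move=> Qx; rewrite /powR gt_eqF// !ler_expR.
have := rq Qx; rewrite -normrM => rqx; split; apply: le_trans rqx.
  exact: ler_norm.
by rewrite -normrN -mulNr opprB ler_norm.
Qed.

(** Values of u below the level max (s, h) are absorbed by s + h. For larger ones
    u = u^r u^(1 - r) is at most u^r times the power 1 - r of the level, whose exponent
    can be changed to 1 - q at the cost of the factor e^D. *)
Lemma pointwise_average x (u : R) : Q x -> (0 <= u)%R ->
  (u <= s + h x + expR D * s `^ (1 - q) * u `^ r x)%R.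
Proof.
move=> Qx u0; have /andP[h0 h1] := h01 x.
have c0 : (0 <= expR D * s `^ (1 - q) * u `^ r x)%R.
  by rewrite !mulr_ge0 ?powR_ge0// expR_ge0.
have [us|su] := leP u (sg x).
  apply: (le_trans us); apply: (@le_trans _ _ (s + h x)%R); last by rewrite lerDl.
  by rewrite ge_max lerDl h0/= lerDr ltW.
apply: (@le_trans _ _ (expR D * s `^ (1 - q) * u `^ r x)%R); last first.
  by rewrite lerDr addr_ge0// ltW.
have up : (0 < u)%R by exact: lt_trans su.
rewrite -[leLHS](powRr1 u0) -[in leLHS](subrK (r x) 1%R).
rewrite powRD; last by rewrite (gt_eqF up) implybT.
rewrite ler_wpM2r ?powR_ge0//.
apply: (@le_trans _ _ (sg x `^ (1 - r x))%R).
  rewrite (_ : 1 - r x = - (r x - 1))%R; last by ring.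
  rewrite !powRN lef_pV2 ?posrE ?powR_gt0//.
  by apply: ge0_ler_powR; rewrite ?nnegrE ?subr_ge0 ?(ltW up) ?(ltW (sg0 x)) ?(ltW su).
rewrite (_ : 1 - r x = (q - r x) + (1 - q))%R; last by ring.
rewrite powRD; last by rewrite (gt_eqF (sg0 x)) implybT.
apply: ler_pM; rewrite ?powR_ge0//; first by have [] := sg_powR_sub Qx.
rewrite (_ : 1 - q = - (q - 1))%R; last by ring.
rewrite !powRN lef_pV2 ?posrE ?powR_gt0//.
apply: ge0_ler_powR; rewrite ?nnegrE ?subr_ge0 ?(ltW s0) ?(ltW (sg0 x))//.
by rewrite /sg le_max lexx.
Qed.

(** Here the exponent r is changed to q; since h <= 1 and q >= 1, h^q <= h. *)
Lemma pointwise_level x : Q x -> (s `^ r x <= expR D * (s `^ q + h x))%R.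
Proof.
move=> Qx; have /andP[h0 h1] := h01 x.
apply: (@le_trans _ _ (sg x `^ r x)%R).
  apply: ge0_ler_powR; rewrite ?nnegrE ?(ltW s0) ?(ltW (sg0 x))//.
    exact: le_trans (r1 x).
  by rewrite /sg le_max lexx.
rewrite (_ : r x = (r x - q) + q)%R; last by ring.
rewrite powRD; last by rewrite (gt_eqF (sg0 x)) implybT.
apply: ler_pM; rewrite ?powR_ge0//; first by have [] := sg_powR_sub Qx.
rewrite /sg; case: (leP s (h x)) => [sh|hs]; last by rewrite lerDl.
apply: (@le_trans _ _ (h x)); last by rewrite lerDr powR_ge0.
have hp : (0 < h x)%R by exact: lt_le_trans sh.
by rewrite -[leRHS](powRr1 h0); apply: ger_powR => //; rewrite hp.
Qed.

Let mpow (g : Rn -> R) : measurable_fun setT g ->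
  measurable_fun setT (fun x => g x `^ r x)%R.
Proof. by move=> mg; exact: measurable_powR2. Qed.

Let icst (c : R) : \int[mu]_(x in Q) c%:E = (c * v)%:E.
Proof. by rewrite EFinM -Qv; exact: integral_cst. Qed.

(** As s^q |Q| = 1, the terms of [pointwise_average] integrate to multiples of s |Q|. *)
Lemma average_le_level (g : Rn -> R) : measurable_fun setT g ->
  (forall x, 0 <= g x)%R -> \int[mu]_(x in Q) (g x `^ r x)%:E <= 1 ->
  \int[mu]_(x in Q) (g x)%:E <= ((1 + E + expR D) * s * v)%:E.
Proof.
move=> mg g0 gr.
have c0 : (0 <= expR D * s `^ (1 - q))%R by rewrite mulr_ge0 ?powR_ge0// expR_ge0.
have h0 x : (0 <= h x)%R by have /andP[] := h01 x.
apply: (@le_trans _ _ (\int[mu]_(x in Q) (s%:E + (h x)%:E +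
    (expR D * s `^ (1 - q))%:E * (g x `^ r x)%:E))).
  apply: le_integral_pointwise => x Qx.
  by rewrite -EFinM -!EFinD lee_fin; exact: pointwise_average.
have mgr : measurable_fun Q (fun x => (g x `^ r x)%:E).
  by apply: measurable_funTS; apply/measurable_EFinP; exact: mpow.
have mhQ : measurable_fun Q (EFin \o h) by apply: measurable_funTS; apply/measurable_EFinP.
have msQ : measurable_fun Q (fun=> s%:E) by exact: measurable_cst.
rewrite (ge0_integralD _ mQ _ (emeasurable_funD msQ mhQ) _
  (emeasurable_funM (measurable_cst _) mgr)); last 2 first.
- by move=> x _; rewrite -EFinD lee_fin addr_ge0// ltW.
- by move=> x _; rewrite mule_ge0// lee_fin// powR_ge0.
rewrite (ge0_integralD _ mQ _ msQ _ mhQ); last 2 first.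
- by move=> x _; rewrite lee_fin ltW.
- by move=> x _; rewrite lee_fin.
rewrite (ge0_integralZl_EFin _ mQ _ mgr)//; last by move=> x _; rewrite lee_fin powR_ge0.
rewrite icst.
apply: (@le_trans _ _ ((s * v)%:E + H%:E + (expR D * s `^ (1 - q))%:E * 1)).
  by rewrite !leeD// lee_wpmul2l// lee_fin.
rewrite mule1 -!EFinD lee_fin.
have -> : ((1 + E + expR D) * s * v = s * v + (E * s) * v + expR D * s * v)%R by ring.
rewrite !lerD//; first by rewrite -ler_pdivrMr.
rewrite -!mulrA ler_pM2l ?expR_gt0// powRD; last by rewrite (gt_eqF s0) implybT.
rewrite powRr1 ?(ltW s0)// ler_pM2l// powRN.
by rewrite -[leLHS]mulr1 -sqv mulKf// gt_eqF// powR_gt0.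
Qed.

Lemma level_integral : \int[mu]_(x in Q) (s `^ r x)%:E <= (expR D * (1 + H))%:E.
Proof.
have h0 x : (0 <= h x)%R by have /andP[] := h01 x.
apply: (@le_trans _ _ (\int[mu]_(x in Q) ((expR D)%:E * ((s `^ q)%:E + (h x)%:E)))).
  apply: le_integral_pointwise => x Qx.
  by rewrite -EFinD -EFinM lee_fin; exact: pointwise_level.
have mhQ : measurable_fun Q (EFin \o h) by apply: measurable_funTS; apply/measurable_EFinP.
have msQ : measurable_fun Q (fun=> (s `^ q)%:E) by exact: measurable_cst.
rewrite (ge0_integralZl_EFin _ mQ _ (emeasurable_funD msQ mhQ)) ?expR_ge0//; last first.
  by move=> x _; rewrite -EFinD lee_fin addr_ge0// powR_ge0.
rewrite (ge0_integralD _ mQ _ msQ _ mhQ); last 2 first.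
- by move=> x _; rewrite lee_fin powR_ge0.
- by move=> x _; rewrite lee_fin.
by rewrite icst sqv EFinM lee_pmul2l ?lte_fin ?expR_gt0// EFinD leeD.
Qed.

(** [level_integral] bounds the norm of 1_Q by a multiple of 1 / s, and
    [average_le_level] bounds the averages of functions of norm at most 1 by a multiple
    of s; the product does not involve s. *)
Lemma average_le_vnorm : exists2 l : R, (0 < l)%R /\ vnorm (EFin \o r) (fun x => (\1_Q x)%:E) = l%:E &
  forall g : Rn -> R, measurable_fun setT g -> (forall x, 0 <= g x)%R ->
  average Q (EFin \o g) <=
    ((1 + E + expR D) * (expR D * (1 + H)))%:E *
    (l^-1%:E * vnorm (EFin \o r) (fun x => (g x * \1_Q x)%:E)).
Proof.
have ep : exponent (EFin \o r).
  by split=> [|x /=]; [apply/measurable_EFinP|rewrite lee_fin].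
set B := (expR D * (1 + H))%R.
set K := (1 + E + expR D)%R.
have B0 : (0 < B)%R by rewrite mulr_gt0 ?expR_gt0// ltr_wpDr.
have K0 : (0 < K)%R by rewrite ltr_wpDl ?expR_gt0// addr_ge0.
have D0 : (1 <= expR D)%R.
  rewrite -expR0 ler_expR.
  have [x Qx] : exists x, Q x.
    apply: contrapT => /forallNP Qn; move: v0; rewrite -lte_fin -Qv (_ : Q = set0).
      by rewrite measure0 ltxx.
    by apply/seteqP; split.
  by apply: le_trans (rq Qx); rewrite mulr_ge0.
have B1 : (1 <= B)%R by rewrite -[leLHS]mulr1 ler_pM// lerDl.
set lam := vnorm _ _.
have lam0 : 0 < lam by apply: vnorm_indic_gt0 => //; rewrite Qv lte_fin.
have lamB : lam <= (B / s)%:E.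
  apply: vnorm_le; first exact: divr_gt0.
  rewrite (_ : (fun x => _) = (fun x => (s / B * \1_Q x)%:E)); last first.
    apply/funext => x; rewrite divEFinE ?divr_gt0// -EFinM; congr (_%:E)%R.
    by rewrite invf_div.
  rewrite modular_indic//; last by move=> _; rewrite divr_ge0// ltW.
  apply: (@le_trans _ _ (\int[mu]_(x in Q) (B^-1%:E * (s `^ r x)%:E))).
    apply: le_integral_pointwise => x _; rewrite -EFinM lee_fin mulrC.
    by apply: ge1r_powRZ => //; rewrite ?(ltW s0)// invr_gt0 B0 invf_le1.
  have mpQ : measurable_fun Q (fun x => (s `^ r x)%:E).
    apply: measurable_funTS; apply/measurable_EFinP.
    exact: (mpow (measurable_cst s)).
  rewrite (ge0_integralZl_EFin _ mQ _ mpQ); last 2 first.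
  - by move=> x _; rewrite lee_fin powR_ge0.
  - by rewrite invr_ge0 ltW.
  by rewrite lee_pdivrMl// mule1; exact: level_integral.
have lamfin : lam \is a fin_num.
  by rewrite ge0_fin_numE ?(ltW lam0)// (le_lt_trans lamB)// ltry.
pose l := fine lam.
have lamE : lam = l%:E by rewrite fineK.
have l0 : (0 < l)%R by rewrite -lte_fin -lamE.
exists l => // g mg g0.
set N := vnorm _ _.
have gQ0 x : 0 <= (g x * \1_Q x)%:E by rewrite lee_fin mulr_ge0.
have step t : N < t%:E -> average Q (EFin \o g) <= (K * B)%:E * (l^-1%:E * t%:E).
  move=> /(vnorm_lt ep gQ0)[t0].
  rewrite (_ : (fun x => _) = (fun x => (g x / t * \1_Q x)%:E)); last first.
    by apply/funext => x; rewrite divEFinE// -EFinM mulrCA mulrA.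
  rewrite modular_indic//; last by move=> x; rewrite divr_ge0// ltW.
  move=> gt; have := average_le_level _ _ gt.
  have mgt : measurable_fun setT (fun x => g x / t)%R.
    exact: (measurable_funM mg (measurable_cst _)).
  move=> /(_ mgt (fun x => divr_ge0 (g0 x) (ltW t0))) gtv.
  rewrite /average Qv inver gt_eqF// lee_pdivrMl//.
  rewrite (_ : \int[mu]_(x in Q) _ = t%:E * \int[mu]_(x in Q) (g x / t)%:E); last first.
    have mgtQ : measurable_fun Q (fun x => (g x / t)%:E).
      by apply: measurable_funTS; apply/measurable_EFinP; exact: mgt.
    rewrite -(ge0_integralZl_EFin _ mQ _ mgtQ); last 2 first.
    - by move=> x _; rewrite lee_fin divr_ge0// ltW.
    - exact: ltW.
    apply: eq_integral => x _; rewrite -EFinM /=; congr EFin.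
    by rewrite mulrC divfK// gt_eqF.
  apply: (@le_trans _ _ (t%:E * (K * s * v)%:E)); first by rewrite lee_pmul2l// lte_fin.
  rewrite -!EFinM lee_fin.
  have sB : (s <= B / l)%R.
    by move: lamB; rewrite lamE lee_fin ler_pdivlMr// mulrC -ler_pdivlMr.
  rewrite (_ : v * (K * B * (l^-1 * t)) = t * (K * (B / l) * v))%R; last by ring.
  by rewrite ler_pM2l// ler_pM2r// ler_pM2l.
have [Ny|Nfin] := eqVneq N +oo.
  by rewrite Ny !gt0_muley ?leey// ?lte_fin ?invr_gt0// mulr_gt0.
have {Nfin} : N \is a fin_num by rewrite ge0_fin_numE ?vnorm_ge0// ltey.
move=> Nfin; pose b := fine N.
have NE : N = b%:E by rewrite fineK.
rewrite NE in step *; apply/lee_addgt0Pr => e e0.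
apply: le_trans (step (b + e / (K * B * l^-1))%R _) _.
  by rewrite lte_fin ltrDl divr_gt0// mulr_gt0 ?invr_gt0// mulr_gt0.
rewrite -!EFinM -EFinD lee_fin le_eqVlt; apply/orP; left; apply/eqP.
by field; rewrite !gt_eqF.
Qed.

End level_estimate.
End averages.

(** * Log-Hoelder exponents on small cubes *)

Section small_cubes.
Context (R : realType) (n : nat).
Local Notation Rn := (Rn R n).
Local Notation mu := (@lebesgue_Rn R n).
Local Open Scope ring_scope.

Lemma mem_side (x a l : R) (b1 b2 : bool) :
  x \in Interval (BSide b1 a) (BSide b2 (a + l)) -> a <= x <= a + l.
Proof. by rewrite in_itv/= => /andP[/lteifW -> /lteifW]. Qed.

Lemma enorm_ge0 (x : Rn) : 0 <= enorm x.
Proof. exact: sqrtr_ge0. Qed.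

Lemma coord_le_enorm (x : Rn) i : `|coord x i| <= enorm x.
Proof.
rewrite -sqrtr_sqr /enorm ler_wsqrtr// (bigD1 i)//= lerDl.
by apply: sumr_ge0 => j _; exact: sqr_ge0.
Qed.

Lemma enorm_sub_side (Q : set Rn) l I x y : has_sides Q l I -> Q x -> Q y ->
  enorm (x - y) <= n.+1%:R * l.
Proof.
move=> [l0 -> hI] Qx Qy; rewrite /enorm.
have nl0 : 0 <= n.+1%:R * l by rewrite mulr_ge0 ?ler0n// ltW.
rewrite -[leRHS]ger0_norm// -sqrtr_sqr ler_wsqrtr//.
apply: (@le_trans _ _ (\sum_(i < n) l ^+ 2)).
  apply: ler_sum => i _; have [a [b1 [b2 IE]]] := hI i.
  have := Qx i; have := Qy i; rewrite IE => /mem_side/andP[ay yl] /mem_side/andP[ax xl].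
  have -> : coord (x - y) i = coord x i - coord y i by rewrite /coord !mxE.
  by rewrite -real_normK ?num_real// lerXn2r ?nnegrE ?(ltW l0)// ler_norml; lra.
rewrite sumr_const card_ord -(mulr_natl (l ^+ 2)) exprMn ler_pM2r ?exprn_gt0//.
by rewrite -natrX ler_nat (leq_trans (leqnSn n))// expnS expn1 leq_pmulr.
Qed.

(** Two points of Q are at distance at most (n + 1) l <= sqrt l / 4, so the local
    condition bounds the oscillation of r on Q by 2 C0 / (- ln l). The logarithm of
    the level s = l^(- n / q) is at most n (- ln l), and D is the product of these
    two bounds. No correction h is needed. *)
Lemma average_small_cube (r : Rn -> R) (C0 : R) : measurable_fun setT r ->
  (forall x, 1 <= r x) -> 0 < C0 ->
  (forall x y : Rn, enorm (x - y) < 2^-1 -> `|r x - r y| <= - (C0 / ln (enorm (x - y)))) ->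
  forall Q l I, cube Q -> has_sides Q l I -> l <= (16 * n.+1%:R ^+ 2)^-1 ->
  let D := 2 * C0 * n%:R in
  exists2 lam : R, 0 < lam /\ vnorm (EFin \o r) (fun x => (\1_Q x)%:E) = lam%:E &
  forall g : Rn -> R, measurable_fun setT g -> (forall x, 0 <= g x)%R ->
  (average Q (EFin \o g) <= ((1 + 0 + expR D) * (expR D * (1 + 0)))%:E *
    (lam^-1%:E * vnorm (EFin \o r) (fun x => (g x * \1_Q x)%:E)))%E.
Proof.
move=> mr r1 C00 rC Q l I cQ sQ ll0 D; have [l0 QE hI] := sQ.
have N1 : 1 <= n.+1%:R :> R by rewrite ler1n.
have N2 : 1 <= n.+1%:R ^+ 2 :> R by rewrite exprn_ege1.
have lN : n.+1%:R ^+ 2 * l <= 16^-1.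
  move: ll0; rewrite invfM -ler_pdivrMr ?invr_gt0 ?(lt_le_trans _ N2)//.
  by rewrite invrK mulrC.
have l16 : l <= 16^-1.
  by apply: le_trans lN; rewrite ler_peMl// ltW.
have lnl : ln l < 0 by apply: ln_lt0; rewrite l0/=; lra.
(* any value of r on Q can serve as q *)
have [x0 Qx0] : exists x, Q x.
  have [a [l' [b1 [b2 [l'0 QE']]]]] := cQ.
  exists (\row_i (coord a i + l' / 2)); rewrite QE' /= => i.
  have -> : coord (\row_i (coord a i + l' / 2) : Rn) i = coord a i + l' / 2.
    by rewrite {1}/coord mxE.
  by rewrite in_itv/=; apply/andP; split; apply: lteifS; lra.
set q := r x0.
have q0 : 0 < q by exact: lt_le_trans (r1 x0).
have osc x : Q x -> `|r x - q| <= 2 * C0 / - ln l.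
  move=> Qx; set d := enorm (x - x0).
  have d0 : 0 <= d by exact: enorm_ge0.
  have dl : d ^+ 2 <= n.+1%:R ^+ 2 * l ^+ 2.
    by rewrite -exprMn lerXn2r ?nnegrE// ?mulr_ge0 ?ler0n ?(ltW l0)//; exact: enorm_sub_side sQ Qx Qx0.
  have dl' : d ^+ 2 <= 16^-1 * l.
    by apply: (le_trans dl); rewrite expr2 mulrA ler_pM2r.
  have d2 : d < 2^-1.
    rewrite -(ltr_pXn2r (n:=2))// ?nnegrE ?invr_ge0//.
    by apply: le_lt_trans dl' _; lra.
  apply: (le_trans (rC _ _ d2)); rewrite -/d.
  move: d0; rewrite le_eqVlt => /orP[/eqP<-|dp].
    by rewrite ln0// invr0 mulr0 oppr0 divr_ge0 ?mulr_ge0 ?(ltW C00)// oppr_ge0 ltW.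
  have lnd : 2 * ln d <= ln l.
    have <- : ln (d ^+ 2) = 2 * ln d by rewrite lnXn// mulr_natl.
    rewrite ler_ln ?posrE ?exprn_gt0//.
    by apply: (le_trans dl'); lra.
  rewrite -mulrN -invrN; set a := - ln d; set b := - ln l.
  have b0 : 0 < b by rewrite oppr_gt0.
  have ba : b <= 2 * a by rewrite /a /b; lra.
  have a0 : 0 < a by lra.
  rewrite ler_pdivrMr// mulrAC ler_pdivlMr// (mulrC 2) -mulrA ler_pM2l//.
set s : R := (l ^+ n) `^ (- q^-1).
have ln0 : 0 < l ^+ n by rewrite exprn_gt0.
have s0 : 0 < s by rewrite powR_gt0.
have lns : ln s = q^-1 * (n%:R * - ln l).
  by rewrite ln_powR lnXn// -[ln l *+ n]mulr_natl; ring.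
apply: (@average_le_vnorm _ _ r (fun=> 0) Q q s (l ^+ n) D 0 0) => //.
- exact: measurable_cube.
- exact: (lebesgue_cube sQ).
- exact: r1.
- by rewrite -powRrM mulNr mulVf ?gt_eqF// powR_inv1 ?(ltW ln0)// mulVf// gt_eqF.
- by move=> _; rewrite lexx ler01.
- move=> x Qx; rewrite max_l ?(ltW s0)// lns.
  have L0 : 0 < - ln l by rewrite oppr_gt0.
  have p0 : 0 <= q^-1 * (n%:R * - ln l).
    by rewrite !mulr_ge0 ?ler0n ?invr_ge0 ?(ltW L0) ?(ltW q0).
  rewrite (ger0_norm p0).
  apply: (@le_trans _ _ (2 * C0 / - ln l * (n%:R * - ln l))).
    apply: ler_pM => //; first exact: osc.
    by rewrite ler_piMl ?mulr_ge0 ?ler0n ?(ltW L0)// invf_le1// r1.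
  by rewrite le_eqVlt; apply/orP; left; apply/eqP; rewrite /D; field; rewrite lt_eqF.
- by rewrite integral0.
- by rewrite !mul0r lexx.
Qed.
End small_cubes.

(** * An integrable function of polynomial decay *)

Section large_cubes.
Context (R : realType) (n : nat).
Local Notation Rn := (Rn R n).
Local Notation mu := (@lebesgue_Rn R n).
Local Open Scope ring_scope.

Definition dyadic_cube (k : nat) : set Rn :=
  [set x | forall i, coord x i \in `[- (2 ^+ k), 2 ^+ k]].

(** Half of the sum of 2^(-k(n+1)) over the dyadic cubes of index k <= K that contain x:
    its integral is bounded independently of K, while it decays only like a power of
    e + |x|. The sum is finite because only the points of one bounded cube matter. *)
Definition tail_weight (K : nat) (x : Rn) : R :=
  2^-1 * \sum_(k < K.+1) (2 ^+ k) ^- n.+1 * \1_(dyadic_cube k) x.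

Lemma measurable_dyadic_cube k : measurable (dyadic_cube k).
Proof. exact: (measurable_RnX (A := fun i => `[- (2 ^+ k), 2 ^+ k]%classic)). Qed.

Lemma lebesgue_dyadic_cube k : mu (dyadic_cube k) = ((2 * 2 ^+ k) ^+ n)%:E.
Proof.
rewrite (lebesgue_RnX (A := fun i => `[- (2 ^+ k), 2 ^+ k]%classic))//.
rewrite (eq_bigr (fun _ => (2 * 2 ^+ k)%:E)); last first.
  move=> i _; apply: (lebesgue_side (a := - 2 ^+ k) (b1 := true) (b2 := false)).
    by rewrite mulr_gt0// exprn_gt0.
  by congr (Interval _ (BSide _ _)); ring.
by rewrite -(big_morph EFin (@EFinM R) erefl) prodr_const card_ord.
Qed.

Lemma cube_sub_dyadic Q : cube Q -> exists K, Q `<=` dyadic_cube K.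
Proof.
move=> [a [l [b1 [b2 [l0 ->]]]]].
pose B := \sum_i `|coord a i| + l.
have B0 : 0 <= B by rewrite addr_ge0// ?(ltW l0)// sumr_ge0.
exists (Num.bound B) => x Qx i.
have aB : `|coord a i| + l <= B.
  by rewrite lerD2r (bigD1 i)//= lerDl sumr_ge0.
have BK : B <= 2 ^+ Num.bound B.
  apply: le_trans (ltW (archi_boundP B0)) _.
  by rewrite -natrX ler_nat ltnW// ltn_expl.
have /mem_side/andP[ax xl] := Qx i.
have := lerNnormlW (lexx `|coord a i|); have := ler_norm (coord a i).
by rewrite in_itv/= => ? ?; apply/andP; split; lra.
Qed.

Lemma sum_pow2_le K : \sum_(k < K) (2 ^+ k)^-1 <= 2 :> R.
Proof.
suff -> : \sum_(k < K) (2 ^+ k)^-1 = 2 - 2 * (2 ^+ K)^-1 :> R.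
  by rewrite gerBl// mulr_ge0// invr_ge0 exprn_ge0.
elim: K => [|K IH]; first by rewrite big_ord0 expr0; lra.
rewrite big_ord_recr/= IH exprS.
by field; rewrite expf_neq0.
Qed.

Lemma measurable_tail_weight K : measurable_fun setT (tail_weight K).
Proof.
apply: measurable_funM; first exact: measurable_cst.
apply: measurable_sum => k.
apply: measurable_funM; first exact: measurable_cst.
by apply: measurable_indic; exact: measurable_dyadic_cube.
Qed.

Lemma tail_weight_ge0 K x : 0 <= tail_weight K x.
Proof.
by rewrite mulr_ge0// sumr_ge0// => k _; rewrite mulr_ge0// invr_ge0 !exprn_ge0.
Qed.

Lemma tail_weight_le1 K x : tail_weight K x <= 1.
Proof.
rewrite -[leRHS](mulVf (x := 2))// ler_pM2l//; apply: le_trans (sum_pow2_le K.+1).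
apply: ler_sum => k _; rewrite exprS invfM -mulrA ler_piMr ?invr_ge0 ?exprn_ge0//.
rewrite mulr_ile1 ?invr_ge0 ?exprn_ge0 ?indicE ?lern1 ?leq_b1//.
by rewrite invf_le1 ?exprn_gt0// !exprn_ege1// ler1n.
Qed.

(** The dyadic cube of index k has measure (2^(k+1))^n, so its term contributes
    2^(n-1) 2^(-k). *)
Lemma integral_tail_weight K (Q : set Rn) : measurable Q ->
  (\int[mu]_(x in Q) (tail_weight K x)%:E <= (2 ^+ n)%:E)%E.
Proof.
move=> mQ; apply: (@le_trans _ _ (\int[mu]_x (tail_weight K x)%:E)%E).
  rewrite integral_mkcond; apply: le_integral_pointwise => x _.
  by rewrite patchE; case: ifP => // _; rewrite lee_fin tail_weight_ge0.
pose F (k : 'I_K.+1) (x : Rn) : \bar R :=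
  ((2^-1 * (2 ^+ k) ^- n.+1)%:E * (\1_(dyadic_cube k) x)%:E)%E.
have c0 k : 0 <= 2^-1 * (2 ^+ k) ^- n.+1 :> R by rewrite mulr_ge0// invr_ge0 !exprn_ge0.
have mI k : measurable_fun setT (fun x : Rn => (\1_(dyadic_cube k) x)%:E : \bar R).
  by apply/measurable_EFinP; apply: measurable_indic; exact: measurable_dyadic_cube.
have -> : (\int[mu]_x (tail_weight K x)%:E = \int[mu]_x (\sum_(k < K.+1) F k x))%E.
  apply: eq_integral => x _; rewrite /tail_weight mulr_sumr -sumEFin.
  by apply: eq_bigr => k _; rewrite /F -EFinM mulrA.
rewrite (ge0_integral_sum mu measurableT); last 2 first.
- by move=> k; apply: emeasurable_funM; [exact: measurable_cst|exact: mI].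
- by move=> k x _; rewrite mule_ge0 ?lee_fin.
apply: (@le_trans _ _ (\sum_(k < K.+1) (2^-1 * 2 ^+ n * (2 ^+ k)^-1)%:E)%E).
  apply: lee_sum => k _.
  rewrite (ge0_integralZl_EFin _ measurableT _ (mI k))//.
  rewrite (integral_indic mu measurableT (measurable_dyadic_cube k)) setIT.
  rewrite [X in (_ * X)%E](lebesgue_dyadic_cube k) -EFinM lee_fin le_eqVlt; apply/orP; left; apply/eqP.
  by rewrite exprMn exprS; field; rewrite ?expf_neq0.
rewrite sumEFin lee_fin -mulr_sumr.
apply: (@le_trans _ _ (2^-1 * 2 ^+ n * 2)); last by rewrite mulrAC mulVf// mul1r.
by rewrite ler_pM2l ?sum_pow2_le// mulr_gt0// exprn_gt0.
Qed.

Lemma expR1_ge2 : 2 <= expR 1 :> R.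
Proof. by apply: le_trans (expR_ge1Dx 1); rewrite lexx. Qed.

(** For the least k such that the dyadic cube of index k contains x one has
    2^k <= 2 (e + |x|) <= (e + |x|)^2, and the term of index k alone gives the bound. *)
Lemma tail_weight_lower K x : dyadic_cube K x ->
  0 < tail_weight K x /\
  - ln (tail_weight K x) <= (2 * n.+1 + 1)%:R * ln (expR 1 + enorm x).
Proof.
move=> Kx; set T := expR 1 + enorm x.
have T2 : 2 <= T by rewrite -[leLHS]addr0 lerD ?expR1_ge2// enorm_ge0.
have T0 : 0 < T by exact: lt_le_trans T2.
have [k [kK kx kT]] : exists k : nat, [/\ (k <= K)%N, dyadic_cube k x & 2 ^+ k <= 2 * T].
  have exk : exists k, `[< dyadic_cube k x >] by exists K; apply/asboolP.
  case: (ex_minnP exk) => k /asboolP kx kmin; exists k; split => //.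
    by apply: kmin; apply/asboolP.
  case: k kx kmin => [|k] kx kmin; first by rewrite expr0; lra.
  rewrite exprS ler_pM2l//; apply: contrapT => /negP; rewrite -ltNge => Tk.
  suff /asboolP/kmin : dyadic_cube k x by rewrite ltnn.
  move=> i; have := coord_le_enorm x i; rewrite ler_norml in_itv/= => /andP[xl xu].
  have eT : enorm x <= T by rewrite lerDr expR_ge0.
  by apply/andP; split; lra.
have hk : T ^- (2 * n.+1 + 1) <= tail_weight K x.
  apply: (@le_trans _ _ (2^-1 * (2 ^+ k) ^- n.+1)).
    rewrite addn1 exprS invfM ler_pM ?invr_ge0 ?exprn_ge0 ?(ltW T0)//.
      by rewrite lef_pV2 ?posrE.
    rewrite lef_pV2 ?posrE ?exprn_gt0// exprM lerXn2r ?nnegrE ?exprn_ge0 ?(ltW T0)//.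
    by apply: (le_trans kT); rewrite expr2 ler_pM2r.
  rewrite /tail_weight ler_pM2l//.
  have kK' : (k < K.+1)%N by rewrite ltnS.
  rewrite (bigD1 (Ordinal kK'))//= indicE mem_set// mulr1 lerDl.
  by rewrite sumr_ge0// => j _; rewrite mulr_ge0// invr_ge0 !exprn_ge0.
have h0 : 0 < tail_weight K x by apply: lt_le_trans hk; rewrite invr_gt0 exprn_gt0.
split=> //; rewrite lerNl mulr_natl -lnXn// -lnV ?posrE ?exprn_gt0//.
by rewrite ler_ln ?posrE ?invr_gt0 ?exprn_gt0.
Qed.

End large_cubes.

(** * Log-Hoelder exponents on large cubes *)

Section log_hoelder_averages.
Context (R : realType) (n : nat).
Local Notation Rn := (Rn R n).
Local Notation mu := (@lebesgue_Rn R n).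
Local Open Scope ring_scope.

(** The level max (s, h) with h = [tail_weight] is bounded above, and below by a power of
    1 / (e + |x|). Its logarithm is therefore compensated by the decay
    |r - roo| <= Coo / ln (e + |x|). *)
Lemma average_large_cube (r : Rn -> R) (roo Coo l0 : R) : measurable_fun setT r ->
  (forall x, 1 <= r x) -> 0 < Coo -> 0 < l0 ->
  (forall x : Rn, `|r x - roo| <= Coo / ln (expR 1 + enorm x)) ->
  exists2 C : R, 0 < C & forall Q l I, cube Q -> has_sides Q l I -> l0 <= l ->
  exists2 lam : R, 0 < lam /\ vnorm (EFin \o r) (fun x => (\1_Q x)%:E) = lam%:E &
  forall g : Rn -> R, measurable_fun setT g -> (forall x, 0 <= g x)%R ->
  (average Q (EFin \o g) <= C%:E *
    (lam^-1%:E * vnorm (EFin \o r) (fun x => (g x * \1_Q x)%:E)))%E.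
Proof.
move=> mr r1 Coo0 l00 rC.
(* the maximum is no further from r >= 1 than roo is *)
pose q := Num.max roo 1.
have q1 : 1 <= q by rewrite le_max lexx orbT.
have q0 : 0 < q by exact: lt_le_trans q1.
pose s0 := Num.max ((l0 ^+ n) `^ (- q^-1)) 1.
have s01 : 1 <= s0 by rewrite le_max lexx orbT.
pose N : R := (2 * n.+1 + 1)%:R.
pose D := N * Coo + Coo * ln s0.
pose H : R := 2 ^+ n.
(* H / |Q| = H s^q <= E s, as s <= s0 on cubes of side at least l0 *)
pose E := H * s0 `^ (q - 1).
exists ((1 + E + expR D) * (expR D * (1 + H))).
  have H0 : 0 <= H by exact: exprn_ge0.
  have E0 : 0 <= E by rewrite mulr_ge0 ?powR_ge0.
  have ? := expR_gt0 D.
  by rewrite mulr_gt0// ?mulr_gt0//; lra.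
move=> Q l I cQ sQ l0l; have [lp QE hI] := sQ.
have [K QK] := cube_sub_dyadic cQ.
have ln0 : 0 < l ^+ n by rewrite exprn_gt0.
set s : R := (l ^+ n) `^ (- q^-1).
have sp : 0 < s by rewrite powR_gt0.
have ss0 : s <= s0.
  rewrite le_max; apply/orP; left; rewrite /s !powRN lef_pV2 ?posrE ?powR_gt0 ?exprn_gt0//.
  apply: ge0_ler_powR; rewrite ?nnegrE ?exprn_ge0 ?invr_ge0 ?(ltW q0) ?(ltW l00) ?(ltW lp)//.
  by rewrite lerXn2r ?nnegrE ?(ltW l00) ?(ltW lp).
have sq : s `^ q = (l ^+ n)^-1.
  by rewrite -powRrM mulNr mulVf ?gt_eqF// powR_inv1 ?(ltW ln0).
apply: (@average_le_vnorm _ _ r (tail_weight K) Q q s (l ^+ n) D H E) => //.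
- exact: measurable_cube.
- exact: (lebesgue_cube sQ).
- by rewrite sq mulVf// gt_eqF.
- exact: measurable_tail_weight.
- by move=> x; rewrite tail_weight_ge0 tail_weight_le1.
- move=> x Qx; set T := expR 1 + enorm x.
  have [h0 hT] := tail_weight_lower (QK _ Qx).
  rewrite -/T -/N in hT.
  have T2 : 2 <= T by rewrite -[leLHS]addr0 lerD ?expR1_ge2// enorm_ge0.
  have lnT : 1 <= ln T.
    rewrite -[leLHS](expRK 1) ler_ln ?posrE ?expR_gt0//; last by lra.
    by rewrite lerDl enorm_ge0.
  have lnT0 : 0 < ln T by lra.
  have rq : `|r x - q| <= Coo / ln T.
    apply: le_trans (rC x); rewrite /q; case: (leP roo 1) => // ro1.
    have := r1 x => rx1; rewrite !ger0_norm ?subr_ge0//; last by lra.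
    by rewrite lerD2l lerN2.
  set sg := Num.max s _.
  have sg0 : 0 < sg by rewrite lt_max sp.
  have sgs0 : sg <= s0.
    by rewrite ge_max ss0/= (le_trans (tail_weight_le1 _ _)).
  have lns0 : 0 <= ln s0 by rewrite ln_ge0.
  have lnsg : `|ln sg| <= N * ln T + ln s0.
    have N0 : 0 <= N by rewrite ler0n.
    have NT : 0 <= N * ln T by rewrite mulr_ge0// ltW.
    have up : ln sg <= ln s0 by rewrite ler_ln ?posrE//; lra.
    have lo : ln (tail_weight K x) <= ln sg.
      by rewrite ler_ln ?posrE// le_max lexx orbT.
    by rewrite ler_norml; apply/andP; split; lra.
  apply: (@le_trans _ _ (Coo / ln T * (N * ln T + ln s0))).
    exact: ler_pM.
  rewrite mulrDr lerD//.
    by rewrite le_eqVlt; apply/orP; left; apply/eqP; field; rewrite gt_eqF.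
  rewrite ler_wpM2r// -[leRHS]mulr1 ler_pM2l// invf_le1//.
- exact: integral_tail_weight (measurable_cube cQ).
- exact: exprn_ge0.
- by rewrite mulr_ge0 ?powR_ge0 ?exprn_ge0.
- rewrite /E -sq -mulrA ler_pM2l ?exprn_gt0//.
  have -> : s `^ q = s `^ (q - 1) * s `^ 1.
    by rewrite -powRD ?subrK// (gt_eqF sp) implybT.
  rewrite powRr1 ?(ltW sp)// ler_pM2r//.
  by apply: ge0_ler_powR; rewrite ?nnegrE ?subr_ge0 ?(ltW sp)//; lra.
Qed.

(** Every use of the log-Hoelder conditions goes through this bound. A cube is small when
    its side is less than (16 (n + 1)^2)^-1, the threshold of [average_small_cube]. *)
Theorem log_hoelder_average (p : Rn -> \bar R) : exponent p -> LH p ->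
  exists2 C : R, 0 < C & forall Q, cube Q ->
  exists2 lam : R, 0 < lam /\ vnorm p (fun x => (\1_Q x)%:E) = lam%:E &
  forall g : Rn -> R, measurable_fun setT g -> (forall x, 0 <= g x)%R ->
  (average Q (EFin \o g) <= C%:E *
    (lam^-1%:E * vnorm p (fun x => (g x * \1_Q x)%:E)))%E.
Proof.
move=> [_ p1] [r [mr [C0 C00 hC0] [roo [Coo [_ Coo0 hCoo]]]] pE].
rewrite {}pE in p1 *.
have r1 x : 1 <= r x by have := p1 x; rewrite lee_fin.
pose l0 : R := (16 * n.+1%:R ^+ 2)^-1.
have l00 : 0 < l0 by rewrite invr_gt0 mulr_gt0// exprn_gt0// ltr0n.
have [C1 C10 hC1] := average_large_cube mr r1 Coo0 l00 hCoo.
pose D := 2 * C0 * n%:R.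
pose C2 := (1 + 0 + expR D) * (expR D * (1 + 0)).
have C20 : 0 < C2 by have ? := expR_gt0 D; rewrite /C2 mulr_gt0//; lra.
have le_C (C : R) (a b : \bar R) : (0 <= b)%E -> C <= C1 + C2 ->
    (a <= C%:E * b -> a <= (C1 + C2)%:E * b)%E.
  by move=> b0 CC /le_trans; apply; rewrite lee_wpmul2r// lee_fin.
exists (C1 + C2) => [|Q cQ]; first exact: addr_gt0.
have [l [I sQ]] := cubeP cQ.
have [l0l|ll0] := leP l0 l.
  have [lam lamE hg] := hC1 Q l I cQ sQ l0l; exists lam => // g mg g0.
  apply: le_C (hg g mg g0) => //; last by rewrite lerDl ltW.
  by rewrite mule_ge0 ?vnorm_ge0// lee_fin invr_ge0; case: lamE => /ltW.
have [lam lamE hg] := average_small_cube mr r1 C00 hC0 cQ sQ (ltW ll0).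
exists lam => // g mg g0.
apply: le_C (hg g mg g0) => //; last by rewrite lerDr ltW.
by rewrite mule_ge0 ?vnorm_ge0// lee_fin invr_ge0; case: lamE => /ltW.
Qed.

End log_hoelder_averages.

(** * Matrix norms and almost Auerbach bases *)

Section entrywise_norm.
Context (R : realType).
Local Open Scope ring_scope.
Local Notation C := R[i].
Local Notation normc := Normc.normc.

(** Comparable with the operator norm up to factors depending on the size, and visibly
    measurable in the entries. *)
Definition l1norm (a b : nat) (A : 'M[C]_(a, b)) : R := \sum_i \sum_j normc (A i j).

Lemma normc_ge0 (z : C) : 0 <= normc z.
Proof. by case: z => x y; exact: sqrtr_ge0. Qed.

Lemma normc_real (x : R) : normc (x%:C)%C = `|x|.
Proof. by rewrite /Normc.normc /= expr0n/= addr0 sqrtr_sqr. Qed.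

Lemma normc_sum (I : Type) (r : seq I) (F : I -> C) :
  normc (\sum_(i <- r) F i) <= \sum_(i <- r) normc (F i).
Proof.
elim/big_ind2 : _ => //.
- by rewrite Normc.normc0.
- by move=> x1 x2 y1 y2 h1 h2; apply: le_trans (le_normcD _ _) (lerD h1 h2).
Qed.

Lemma normc_prod (I : Type) (r : seq I) (F : I -> C) :
  normc (\prod_(i <- r) F i) = \prod_(i <- r) normc (F i).
Proof. by apply: (big_morph _ (@Normc.normcM R) (Normc.normc1 R)). Qed.

Lemma l1norm_ge0 a b (A : 'M[C]_(a, b)) : 0 <= l1norm A.
Proof. by apply: sumr_ge0 => i _; apply: sumr_ge0 => j _; exact: normc_ge0. Qed.

Lemma normc_le_l1norm a b (A : 'M[C]_(a, b)) i j : normc (A i j) <= l1norm A.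
Proof.
rewrite /l1norm (bigD1 i)//= (bigD1 j)//= -addrA lerDl addr_ge0//.
  by apply: sumr_ge0 => k _; exact: normc_ge0.
by apply: sumr_ge0 => k _; apply: sumr_ge0 => l _; exact: normc_ge0.
Qed.

Lemma l1norm_mulmx a b c (A : 'M[C]_(a, b)) (B : 'M[C]_(b, c)) :
  l1norm (A *m B) <= l1norm A * l1norm B.
Proof.
rewrite {2}/l1norm mulr_suml; apply: ler_sum => i _.
apply: (@le_trans _ _ (\sum_k \sum_j normc (A i j) * normc (B j k))).
  apply: ler_sum => k _; rewrite mxE; apply: le_trans (normc_sum _ _) _.
  by apply: ler_sum => j _; rewrite Normc.normcM.
rewrite exchange_big/= mulr_suml; apply: ler_sum => j _.
rewrite -mulr_sumr ler_wpM2l ?normc_ge0// /l1norm (bigD1 j)//= lerDl.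
by apply: sumr_ge0 => k _; apply: sumr_ge0 => l _; exact: normc_ge0.
Qed.

Lemma l1norm_eq0 a b (A : 'M[C]_(a, b)) : l1norm A = 0 -> A = 0.
Proof.
move=> A0; apply/matrixP => i j; rewrite mxE; apply: Normc.eq0_normc.
by apply/eqP; rewrite eq_le normc_ge0 andbT -A0 normc_le_l1norm.
Qed.

Lemma l1norm_tr a b (A : 'M[C]_(a, b)) : l1norm A^T = l1norm A.
Proof.
by rewrite /l1norm exchange_big/=; apply: eq_bigr => i _; apply: eq_bigr => j _; rewrite mxE.
Qed.

Lemma l1norm_rows a b (A : 'M[C]_(a, b)) : l1norm A = \sum_i l1norm (row i A).
Proof.
apply: eq_bigr => i _; rewrite /l1norm big_ord1.
by apply: eq_bigr => j _; rewrite mxE.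
Qed.

Lemma l1norm_row_le a b (A : 'M[C]_(a, b)) i : l1norm (row i A) <= l1norm A.
Proof.
by rewrite (l1norm_rows A) (bigD1 i)//= lerDl sumr_ge0// => j _; exact: l1norm_ge0.
Qed.

Lemma l1norm_rowE b (A : 'rV[C]_b) : l1norm A = \sum_j normc (A 0 j).
Proof. by rewrite /l1norm big_ord1. Qed.

Lemma normc_le_cvnorm m (v : 'cV[C]_m) i : normc (v i 0) <= cvnorm v.
Proof.
rewrite -[leLHS]ger0_norm ?normc_ge0// -sqrtr_sqr ler_wsqrtr//.
by rewrite (bigD1 i)//= lerDl sumr_ge0// => j _; rewrite exprn_ge0// normc_ge0.
Qed.

Lemma cvnorm_le_l1norm m (v : 'cV[C]_m) : cvnorm v <= l1norm v.
Proof.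
rewrite -[leRHS]ger0_norm ?l1norm_ge0// -sqrtr_sqr ler_wsqrtr//.
rewrite expr2 {1}/l1norm mulr_suml; apply: ler_sum => i _; rewrite big_ord1 expr2.
by rewrite ler_wpM2l ?normc_ge0// normc_le_l1norm.
Qed.

Lemma cvnorm_mulmx_le_l1norm m (A : 'M[C]_m) v : cvnorm v <= 1 -> cvnorm (A *m v) <= l1norm A.
Proof.
move=> v1; apply: le_trans (cvnorm_le_l1norm _) _.
rewrite /l1norm; apply: ler_sum => i _; rewrite big_ord1 mxE.
apply: le_trans (normc_sum _ _) _; apply: ler_sum => j _.
by rewrite Normc.normcM ler_piMr ?normc_ge0// (le_trans (normc_le_cvnorm _ _)).
Qed.

Lemma opnorm_ubound m (A : 'M[C]_m) :
  has_ubound [set cvnorm (A *m v) | v in [set v | cvnorm v <= 1]].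
Proof. by exists (l1norm A) => _ [v v1 <-]; exact: cvnorm_mulmx_le_l1norm. Qed.

Lemma opnorm_le_l1norm m (A : 'M[C]_m) : opnorm A <= l1norm A.
Proof.
apply: ge_sup; last by move=> _ [v v1 <-]; exact: cvnorm_mulmx_le_l1norm.
exists (cvnorm (A *m 0)), 0 => //=.
by rewrite /cvnorm big1 ?sqrtr0// => i _; rewrite mxE Normc.normc0 expr0n.
Qed.

Lemma opnorm_ge0 m (A : 'M[C]_m) : 0 <= opnorm A.
Proof.
have z : cvnorm (0 : 'cV[C]_m) = 0.
  by rewrite /cvnorm big1 ?sqrtr0// => i _; rewrite mxE Normc.normc0 expr0n.
apply: (ub_le_sup (opnorm_ubound A)); exists 0 => /=; first by rewrite z.
by rewrite mulmx0 z.
Qed.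

Lemma normc_le_opnorm m (A : 'M[C]_m) i j : normc (A i j) <= opnorm A.
Proof.
apply: (@le_trans _ _ (cvnorm (A *m delta_mx j 0))).
  apply: le_trans (normc_le_cvnorm _ i); rewrite mxE (bigD1 j)//= mxE !eqxx mulr1.
  rewrite big1 ?addr0// => k kj; rewrite mxE (negbTE kj) mulr0//.
apply: (ub_le_sup (opnorm_ubound A)); exists (delta_mx j 0) => //=.
rewrite /cvnorm (bigD1 j)//= mxE !eqxx Normc.normc1 expr1n big1 ?addr0 ?sqrtr1//.
by move=> k kj; rewrite mxE (negbTE kj) Normc.normc0 expr0n.
Qed.

Lemma l1norm_row_le_opnorm m (A : 'M[C]_m) i : l1norm (row i A) <= m%:R * opnorm A.
Proof.
rewrite l1norm_rowE -[X in X%:R]card_ord mulr_natl -sumr_const; apply: ler_sum => j _.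
by rewrite mxE normc_le_opnorm.
Qed.

Lemma normc_det_le m (A : 'M[C]_m) (b : R) : (forall i j, normc (A i j) <= b) ->
  normc (\det A) <= (m`!)%:R * b ^+ m.
Proof.
move=> Ab; apply: le_trans (normc_sum _ _) _.
have -> : (m`!)%:R * b ^+ m = \sum_(s : 'S_m) b ^+ m.
  by rewrite sumr_const card_Sn mulr_natl.
apply: ler_sum => s _; rewrite Normc.normcM normc_prod.
have -> : normc ((-1) ^+ s : C) = 1 :> R.
  case: (odd_perm s); rewrite ?expr1 ?expr0; last exact: Normc.normc1.
  apply/eqP; rewrite -(@pexpr_eq1 _ _ 2)// ?normc_ge0//.
  by rewrite expr2 -Normc.normcM mulrNN mulr1 Normc.normc1.
rewrite mul1r -[X in b ^+ X]card_ord -prodr_const; apply: ler_prod => i _.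
by rewrite normc_ge0 Ab.
Qed.

(** Among the matrices with rows in the unit ball of N, take U whose determinant is more
    than half the supremum, which is finite as N dominates a multiple of the entrywise
    norm. By Cramer's rule the j-th coordinate of a unit vector psi in the basis U is the
    quotient by det U of the determinant of U with its j-th row replaced by psi, which
    is at most the supremum. An exact maximiser would give Auerbach's lemma, with
    constant 1 but with a compactness argument. *)
Theorem almost_auerbach m (N : 'rV[C]_m -> R) (c : R) : 0 < c ->
  (forall phi, c * l1norm phi <= N phi) ->
  (forall (a : C) phi, a != 0 -> N (a *: phi) <= normc a * N phi) ->
  exists U : 'M[C]_m, [/\ U \in unitmx, forall j, N (row j U) <= 1 &
    forall phi j, normc ((phi *m invmx U) 0 j) <= 2 * N phi].
Proof.
move=> c0 cN Nhom.
pose S := [set normc (\det U) | U in [set U : 'M[C]_m | forall j, N (row j U) <= 1]].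
have ubS : has_ubound S.
  exists ((m`!)%:R * c^-1 ^+ m) => _ [U NU <-]; apply: normc_det_le => i j.
  have -> : U i j = row i U 0 j by rewrite mxE.
  apply: le_trans (normc_le_l1norm _ _ _) _.
  by rewrite -[leRHS]mulr1 -ler_pdivrMl ?invr_gt0// invrK (le_trans (cN _)).
have N0 phi : 0 <= N phi by apply: le_trans (cN _); rewrite mulr_ge0 ?l1norm_ge0// ltW.
(* a scalar matrix with rows in the unit ball shows that the supremum is positive *)
pose B : R := 1 + \sum_j N (delta_mx 0 j).
have B0 : 0 < B by rewrite ltr_pwDl// sumr_ge0.
have BC0 : ((B^-1)%:C)%C != 0 :> C by rewrite eq_complex /= eqxx andbT invr_eq0 gt_eqF.
have US : S (normc (\det ((B^-1)%:C%C%:M : 'M[C]_m))).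
  exists ((B^-1)%:C%C%:M) => //= j; rewrite -scalemx1 linearZ/= row1.
  apply: le_trans (Nhom _ _ BC0) _.
  rewrite normc_real ger0_norm ?invr_ge0 ?(ltW B0)// mulrC ler_pdivrMr// mul1r.
  by rewrite /B (bigD1 j)//= addrCA lerDl addr_ge0// sumr_ge0.
have s0 : 0 < sup S.
  apply: lt_le_trans (ub_le_sup ubS US); rewrite lt_neqAle normc_ge0 andbT eq_sym.
  apply/eqP => /Normc.eq0_normc/eqP; apply/negP.
  by rewrite det_scalar expf_neq0.
have [_ [U NU <-] sU] := @sup_adherent _ S (sup S / 2) (divr_gt0 s0 (ltr0n _ 2))
  (conj (ex_intro _ _ US) ubS).
have {}sU : sup S <= 2 * normc (\det U) by move: sU; lra.
have detU0 : 0 < normc (\det U) by lra.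
have detU : \det U != 0.
  by apply/eqP => d; move: detU0; rewrite d Normc.normc0 ltxx.
have uU : U \in unitmx by rewrite unitmxE unitfE.
exists U; split => // phi j.
have [t0|t0] := eqVneq (N phi) 0.
  have -> : phi = 0.
    apply: l1norm_eq0; apply/eqP; rewrite eq_le l1norm_ge0 andbT.
    by rewrite -(ler_pM2l c0) mulr0 -t0.
  by rewrite mul0mx mxE Normc.normc0 mulr_ge0// N0.
have tp : 0 < N phi by rewrite lt_neqAle eq_sym t0 N0.
set t := N phi in t0 tp *.
have tC0 : ((t^-1)%:C)%C != 0 :> C by rewrite eq_complex /= eqxx andbT invr_eq0.
pose psi := ((t^-1)%:C)%C *: phi.
have Npsi : N psi <= 1.
  apply: le_trans (Nhom _ _ tC0) _.
  by rewrite normc_real ger0_norm ?invr_ge0 ?(ltW tp)// mulVf.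
pose U' : 'M[C]_m := \matrix_i (if i == j then psi else row i U).
have rU' i : row i U' = if i == j then psi else row i U by rewrite rowK.
have dU' : normc (\det U') <= sup S.
  apply: (ub_le_sup ubS); exists U' => //= i; rewrite rU'; case: ifP => // _.
have detU'E : \det U' = (psi *m \adj U) 0 j.
  rewrite (expand_det_row _ j) mxE; apply: eq_bigr => k _.
  have -> : U' j k = psi 0 k by rewrite mxE eqxx.
  congr (_ * _); rewrite mxE /cofactor; congr (_ * \det _).
  apply/matrixP => a b; rewrite !mxE.
  by rewrite eq_sym (negbTE (neq_lift _ _)) mxE.
have phiE : (phi *m invmx U) 0 j = (t%:C)%C * (\det U' / \det U).
  have E1 : phi *m invmx U = (\det U)^-1 *: (phi *m \adj U).
    by rewrite /invmx uU -scalemxAr.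
  have E2 : psi *m \adj U = ((t^-1)%:C)%C *: (phi *m \adj U) by rewrite -scalemxAl.
  rewrite detU'E E1 E2 [LHS]mxE [X in _ * (X / _)]mxE.
  have -> : (t%:C)%C = ((t^-1)%:C)%C^-1 :> C by rewrite -fmorphV invrK.
  by field; rewrite detU fmorph_eq0.
rewrite phiE !Normc.normcM Normc.normcV normc_real ger0_norm ?(ltW tp)//.
rewrite mulrC ler_pM2r// ler_pdivrMr//; exact: le_trans sU.
Qed.

End entrywise_norm.

(** * Measurable complex matrices *)

Section complex_measurability.
Context (R : realType) d (T : measurableType d).
Local Open Scope ring_scope.
Local Notation C := R[i].
Local Notation normc := Normc.normc.

Definition measurableC (f : T -> C) : Prop :=
  measurable_fun setT (fun x => complex.Re (f x)) /\
  measurable_fun setT (fun x => complex.Im (f x)).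

Lemma measurable_inv_ge0 (f : T -> R) : measurable_fun setT f -> (forall x, 0 <= f x) ->
  measurable_fun setT (fun x => (f x)^-1).
Proof.
move=> mf f0; rewrite (_ : (fun x => _) = (fun x => f x `^ (-1))).
  exact: measurable_powR2 mf (measurable_cst _).
by apply/funext => x; rewrite powR_inv1.
Qed.

Lemma measurableC_cst (c : C) : measurableC (fun=> c).
Proof. by split; exact: measurable_cst. Qed.

Lemma measurableCD (f g : T -> C) : measurableC f -> measurableC g ->
  measurableC (fun x => f x + g x).
Proof.
move=> [rf jf] [rg jg]; split.
- rewrite (_ : (fun x => _) = (fun x => complex.Re (f x) + complex.Re (g x))).
    exact: measurable_funD rf rg.
  by apply/funext => x; case: (f x) (g x) => [a b] [a' b'].
- rewrite (_ : (fun x => _) = (fun x => complex.Im (f x) + complex.Im (g x))).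
    exact: measurable_funD jf jg.
  by apply/funext => x; case: (f x) (g x) => [a b] [a' b'].
Qed.

Lemma measurableCM (f g : T -> C) : measurableC f -> measurableC g ->
  measurableC (fun x => f x * g x).
Proof.
move=> [rf jf] [rg jg]; split.
- rewrite (_ : (fun x => _) = (fun x => complex.Re (f x) * complex.Re (g x) -
      complex.Im (f x) * complex.Im (g x))).
    exact: measurable_funB (measurable_funM rf rg) (measurable_funM jf jg).
  by apply/funext => x; case: (f x) (g x) => [a b] [a' b'].
- rewrite (_ : (fun x => _) = (fun x => complex.Re (f x) * complex.Im (g x) +
      complex.Im (f x) * complex.Re (g x))).
    exact: measurable_funD (measurable_funM rf jg) (measurable_funM jf rg).
  by apply/funext => x; case: (f x) (g x) => [a b] [a' b'].
Qed.

Lemma measurableCV (f : T -> C) : measurableC f -> measurableC (fun x => (f x)^-1).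
Proof.
move=> [rf jf].
have m2 : measurable_fun setT (fun x => (complex.Re (f x) ^+ 2 + complex.Im (f x) ^+ 2)^-1).
  apply: measurable_inv_ge0 => [|x]; last by rewrite addr_ge0// sqr_ge0.
  by apply: measurable_funD; exact: measurable_funX.
split.
- rewrite (_ : (fun x => _) = (fun x => complex.Re (f x) *
    (complex.Re (f x) ^+ 2 + complex.Im (f x) ^+ 2)^-1)); first exact: measurable_funM rf m2.
  by apply/funext => x; case: (f x).
- rewrite (_ : (fun x => _) = (fun x => (- complex.Im (f x)) *
    (complex.Re (f x) ^+ 2 + complex.Im (f x) ^+ 2)^-1)).
    exact: measurable_funM (measurable_funN jf) m2.
  by apply/funext => x; case: (f x) => a b; rewrite mulNr.
Qed.

Lemma measurable_normc (f : T -> C) : measurableC f -> measurable_fun setT (fun x => normc (f x)).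
Proof.
move=> [rf jf].
rewrite (_ : (fun x => _) = (fun x => (complex.Re (f x) ^+ 2 + complex.Im (f x) ^+ 2) `^ 2^-1)).
  apply: measurable_powR2; last exact: measurable_cst.
  by apply: measurable_funD; exact: measurable_funX.
by apply/funext => x; rewrite powR12_sqrt ?addr_ge0 ?sqr_ge0//; case: (f x).
Qed.

Lemma measurableC_sum (I : Type) (r : seq I) (F : I -> T -> C) :
  (forall i, measurableC (F i)) -> measurableC (fun x => \sum_(i <- r) F i x).
Proof.
move=> mF; elim: r => [|i r IH].
  by under [X in measurableC X]eq_fun do rewrite big_nil; exact: measurableC_cst.
by under [X in measurableC X]eq_fun do rewrite big_cons; exact: measurableCD.
Qed.

Lemma measurableC_prod (I : Type) (r : seq I) (F : I -> T -> C) :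
  (forall i, measurableC (F i)) -> measurableC (fun x => \prod_(i <- r) F i x).
Proof.
move=> mF; elim: r => [|i r IH].
  by under [X in measurableC X]eq_fun do rewrite big_nil; exact: measurableC_cst.
by under [X in measurableC X]eq_fun do rewrite big_cons; exact: measurableCM.
Qed.

Lemma measurableC_if (b : T -> bool) (f g : T -> C) : measurable_fun setT b ->
  measurableC f -> measurableC g -> measurableC (fun x => if b x then f x else g x).
Proof.
move=> mb [rf jf] [rg jg]; split.
- rewrite (_ : (fun x => _) = (fun x => if b x then complex.Re (f x) else complex.Re (g x))).
    exact: measurable_fun_ifT.
  by apply/funext => x; case: ifP.
- rewrite (_ : (fun x => _) = (fun x => if b x then complex.Im (f x) else complex.Im (g x))).
    exact: measurable_fun_ifT.
  by apply/funext => x; case: ifP.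
Qed.

Definition measurable_mx (a b : nat) (V : T -> 'M[C]_(a, b)) : Prop :=
  forall i j, measurableC (fun x => V x i j).

Lemma measurable_l1norm a b (V : T -> 'M[C]_(a, b)) : measurable_mx V ->
  measurable_fun setT (fun x => l1norm (V x)).
Proof.
move=> mV; apply: measurable_sum => i; apply: measurable_sum => j.
exact: measurable_normc.
Qed.

Lemma measurable_mx_cst a b (A : 'M[C]_(a, b)) : measurable_mx (fun=> A).
Proof. by move=> i j; exact: measurableC_cst. Qed.

Lemma measurable_mulmx a b c (V : T -> 'M[C]_(a, b)) (W : T -> 'M[C]_(b, c)) :
  measurable_mx V -> measurable_mx W -> measurable_mx (fun x => V x *m W x).
Proof.
move=> mV mW i j; under [X in measurableC X]eq_fun do rewrite mxE.
by apply: measurableC_sum => k; exact: measurableCM.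
Qed.

Lemma measurable_trmx a b (V : T -> 'M[C]_(a, b)) : measurable_mx V ->
  measurable_mx (fun x => (V x)^T).
Proof. by move=> mV i j; under [X in measurableC X]eq_fun do rewrite mxE; exact: mV. Qed.

Lemma measurable_det m (V : T -> 'M[C]_m) : measurable_mx V ->
  measurableC (fun x => \det (V x)).
Proof.
move=> mV; apply: measurableC_sum => s; apply: measurableCM; first exact: measurableC_cst.
by apply: measurableC_prod => i; exact: mV.
Qed.

(** Cramer's rule off the measurable set where the determinant vanishes, on which [invmx]
    is the identity map. *)
Lemma measurable_invmx m (V : T -> 'M[C]_m) : measurable_mx V ->
  measurable_mx (fun x => invmx (V x)).
Proof.
move=> mV i j.
have [rd jd] := measurable_det mV.
rewrite (_ : (fun x => _) = (fun x =>
    if (complex.Re (\det (V x)) == 0) && (complex.Im (\det (V x)) == 0)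
    then V x i j else (\det (V x))^-1 * cofactor (V x) j i)); last first.
  apply/funext => x; rewrite /invmx unitmxE unitfE eq_complex /=.
  by case: (_ && _) => //=; rewrite !mxE.
apply: measurableC_if; last 2 first.
- exact: mV.
- apply: measurableCM; first exact: measurableCV (measurable_det mV).
  apply: measurableCM; first exact: measurableC_cst.
  apply: measurable_det => k l.
  by under [X in measurableC X]eq_fun do rewrite !mxE; exact: mV.
apply: measurable_and; exact: measurable_fun_eqr (measurable_cst _).
Qed.

End complex_measurability.

(** * Reducing bases *)

Section row_norms.
Context (R : realType) (n m : nat).
Local Notation Rn := (Rn R n).
Local Notation mu := (@lebesgue_Rn R n).
Local Notation C := R[i].
Local Notation normc := Normc.normc.

Lemma vnorm0 (q : Rn -> \bar R) : exponent q -> vnorm q (fun=> 0) = 0.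
Proof.
move=> eq; apply/eqP; rewrite eq_le vnorm_ge0 andbT; apply/lee_addgt0Pr => e e0.
rewrite add0e; apply: vnorm_le => //.
have -> : (fun x : Rn => 0 / e%:E) = (fun=> 0) :> (Rn -> \bar R) by apply/funext => x; rewrite mul0e.
rewrite modularE [X in X + _](_ : _ = 0); last first.
  apply: integral0_eq => x qx; rewrite abse0 poweR0r// gt_eqF//.
  by rewrite (lt_le_trans _ (fine_exponent_ge1 eq qx)).
rewrite add0e; apply/ess_supP/nearW => x; rewrite patchE.
by case: ifP => _; rewrite abse0 lee01.
Qed.

(** Covers the coefficient 0, which [vnormZ_le] excludes. *)
Lemma vnormZ_real (q f : Rn -> \bar R) (c b : R) : exponent q -> (0 <= c)%R ->
  vnorm q f <= b%:E -> vnorm q (fun x => c%:E * f x) <= (c * b)%:E.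
Proof.
move=> eq; rewrite le_eqVlt => /orP[/eqP<- _|c0 fb].
  rewrite mul0r; have -> : (fun x => 0 * f x) = (fun=> 0) by apply/funext => x; rewrite mul0e.
  by rewrite vnorm0.
by apply: le_trans (vnormZ_le q f c0) _; rewrite EFinM lee_wpmul2l// lee_fin ltW.
Qed.

Lemma l1norm_indic_ge0 a b (A : 'M[C]_(a, b)) (Q : set Rn) y : (0 <= l1norm A * \1_Q y)%R.
Proof. by rewrite mulr_ge0// l1norm_ge0. Qed.

(** Two cases matter: V = W^T with the exponent p, and V = W^-1 with its conjugate. *)
Definition rownorm (q : Rn -> \bar R) (Q : set Rn) (V : Rn -> 'M[C]_m) (phi : 'rV[C]_m) :=
  vnorm q (fun y => (l1norm (phi *m V y) * \1_Q y)%:E).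

Section fixed_exponent.
Variables (q : Rn -> \bar R) (Q : set Rn) (V : Rn -> 'M[C]_m).
Hypotheses (eq : exponent q) (mQ : measurable Q) (mV : measurable_mx V).

Lemma measurable_rownorm (phi : 'rV[C]_m) : measurable_fun setT (fun y : Rn => l1norm (phi *m V y) * \1_Q y)%R.
Proof.
apply: measurable_funM; last exact: measurable_indic.
exact: (measurable_l1norm (measurable_mulmx (measurable_mx_cst _ phi) mV)).
Qed.

(** |a U V(y)| is at most the sum over j of |a_j| |U_j V(y)|; [vnorm_sum] then costs m^2. *)
Lemma rownorm_comb (U : 'M[C]_m) (a : 'rV[C]_m) (B : R) : (0 < m)%N -> (0 <= B)%R ->
  (forall j, rownorm q Q V (row j U) <= B%:E) ->
  rownorm q Q V (a *m U) <= (m%:R ^+ 2 * (l1norm a * B))%:E.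
Proof.
move=> m0 B0 UB.
pose f j y := (normc (a 0 j) * (l1norm (row j U *m V y) * \1_Q y))%R.
apply: (@le_trans _ _ (vnorm q (fun y => (\sum_j f j y)%:E))).
  apply: le_vnorm => // y; rewrite lee_fin l1norm_indic_ge0/= lee_fin.
  rewrite (eq_bigr (fun j => normc (a 0 j) * l1norm (row j U *m V y) * \1_Q y)%R); last first.
    by move=> j _; rewrite /f mulrA.
  rewrite -mulr_suml ler_wpM2r// -mulmxA [X in l1norm X]mulmx_sum_row.
  rewrite l1norm_rowE.
  apply: (@le_trans _ _ (\sum_k \sum_j normc (a 0 j * (U *m V y) j k))%R).
    apply: ler_sum => k _; rewrite summxE; apply: le_trans (normc_sum _ _) _.
    by apply: ler_sum => j _; rewrite !mxE.
  rewrite exchange_big/=; apply: ler_sum => j _; rewrite l1norm_rowE mulr_sumr.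
  by apply: ler_sum => k _; rewrite Normc.normcM -row_mul [row j _ _ _]mxE.
apply: (vnorm_sum eq m0) => [j|j y|j].
- apply: measurable_funM; first exact: measurable_cst.
  exact: measurable_rownorm.
- by rewrite mulr_ge0 ?normc_ge0 ?l1norm_indic_ge0.
- have := vnormZ_real eq (normc_ge0 (a 0%R j)) (UB j).
  move=> /le_trans; apply; rewrite lee_fin ler_wpM2r//.
  exact: normc_le_l1norm.
Qed.

Lemma rownorm_lty (U : 'M[C]_m) : (0 < m)%N -> U \in unitmx ->
  (forall j, rownorm q Q V (row j U) < +oo) ->
  forall phi, rownorm q Q V phi < +oo.
Proof.
move=> m0 uU Ufin phi.
rewrite -(mulmxKV uU phi).
apply: le_lt_trans (rownorm_comb (B := (\sum_j fine (rownorm q Q V (row j U)))%R) _ m0 _ _) _.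
- by apply: sumr_ge0 => j _; rewrite fine_ge0// vnorm_ge0.
- move=> j; rewrite -[leLHS]fineK ?ge0_fin_numE ?vnorm_ge0// lee_fin (bigD1 j)//= lerDl.
  by apply: sumr_ge0 => k _; rewrite fine_ge0// vnorm_ge0.
- exact: ltry.
Qed.

Lemma rownormZ (a : C) phi : a != 0%R ->
  rownorm q Q V (a *: phi)%R <= (normc a)%:E * rownorm q Q V phi.
Proof.
move=> a0; have na0 : (0 < normc a)%R.
  rewrite lt_neqAle normc_ge0 andbT eq_sym; apply: contra a0 => /eqP.
  by move=> /Normc.eq0_normc ->.
apply: le_trans (vnormZ_le _ _ na0); apply: le_vnorm => // y.
rewrite lee_fin l1norm_indic_ge0/= -EFinM lee_fin mulrA ler_wpM2r//.
rewrite -scalemxAl /l1norm mulr_sumr; apply: ler_sum => i _; rewrite mulr_sumr.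
by apply: ler_sum => j _; rewrite mxE Normc.normcM.
Qed.

(** |phi| <= |phi V(y)| |V(y)^-1| wherever V(y) is invertible, and the norm of the
    positive function 1 / (1 + |V^-1|) is positive. *)
Lemma rownorm_lower : 0 < mu Q -> {ae mu, forall x, V x \in unitmx} ->
  exists2 c : R, (0 < c)%R & forall phi, (c * l1norm phi)%:E <= rownorm q Q V phi.
Proof.
move=> Q0 uV; have [E [mE E0 EQ _ VE]] := conull_subset mQ Q0 uV.
pose g y := (\1_E y / (1 + l1norm (invmx (V y))))%R.
have d0 y : (0 < 1 + l1norm (invmx (V y)))%R by rewrite ltr_pwDl// l1norm_ge0.
have g0 y : (0 <= g y)%R by rewrite divr_ge0// ltW.
have mg : measurable_fun setT g.
  apply: measurable_funM; first exact: measurable_indic.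
  apply: measurable_inv_ge0 => [|y]; last exact: ltW.
  apply: measurable_funD; first exact: measurable_cst.
  by apply: measurable_l1norm; exact: measurable_invmx.
have gE y : E y -> (0 < g y)%R.
  by move=> Ey; rewrite divr_gt0// indicE mem_set.
have := vnorm_gt0 eq mg g0 mE E0 gE; set v := vnorm q _ => v0.
have gphi phi y : (l1norm phi * g y <= l1norm (phi *m V y) * \1_Q y)%R.
  rewrite /g indicE; have [yE|yE] := boolP (y \in E); last first.
    by rewrite !mul0r mulr0 mulr_ge0// l1norm_ge0.
  have Ey := set_mem yE; rewrite indicE mem_set; last exact: EQ.
  rewrite mulr1 mul1r ler_pdivrMr//.
  rewrite -[in leLHS](mulmxK (VE y Ey) phi); apply: le_trans (l1norm_mulmx _ _) _.
  by rewrite ler_wpM2l ?l1norm_ge0// lerDr.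
have vphi phi : (0 < l1norm phi)%R -> (l1norm phi)%:E * v <= rownorm q Q V phi.
  move=> phi0; apply: (@le_trans _ _ (vnorm q (fun y => (l1norm phi)%:E * (g y)%:E))).
    rewrite -lee_pdivlMl//.
    have -> : v = vnorm q (fun y => ((l1norm phi)^-1)%:E * ((l1norm phi)%:E * (g y)%:E)).
      congr vnorm; apply/funext => y.
      by rewrite -!EFinM mulKf// gt_eqF.
    by apply: vnormZ_le; rewrite invr_gt0.
  apply: le_vnorm => // y; rewrite -EFinM !lee_fin gphi andbT.
  by rewrite mulr_ge0// l1norm_ge0.
have [c c0 cv] : exists2 c : R, (0 < c)%R & c%:E <= v.
  move: v0; case: v {vphi} => [r|_|//]; last by exists 1%R; rewrite ?leey.
  by rewrite lte_fin => r0; exists r.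
exists c => // phi; have := l1norm_ge0 phi; rewrite le_eqVlt => /orP[/eqP<-|phi0].
  by rewrite mulr0 vnorm_ge0.
apply: le_trans (vphi _ phi0); rewrite mulrC EFinM lee_wpmul2l// lee_fin ltW//.
Qed.

(** A basis of this kind replaces the reducing matrix of the norm [rownorm]. *)
Lemma reducing_basis : 0 < mu Q -> {ae mu, forall x, V x \in unitmx} ->
  (forall phi, rownorm q Q V phi < +oo) ->
  exists U : 'M[C]_m, [/\ U \in unitmx, forall j, rownorm q Q V (row j U) <= 1 &
    forall phi j, (normc ((phi *m invmx U) 0%R j))%:E <= 2%:E * rownorm q Q V phi].
Proof.
move=> Q0 uV fin.
have [c c0 cN] := rownorm_lower Q0 uV.
have NE phi : rownorm q Q V phi = (fine (rownorm q Q V phi))%:E.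
  by rewrite fineK// ge0_fin_numE ?vnorm_ge0.
have [||U [uU NU hU]] := @almost_auerbach R m (fun phi => fine (rownorm q Q V phi)) c c0.
- by move=> phi; rewrite -lee_fin -NE.
- by move=> a phi a0; have := rownormZ phi a0; rewrite (NE phi) (NE (a *: phi)%R) -EFinM lee_fin.
exists U; split => //.
- by move=> j; rewrite NE lee_fin; exact: NU.
- by move=> phi j; rewrite NE -EFinM lee_fin; exact: hU.
Qed.

End fixed_exponent.
End row_norms.

(** * Integrals of logarithms *)

Section log_integrals.
Context d (T : measurableType d) (R : realType).
Variable mu : {measure set T -> \bar R}.

Lemma lne_le (x : \bar R) : 0 <= x -> lne x <= x.
Proof.
move=> x0; have [->|xy] := eqVneq x +oo; first by rewrite leey.
by apply: ltW; apply: lne_sublinear; rewrite ge0_fin_numE// ltey.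
Qed.

Lemma ge0_fineE (x : \bar R) : 0 <= x -> x != +oo -> x = (fine x)%:E.
Proof. by case: x. Qed.

(** Additivity can fail for s not integrable, as +oo - +oo is -oo. The inequality is
    nevertheless true: it follows from the integrated form of
    (k + s)^+ + s^- <= k + s^+ + (k + s)^- when the integral of s^- is finite, and
    otherwise the integral of (k + s)^- is infinite too. *)
Lemma integral_shift_le (Q : set T) (s : T -> \bar R) (k : R) : measurable Q ->
  mu Q < +oo -> measurable_fun Q s -> (0 <= k)%R ->
  \int[mu]_(x in Q) (k%:E + s x) <= k%:E * mu Q + \int[mu]_(x in Q) s x.
Proof.
move=> mQ Qoo ms k0; rewrite integralE [in leRHS]integralE.
have mks : measurable_fun Q (fun x => k%:E + s x).
  by apply: emeasurable_funD => //; exact: measurable_cst.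
have msn := measurable_funeneg ms.
have msp := measurable_funepos ms.
have mkn := measurable_funeneg mks.
have mkp := measurable_funepos mks.
have p0 (f : T -> \bar R) x : 0 <= f^\+ x by exact: funepos_ge0.
have n0 (f : T -> \bar R) x : 0 <= f^\- x by exact: funeneg_ge0.
set a := \int[mu]_(x in Q) (fun x => k%:E + s x)^\+ x.
set a' := \int[mu]_(x in Q) (fun x => k%:E + s x)^\- x.
set b := \int[mu]_(x in Q) s^\+ x.
set b' := \int[mu]_(x in Q) s^\- x.
have a'0 : 0 <= a' by exact: integral_ge0.
have b'0 : 0 <= b' by exact: integral_ge0.
have b0 : 0 <= b by exact: integral_ge0.
have kQ : \int[mu]_(x in Q) k%:E = k%:E * mu Q by exact: integral_cst.
have mk : measurable_fun Q (fun=> k%:E : \bar R) by exact: measurable_cst.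
have kQ0 : 0 <= k%:E * mu Q by rewrite mule_ge0// lee_fin.
have k0' x : Q x -> 0 <= k%:E :> \bar R by rewrite lee_fin.
have b'a' : b' <= a' + k%:E * mu Q.
  rewrite -kQ -(ge0_integralD mu mQ _ mkn _ mk)//.
  apply: le_integral_pointwise => x _; rewrite !funenegE.
  case: (s x) => [r| |].
  - rewrite -EFinD -!EFinN -!EFin_max -EFinD lee_fin.
    by case: (leP (- r)%R (0%R : R)); case: (leP (- (k + r))%R (0%R : R)) => ? ?; lra.
  - by rewrite addey// maxNye add0e lee_fin.
  - by rewrite addeNy maxye addye// leey.
have [b'y|b'y] := eqVneq b' +oo.
  have -> : a' = +oo.
    apply/eqP; rewrite -leye_eq leNgt; apply/negP => ay.
    move: b'a'; rewrite b'y leye_eq => /eqP e.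
    have : a' + k%:E * mu Q < +oo by rewrite lte_add_pinfty// lte_mul_pinfty// lee_fin.
    by rewrite e.
  by rewrite addeNy leNye.
have b'fin : b' \is a fin_num by rewrite ge0_fin_numE// ltey.
have a'b' : a' <= b'.
  apply: le_integral_pointwise => x _; apply: (@funeneg_le _ _ setT); last by rewrite in_setT.
  by move=> y _; rewrite leeDr// lee_fin.
have a'fin : a' \is a fin_num by rewrite ge0_fin_numE// (le_lt_trans a'b')// ltey.
have key : a + b' <= k%:E * mu Q + b + a'.
  rewrite -kQ -(ge0_integralD mu mQ _ mkp _ msn)//.
  rewrite -(ge0_integralD mu mQ _ mk _ msp)//.
  rewrite -(ge0_integralD mu mQ _ (emeasurable_funD mk msp) _ mkn)//; last first.
    by move=> x _; rewrite adde_ge0// lee_fin.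
  apply: le_integral_pointwise => x _; rewrite !funenegE !funeposE.
  case: (s x) => [r| |].
  - rewrite -EFinD -!EFinN -!EFin_max -!EFinD lee_fin.
    by case: (leP (k + r)%R (0%R : R)); case: (leP (- r)%R (0%R : R));
      case: (leP (- (k + r))%R (0%R : R)); case: (leP r (0%R : R)) => ? ? ? ?; lra.
  - by rewrite !addey// !maxye !maxNye adde0 addey// adde0.
  - by rewrite addeNy !maxNye !maxye add0e adde0 addey.
by rewrite leeBlDr// (addeA (k%:E * mu Q) b) (addeAC _ (- b')) leeBrDr.
Qed.

(** The positive part is infinite on E, and the negative part lives on a null set. *)
Lemma integral_eqy (Q E : set T) (s : T -> \bar R) : measurable Q -> measurable E ->
  E `<=` Q -> 0 < mu E -> mu (Q `\` E) = 0 -> (forall x, E x -> s x = +oo) ->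
  \int[mu]_(x in Q) s x = +oo.
Proof.
move=> mQ mE EQ E0 QE sE; rewrite integralE.
have -> : \int[mu]_(x in Q) s^\+ x = +oo.
  apply/eqP; rewrite -leye_eq -[leLHS](gt0_mulye E0) -[leLHS](integral_cst mu mE).
  rewrite integral_mkcond [leRHS]integral_mkcond; apply: le_integral_pointwise => x _.
  rewrite !patchE; case: ifPn => [/set_mem Ex|_].
    by rewrite mem_set ?funeposE ?sE//; exact: EQ.
  by case: ifP => // _; exact: funepos_ge0.
have -> : \int[mu]_(x in Q) s^\- x = 0; last by rewrite oppe0 adde0.
apply/eqP; rewrite eq_le integral_ge0 ?andbT//.
rewrite -[leRHS](mule0 +oo) -[X in _ <= _ * X]QE -[leRHS](integral_cst mu (measurableD mQ mE)).
rewrite integral_mkcond [leRHS]integral_mkcond; apply: le_integral_pointwise => x _.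
rewrite !patchE; case: ifPn => [/set_mem Qx|_]; last by case: ifP => // _; rewrite leey.
have [Ex|nEx] := pselect (E x).
  by rewrite funenegE sE// maxNye; case: ifP => // _; rewrite leey.
by rewrite mem_set// leey.
Qed.

Lemma le_lne (x y : \bar R) : 0 <= x -> x <= y -> lne x <= lne y.
Proof.
move=> x0 xy; rewrite lee_lne// in_itv/= ?x0 ?leey//.
by rewrite (le_trans x0 xy).
Qed.

Lemma lneM_le (k r : R) : (1 <= k)%R -> (0 <= r)%R ->
  lne (k * r)%:E <= (ln k)%:E + lne r%:E.
Proof.
move=> k1; rewrite le_eqVlt => /orP[/eqP<-|r0].
  by rewrite mulr0 !le0_lneNy ?leNye.
have k0 : (0 < k)%R by exact: lt_le_trans k1.
by rewrite !lne_EFin ?mulr_gt0// lnM ?posrE// EFinD.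
Qed.

Lemma measurable_lne (f : T -> R) : measurable_fun setT f ->
  measurable_fun setT (fun x => lne (f x)%:E).
Proof.
move=> mf; apply: measurable_fun_ifT.
- exact: (measurable_fun_ler mf (measurable_cst _)).
- exact: measurable_cst.
- by apply/measurable_EFinP; apply: measurableT_comp => //; exact: measurable_ln.
Qed.

End log_integrals.

(** * The matrix conditions on one cube *)

Section one_cube.
Context (R : realType) (n m : nat).
Local Notation Rn := (Rn R n).
Local Notation mu := (@lebesgue_Rn R n).
Local Notation C := R[i].
Local Notation normc := Normc.normc.
Variables (p : Rn -> \bar R) (W : Rn -> 'M[C]_m) (Q : set Rn).
Hypotheses (m0 : (0 < m)%N) (ep : exponent p) (py : forall x, p x < +oo).
Hypotheses (mW : measurable_mx W) (uW : {ae mu, forall x, W x \in unitmx}).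
Hypotheses (mQ : measurable Q) (Q0 : 0 < mu Q).

Local Notation M := (m%:R : R).
Local Notation p' := (conjugate_exponent p).
Local Notation N := (rownorm p Q (fun x => (W x)^T)).
Local Notation N' := (rownorm p' Q (fun x => invmx (W x))).

Let ep' : exponent p' := exponent_conjugate ep py.
Let mWT : measurable_mx (fun x => (W x)^T) := measurable_trmx mW.
Let mWV : measurable_mx (fun x => invmx (W x)) := measurable_invmx mW.

Let M0 : (0 < M)%R. Proof. by rewrite ltr0n. Qed.

Let sumM (x : R) : (\sum_(j < m) x = M * x)%R.
Proof. by rewrite sumr_const card_ord mulr_natl. Qed.

Lemma ae_unit_tr : {ae mu, forall x, (W x)^T \in unitmx}.
Proof. by apply: filterS uW => x; rewrite unitmx_tr. Qed.

Lemma ae_unit_inv : {ae mu, forall x, invmx (W x) \in unitmx}.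
Proof. by apply: filterS uW => x; rewrite unitmx_inv. Qed.

Local Notation osc x y := (opnorm (W x *m invmx (W y))).
Definition outer_norm y : \bar R := vnorm p (fun x => (osc x y)%:E * (\1_Q x)%:E).
Definition inner_norm x : \bar R := vnorm p' (fun y => (osc x y)%:E * (\1_Q y)%:E).

Lemma osc_indic_ge0 x y z : 0 <= (osc x y)%:E * (\1_Q z)%:E.
Proof. by rewrite mule_ge0// lee_fin// opnorm_ge0. Qed.

Lemma rownorm_le_inner i x : N' (row i (W x)) <= M%:E * inner_norm x.
Proof.
apply: le_trans (vnormZ_le _ _ M0); apply: le_vnorm => // y.
rewrite lee_fin l1norm_indic_ge0/= -!EFinM lee_fin mulrA ler_wpM2r//.
by rewrite -row_mul l1norm_row_le_opnorm.
Qed.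

Lemma rownorm_le_outer k y : N (row k (invmx (W y))^T) <= M%:E * outer_norm y.
Proof.
apply: le_trans (vnormZ_le _ _ M0); apply: le_vnorm => // x.
rewrite lee_fin l1norm_indic_ge0/= -!EFinM lee_fin mulrA ler_wpM2r//.
rewrite -row_mul -trmx_mul l1norm_rowE.
rewrite -sumM.
by apply: ler_sum => j _; rewrite 2!mxE normc_le_opnorm.
Qed.

Section with_basis.
Variable U : 'M[C]_m.
Hypotheses (uU : U \in unitmx) (NU : forall j, N (row j U) <= 1).

(** The explicit measurable function that stands for [outer_norm]: the two are comparable
    when U is a reducing basis. *)
Definition reduced y : R := l1norm ((invmx U)^T *m invmx (W y)).

Lemma reduced_tr y : reduced y = l1norm ((invmx (W y))^T *m invmx U).
Proof. by rewrite /reduced -l1norm_tr trmx_mul trmxK. Qed.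

Lemma vnorm_l1norm_le_reduced y :
  vnorm p (fun x => (l1norm (W x *m invmx (W y)) * \1_Q x)%:E) <= (M ^+ 4 * reduced y)%:E.
Proof.
set X := (invmx (W y))^T.
have XE x : (l1norm (W x *m invmx (W y)) * \1_Q x = \sum_k l1norm (row k X *m (W x)^T) * \1_Q x)%R.
  rewrite -mulr_suml; congr (_ * _)%R; rewrite -l1norm_tr trmx_mul l1norm_rows.
  by apply: eq_bigr => k _; rewrite row_mul.
under [X in vnorm p X]eq_fun do rewrite XE.
have -> : (M ^+ 4 * reduced y = M ^+ 2 * (M ^+ 2 * reduced y))%R by ring.
apply: (vnorm_sum ep m0) => [k|k x|k].
- exact: (measurable_rownorm mQ mWT).
- exact: l1norm_indic_ge0.
have := rownorm_comb ep mQ mWT (row k X *m invmx U) m0 ler01 NU.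
rewrite mulmxKV// => /le_trans; apply; rewrite lee_fin mulr1 ler_pM2l ?exprn_gt0//.
by rewrite reduced_tr -row_mul l1norm_row_le.
Qed.

Lemma outer_le_reduced y : outer_norm y <= (M ^+ 4 * reduced y)%:E.
Proof.
apply: le_trans (vnorm_l1norm_le_reduced y); apply: le_vnorm => // x.
by rewrite osc_indic_ge0/= -EFinM lee_fin ler_wpM2r// opnorm_le_l1norm.
Qed.

Lemma measurable_reduced : measurable_fun setT reduced.
Proof. exact: (measurable_l1norm (measurable_mulmx (measurable_mx_cst _ _) mWV)). Qed.

Lemma reduced_le_outer y :
  (forall phi j, (normc ((phi *m invmx U) 0%R j))%:E <= 2%:E * N phi) ->
  (reduced y)%:E <= (2 * M ^+ 3)%:E * outer_norm y.
Proof.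
move=> hU; rewrite reduced_tr.
have [->|Gy] := eqVneq (outer_norm y) +oo.
  by rewrite gt0_muley ?leey// lte_fin mulr_gt0// exprn_gt0.
have GE : outer_norm y = (fine (outer_norm y))%:E.
  by apply: ge0_fineE => //; exact: vnorm_ge0.
rewrite GE -EFinM lee_fin /l1norm.
have -> : (2 * M ^+ 3 * fine (outer_norm y) =
    \sum_(k < m) \sum_(j < m) 2 * (M * fine (outer_norm y)))%R.
  by rewrite !sumM; ring.
apply: ler_sum => k _; apply: ler_sum => j _.
rewrite -lee_fin EFinM EFinM -GE.
apply: (@le_trans _ _ (2%:E * N (row k (invmx (W y))^T))).
  by apply: le_trans (hU _ j); rewrite -row_mul [X in _ <= (normc X)%:E]mxE.
by rewrite lee_pmul2l// ?lte_fin//; exact: rownorm_le_outer.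
Qed.

End with_basis.

(** The logarithm is at most its argument, and [outer_norm] at most a multiple of
    [reduced]. Hoelder's inequality bounds the integral of the latter by the p'-norms
    of phi_j W^-1, where phi_j are the rows of U^-T. In a reducing basis U' for these
    norms the coordinates of phi_j are those of z_k in the basis U, where z_k are the
    rows of U'^-T; so they are at most twice the p-norm of z_k W^T, whose entries at x
    are coordinates of rows of W(x) in the basis U', bounded by [inner_norm]. *)
Theorem average_log_le_Ap (lam v K : R) : mu Q = v%:E ->
  vnorm p (fun x => (\1_Q x)%:E) = lam%:E -> (0 < lam)%R -> (0 < K)%R ->
  vnorm p (fun x => inner_norm x * (\1_Q x)%:E) <= (K * v)%:E ->
  average Q (fun y => lne (lam^-1%:E * outer_norm y)) <= (32 * M ^+ 10 * K)%:E.
Proof.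
move=> Qv Qlam lam0 K0 hK.
have v0 : (0 < v)%R by rewrite -lte_fin -Qv.
have in0 x : 0 <= inner_norm x by exact: vnorm_ge0.
have inQ0 x : 0 <= inner_norm x * (\1_Q x)%:E by rewrite mule_ge0// lee_fin.
(* the norm over x is finite, so the inner norm is finite at some x0 where W is invertible;
   the rows of W x0 then show that the p'-row norm is finite everywhere *)
have [x0 [uWx0 Fx0]] : exists x, W x \in unitmx /\ inner_norm x < +oo.
  have [E [mE E0 EQ _ WE]] := conull_subset mQ Q0 uW.
  apply: contrapT => /forallNP noF.
  have : vnorm p (fun x => inner_norm x * (\1_Q x)%:E) = +oo.
    apply: (vnorm_eqy ep inQ0 mE E0) => x Ex; split; first exact: py.
    have := noF x; rewrite WE// => /not_andP[//|/negP]; rewrite -leNgt leye_eq => /eqP ->.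
    by rewrite indicE mem_set ?mule1//; exact: EQ.
  by move=> e; move: hK; rewrite e.
have N'fin : forall phi, N' phi < +oo.
  apply: (rownorm_lty ep' mQ mWV m0 uWx0) => i.
  apply: le_lt_trans (rownorm_le_inner i x0) _.
  by rewrite lte_mul_pinfty// lee_fin ltW.
have [U' [uU' N'U' hU']] := reducing_basis ep' mQ mWV Q0 ae_unit_inv N'fin.
pose z k := row k (invmx U')^T.
have Nz k : N (z k) <= (2 * M ^+ 2 * (K * v))%:E.
  have c0 : (0 < 2 * M ^+ 2)%R by rewrite mulr_gt0// exprn_gt0.
  rewrite EFinM; apply: le_trans (lee_wpmul2l _ hK); last by rewrite lee_fin ltW.
  apply: le_trans (vnormZ_le _ _ c0); apply: le_vnorm => // x.
  rewrite lee_fin l1norm_indic_ge0/= EFinM muleA lee_wpmul2r ?lee_fin//.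
  have [->|Fy] := eqVneq (inner_norm x) +oo; first by rewrite gt0_muley ?leey// lte_fin.
  have FE : inner_norm x = (fine (inner_norm x))%:E := ge0_fineE (in0 x) Fy.
  rewrite FE -EFinM lee_fin l1norm_rowE.
  have -> : (2 * M ^+ 2 * fine (inner_norm x) = \sum_(i < m) 2 * (M * fine (inner_norm x)))%R.
    by rewrite sumM; ring.
  apply: ler_sum => i _; rewrite -lee_fin EFinM EFinM -FE.
  have -> : (z k *m (W x)^T) 0%R i = (row i (W x) *m invmx U') 0%R k.
    by rewrite -!row_mul -trmx_mul !mxE.
  apply: le_trans (hU' _ k) _; rewrite lee_pmul2l// ?lte_fin//.
  exact: rownorm_le_inner.
have Nfin : forall phi, N phi < +oo.
  have uz : (invmx U')^T \in unitmx by rewrite unitmx_tr unitmx_inv.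
  apply: (rownorm_lty ep mQ mWT m0 uz) => k.
  by apply: le_lt_trans (Nz k) _; rewrite ltry.
have [U [uU NU hU]] := reducing_basis ep mQ mWT Q0 ae_unit_tr Nfin.
pose phi j := row j (invmx U)^T.
(* m^2 from the quasi-triangle inequality, times the m coordinates of phi_j *)
pose A : R := (M ^+ 2 * (M * (4 * M ^+ 2 * (K * v))))%R.
have A0 : (0 < A)%R by rewrite !mulr_gt0// ?exprn_gt0.
have N'phi j : N' (phi j) <= A%:E.
  have := rownorm_comb ep' mQ mWV (phi j *m invmx U') m0 ler01 N'U'.
  rewrite mulmxKV// => /le_trans; apply; rewrite lee_fin mulr1 ler_pM2l ?exprn_gt0//.
  rewrite l1norm_rowE -sumM; apply: ler_sum => k _.
  have -> : (phi j *m invmx U') 0%R k = (z k *m invmx U) 0%R j.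
    by rewrite -!row_mul -[X in row j X]trmxK trmx_mul trmxK !mxE.
  rewrite -lee_fin; apply: le_trans (hU _ j) _.
  have -> : (4 * M ^+ 2 * (K * v) = 2 * (2 * M ^+ 2 * (K * v)))%R by ring.
  by rewrite EFinM lee_pmul2l// lte_fin.
have mred := measurable_reduced U.
have int_phi j : \int[mu]_(y in Q) (l1norm (phi j *m invmx (W y)))%:E <= (8 * (A * lam))%:E.
  have -> : (8 * (A * lam) = 2 * ((2 * A) * (2 * lam)))%R by ring.
  have mphi : measurable_fun setT (fun y => l1norm (phi j *m invmx (W y))).
    exact: (measurable_l1norm (measurable_mulmx (measurable_mx_cst _ (phi j)) mWV)).
  apply: (vnorm_hoelder ep py mQ mphi).
  - by move=> y; exact: l1norm_ge0.
  - by apply: le_lt_trans (N'phi j) _; rewrite lte_fin; lra.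
  - by rewrite Qlam lte_fin; lra.
have int_red : \int[mu]_(y in Q) (reduced U y)%:E <= (M * (8 * (A * lam)))%:E.
  have -> : \int[mu]_(y in Q) (reduced U y)%:E =
      \int[mu]_(y in Q) (\sum_j (l1norm (phi j *m invmx (W y)))%:E).
    apply: eq_integral => y _; rewrite sumEFin /reduced l1norm_rows.
    by congr EFin; apply: eq_bigr => j _; rewrite row_mul.
  rewrite (ge0_integral_sum mu mQ); last 2 first.
  - move=> j; apply: measurable_funTS; apply/measurable_EFinP.
    exact: (measurable_l1norm (measurable_mulmx (measurable_mx_cst _ (phi j)) mWV)).
  - by move=> j y _; rewrite lee_fin l1norm_ge0.
  have -> : (M * (8 * (A * lam)))%:E = \sum_(j < m) (8 * (A * lam))%:E.
    by rewrite sumEFin sumM.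
  by apply: lee_sum => j _; exact: int_phi.
have c0 : (0 <= lam^-1 * M ^+ 4)%R by rewrite mulr_ge0 ?invr_ge0 ?exprn_ge0 ?(ltW lam0) ?(ltW M0).
rewrite /average Qv inver gt_eqF// lee_pdivrMl//.
apply: (@le_trans _ _ (\int[mu]_(y in Q) ((lam^-1 * M ^+ 4)%:E * (reduced U y)%:E))).
  apply: le_integral_pointwise => y _; apply: le_trans (lne_le _) _.
    by rewrite mule_ge0 ?vnorm_ge0// lee_fin invr_ge0 ltW.
  rewrite EFinM -muleA; apply: lee_wpmul2l; first by rewrite lee_fin invr_ge0 ltW.
  exact: outer_le_reduced.
have mredQ : measurable_fun Q (fun y => (reduced U y)%:E).
  by apply: measurable_funTS; apply/measurable_EFinP; exact: mred.
rewrite (ge0_integralZl_EFin _ mQ _ mredQ c0); last first.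
  by move=> y _; rewrite lee_fin l1norm_ge0.
apply: le_trans (lee_wpmul2l _ int_red) _; first by rewrite lee_fin.
rewrite -!EFinM lee_fin le_eqVlt; apply/orP; left; apply/eqP.
by rewrite /A; field; rewrite gt_eqF.
Qed.

(** If the row norm of W^T were infinite at some vector, then [outer_norm] would be
    infinite at every y where W(y) is invertible, and so would be the average of its
    logarithm. Hence there is a reducing basis U. The inner L^1 average is at most a
    multiple of the normalised p-norm, hence of [reduced], hence of [outer_norm], and
    the constant leaves the logarithm as a summand. *)
Theorem average_log_le_A1 (lam v c : R) : mu Q = v%:E -> (0 < lam)%R -> (0 < c)%R ->
  (forall g : Rn -> R, measurable_fun setT g -> (forall x, 0 <= g x)%R ->
    average Q (EFin \o g) <= c%:E * (lam^-1%:E * vnorm p (fun x => (g x * \1_Q x)%:E))) ->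
  average Q (fun y => lne (lam^-1%:E * outer_norm y)) < +oo ->
  average Q (fun y => lne (average Q (fun x => (osc x y)%:E))) <=
    (ln (1 + 2 * c * M ^+ 7))%:E + average Q (fun y => lne (lam^-1%:E * outer_norm y)).
Proof.
move=> Qv lam0 c0 havg; rewrite {1 2 4}/average Qv inver.
have v0 : (0 < v)%R by rewrite -lte_fin -Qv.
have lV0 : (0 < lam^-1)%R by rewrite invr_gt0.
rewrite gt_eqF// => avgfin.
have Nfin : forall phi, N phi < +oo.
  apply: contrapT => /existsNP[phi /negP]; rewrite -leNgt leye_eq => /eqP Nphi.
  have [E [mE E0 EQ QE WE]] := conull_subset mQ Q0 uW.
  move: avgfin; rewrite (integral_eqy mQ mE EQ E0 QE) ?gt0_muley ?lte_fin ?invr_gt0// => y Ey.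
  suff -> : outer_norm y = +oo by rewrite gt0_muley ?lte_fin.
  apply/eqP; rewrite -leye_eq leNgt; apply/negP => Gy.
  suff : N phi < +oo by rewrite Nphi.
  have uT : (invmx (W y))^T \in unitmx by rewrite unitmx_tr unitmx_inv; exact: WE.
  apply: (rownorm_lty ep mQ mWT m0 uT) => k.
  apply: le_lt_trans (rownorm_le_outer k y) _.
  by rewrite lte_mul_pinfty// lee_fin ltW.
have [U [uU NU hU]] := reducing_basis ep mQ mWT Q0 ae_unit_tr Nfin.
have mred := measurable_reduced U.
have red0 y : (0 <= reduced U y)%R by exact: l1norm_ge0.
(* the measurable function s is below the A_{p,oo} integrand, and ln k + s above the
   A_{1,oo} one *)
pose c2 := (lam^-1 / (2 * M ^+ 3))%R.
have c20 : (0 < c2)%R by rewrite divr_gt0 ?mulr_gt0 ?exprn_gt0.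
pose s y := lne (c2 * reduced U y)%:E.
pose k := (1 + 2 * c * M ^+ 7)%R.
have k1 : (1 <= k)%R by rewrite lerDl !mulr_ge0 ?exprn_ge0 ?(ltW c0) ?(ltW M0).
have sG y : s y <= lne (lam^-1%:E * outer_norm y).
  apply: le_lne; first by rewrite lee_fin mulr_ge0// ltW.
  rewrite /c2 mulrAC -mulrA EFinM lee_pmul2l ?lte_fin//.
  rewrite mulrC EFinM lee_pdivrMl ?mulr_gt0 ?exprn_gt0//.
  exact: reduced_le_outer.
have ms : measurable_fun Q s.
  apply: measurable_funTS; apply: measurable_lne.
  exact: (measurable_funM (measurable_cst c2) mred).
have avgs y : lne (average Q (fun x => (osc x y)%:E)) <= (ln k)%:E + s y.
  apply: (@le_trans _ _ (lne (k * (c2 * reduced U y))%:E)); last first.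
    by apply: lneM_le => //; rewrite mulr_ge0// ltW.
  apply: le_lne.
    by rewrite mule_ge0 ?inve_ge0 ?measure_ge0// integral_ge0// => x _; rewrite lee_fin opnorm_ge0.
  have ment : measurable_fun setT (fun x => l1norm (W x *m invmx (W y))).
    exact: (measurable_l1norm (measurable_mulmx mW (measurable_mx_cst _ _))).
  apply: (@le_trans _ _ (average Q (EFin \o (fun x => l1norm (W x *m invmx (W y)))))).
    rewrite /average lee_wpmul2l ?inve_ge0 ?measure_ge0//.
    by apply: le_integral_pointwise => x _; rewrite lee_fin opnorm_le_l1norm.
  apply: le_trans (havg _ ment (fun x => l1norm_ge0 _)) _.
  apply: (@le_trans _ _ (c%:E * (lam^-1%:E * (M ^+ 4 * reduced U y)%:E))).
    rewrite lee_pmul2l ?lte_fin// lee_pmul2l ?lte_fin//.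
    exact: vnorm_l1norm_le_reduced.
  rewrite -!EFinM lee_fin.
  have -> : (c * (lam^-1 * (M ^+ 4 * reduced U y)) = 2 * c * M ^+ 7 * c2 * reduced U y)%R.
    by rewrite /c2; field; rewrite !gt_eqF.
  by rewrite (mulrA k) ler_wpM2r// ler_pM2r// /k lerDr.
apply: (@le_trans _ _ (v^-1%:E * ((ln k)%:E * v%:E + \int[mu]_(y in Q) lne (lam^-1%:E * outer_norm y)))).
  rewrite lee_pmul2l ?lte_fin ?invr_gt0//.
  apply: (@le_trans _ _ (\int[mu]_(y in Q) ((ln k)%:E + s y))).
    by apply: le_integral_pointwise => y _; exact: avgs.
  have Qoo : mu Q < +oo by rewrite Qv ltry.
  apply: le_trans (integral_shift_le mQ Qoo ms (ln_ge0 k1)) _.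
  rewrite [X in _ * X + _ <= _]Qv leeD2l//.
  by apply: le_integral_pointwise => y _; exact: sG.
rewrite muleDr ?fin_num_adde_defr// -!EFinM leeD2r// lee_fin.
by rewrite mulrCA mulVf ?mulr1// gt_eqF.
Qed.

End one_cube.

(** * The two inclusions *)

Section inclusions.
Context (R : realType) (n m : nat).
Local Notation Rn := (Rn R n).
Local Notation mu := (@lebesgue_Rn R n).
Local Notation C := R[i].

Lemma lty_real_bound (x : \bar R) : x < +oo -> exists2 K : R, (0 < K)%R & x <= K%:E.
Proof.
case: x => [r _|//|_]; last by exists 1%R => //; rewrite leNye.
by exists (Num.max r 1)%R; rewrite ?lt_max ?ltr01 ?orbT// lee_fin le_max lexx.
Qed.

Lemma LH_lty (p : Rn -> \bar R) : LH p -> forall x, p x < +oo.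
Proof. by move=> [r _ ->] x; exact: ltry. Qed.

Lemma matrix_weight_measurable (W : Rn -> 'M[C]_m) : matrix_weight W -> measurable_mx W.
Proof. by move=> [_ Wint] i j; have [] := Wint i j. Qed.

Lemma matrix_weight_unit (W : Rn -> 'M[C]_m) : matrix_weight W ->
  {ae mu, forall x, W x \in unitmx}.
Proof. by move=> [W0 _]; apply: filterS W0 => x []. Qed.

Lemma cube_fin (Q : set Rn) : cube Q -> mu Q = (fine (mu Q))%:E.
Proof. by move=> cQ; apply: ge0_fineE; rewrite ?measure_ge0// lt_eqF// cube_lty. Qed.

Theorem sub_Ap_Ap_infty (p : Rn -> \bar R) : (0 < m)%N -> exponent p -> LH p ->
  matrix_Ap m p `<=` matrix_Ap_infty m p.
Proof.
move=> m0 ep hLH W [wW supW]; split; first exact: wW.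
have [K K0 supK] := lty_real_bound supW.
have [c c0 hc] := log_hoelder_average ep hLH.
have py := LH_lty hLH.
have mW := matrix_weight_measurable wW.
have uW := matrix_weight_unit wW.
apply: (@le_lt_trans _ _ (expeR (32 * m%:R ^+ 10 * K)%:E)); last by rewrite ltry.
apply: ge_ereal_sup => _ [Q cQ <-]; rewrite lee_expeR.
have [lam [lam0 Qlam] _] := hc Q cQ.
have Qv := cube_fin cQ; have Q0 := cube_gt0 cQ.
rewrite Qlam inver gt_eqF//.
apply: (average_log_le_Ap (v := fine (mu Q)) m0 ep py mW uW (measurable_cube cQ) Q0) => //.
have v0 : (0 < fine (mu Q))%R by rewrite -lte_fin -Qv.
rewrite mulrC EFinM -lee_pdivrMl//.
apply: le_trans supK; apply: ereal_sup_ubound; exists Q => //.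
by rewrite {1}Qv inver gt_eqF.
Qed.

Theorem sub_Ap_infty_A1_infty (p : Rn -> \bar R) : (0 < m)%N -> exponent p -> LH p ->
  matrix_Ap_infty m p `<=` matrix_A1_infty R n m.
Proof.
move=> m0 ep hLH W [wW supW]; split; first exact: wW.
have [K K0 supK] := lty_real_bound supW.
have [c c0 hc] := log_hoelder_average ep hLH.
have py := LH_lty hLH.
have mW := matrix_weight_measurable wW.
have uW := matrix_weight_unit wW.
have k0 : (0 < 1 + 2 * c * m%:R ^+ 7 :> R)%R.
  by rewrite ltr_pwDl// !mulr_ge0 ?exprn_ge0// ltW.
apply: (@le_lt_trans _ _ ((1 + 2 * c * m%:R ^+ 7) * K)%:E); last by rewrite ltry.
apply: ge_ereal_sup => _ [Q cQ <-].
have [lam [lam0 Qlam] havg] := hc Q cQ.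
have Qv := cube_fin cQ; have Q0 := cube_gt0 cQ.
have EK : expeR (average Q (fun y => lne (lam^-1%:E * outer_norm p W Q y))) <= K%:E.
  apply: le_trans supK; apply: ereal_sup_ubound; exists Q => //.
  by rewrite Qlam inver gt_eqF.
have Eoo : average Q (fun y => lne (lam^-1%:E * outer_norm p W Q y)) < +oo.
  rewrite ltey; apply/eqP => e; move: EK; rewrite e /= leye_eq => /eqP; by [].
have := average_log_le_A1 m0 ep mW uW (measurable_cube cQ) Q0 Qv lam0 c0 havg Eoo.
rewrite -lee_expeR => /le_trans; apply; rewrite expeRD EFinM.
rewrite /= lnK ?posrE//; apply: lee_wpmul2l; first by rewrite lee_fin ltW.
exact: EK.
Qed.

End inclusions.

(** * Averages of powers of one coordinate *)

Section one_coordinate.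
Context (R : realType) (n : nat) (i0 : 'I_n).
Local Notation Rn := (Rn R n).
Local Notation mu := (@lebesgue_Rn R n).
Local Open Scope ring_scope.

Definition slab (J : set R) (I : 'I_n -> interval R) : set Rn :=
  [set x | forall i, (if i == i0 then J else [set` I i]) (coord x i)].

Lemma measurable_slab J I : measurable J -> measurable (slab J I).
Proof.
move=> mJ; apply: (measurable_RnX (A := fun i => if i == i0 then J else [set` I i])).
by move=> i; case: ifP.
Qed.

Lemma lebesgue_slab J I l Q : measurable J -> has_sides Q l I ->
  mu (slab J I) = (lebesgue_measure J * (l ^+ n.-1)%:E)%E.
Proof.
move=> mJ [l0 _ hI].
rewrite (lebesgue_RnX (A := fun i => if i == i0 then J else [set` I i])); last first.
  by move=> i; case: ifP.
rewrite (bigD1 i0)//= eqxx; congr (_ * _)%E.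
rewrite (eq_bigr (fun _ => l%:E)); last first.
  by move=> i /negbTE ->; have [a [b1 [b2 /lebesgue_side->]]] := hI i.
rewrite -(big_morph EFin (@EFinM R) erefl) prodr_const; congr (_ ^+ _)%:E.
by have := cardC1 i0; rewrite card_ord.
Qed.

Lemma coord_eq0_null : mu [set x : Rn | coord x i0 = 0] = 0%E.
Proof.
rewrite (_ : [set x : Rn | _] = [set x : Rn |
    forall i, (if i == i0 then [set 0] else setT) (coord x i)]); last first.
  apply/seteqP; split=> x /=; first by move=> x0 i; case: eqP => // ->.
  by move=> /(_ i0); rewrite eqxx.
rewrite (lebesgue_RnX (A := fun i => if i == i0 then [set 0] else setT)); last first.
  by move=> i; case: ifP.
by rewrite (bigD1 i0)//= eqxx lebesgue_measure_set1 mul0e.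
Qed.

Lemma ae_coord_neq0 : {ae mu, forall x : Rn, coord x i0 != 0}.
Proof.
exists [set x : Rn | coord x i0 = 0]; split; last by move=> x /= /negP; rewrite negbK => /eqP.
- rewrite -[X in measurable X]setTI.
  exact: (measurable_coord i0 measurableT (measurable_set1 0)).
- exact: coord_eq0_null.
Qed.

Lemma geometric_sum_le (rho : R) N : 0 <= rho < 1 ->
  \sum_(k < N) rho ^+ k <= (1 - rho)^-1.
Proof.
move=> /andP[r0 r1]; have r10 : 0 < 1 - rho by rewrite subr_gt0.
rewrite -[leRHS]mul1r ler_pdivlMr//.
suff -> : (\sum_(k < N) rho ^+ k) * (1 - rho) = 1 - rho ^+ N by rewrite gerBl exprn_ge0.
elim: N => [|N IH]; first by rewrite big_ord0 mul0r expr0 subrr.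
by rewrite big_ord_recr/= mulrDl IH exprS; ring.
Qed.

Lemma dyadic_bracket (T t : R) : 0 < t -> t <= T ->
  exists k : nat, t <= T / 2 ^+ k /\ T / 2 ^+ k.+1 < t.
Proof.
move=> t0 tT.
have exk : exists k : nat, T / 2 ^+ k.+1 < t.
  exists (Num.bound (T / t)); rewrite ltr_pdivrMr ?exprn_gt0// -ltr_pdivrMl// mulrC.
  have Tt : 0 <= T / t by rewrite divr_ge0 ?(ltW t0)// (le_trans (ltW t0)).
  apply: lt_le_trans (archi_boundP Tt) _.
  by rewrite -natrX ler_nat ltnW// (ltn_trans (ltn_expl _ (isT : 1 < 2)%N))// ltn_exp2l.
case: (ex_minnP exk) => k kt kmin; exists k; split => //.
case: k kt kmin => [|k] kt kmin; first by rewrite expr0 divr1.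
by rewrite leNgt; apply/negP => /kmin; rewrite ltnn.
Qed.

(** The first term is the sum of a geometric series of ratio 2^(a-1) over dyadic
    neighbourhoods of the hyperplane; the second one serves the cubes far from it. *)
Definition power_constant (a : R) := 4 * 2 `^ a / (1 - 2 `^ (a - 1)) + 2 `^ a.

Lemma power_ratio (a : R) : 0 < a -> a < 1 -> 0 <= 2 `^ (a - 1) < 1.
Proof.
move=> a0 a1; rewrite powR_ge0/= /powR ?pnatr_eq0/=.
by rewrite -[ltRHS]expR0 ltr_expR pmulr_llt0 ?subr_lt0// ln_gt0// ltr1n.
Qed.

Lemma power_constant_gt1 (a : R) : 0 < a -> a < 1 -> 1 <= power_constant a.
Proof.
move=> a0 a1; have /andP[r0 r1] := power_ratio a0 a1.
have h : 1 <= 2 `^ a by rewrite -[leLHS](powRr0 2) ler_powR ?ler1n// ltW.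
rewrite /power_constant (le_trans h)// lerDr divr_ge0 ?mulr_ge0 ?powR_ge0//.
by rewrite subr_ge0 ltW.
Qed.

(** T is the supremum of |x_i0| on Q, and l the side. If l < T / 2, then |x_i0| >= T / 2 on
    Q. Otherwise |x_i0|^-a is at most the sum over k of (T 2^(-k-1))^-a on the sets
    |x_i0| <= T 2^-k, whose integrals form a geometric series because a < 1. *)
Lemma average_power (a : R) : 0 < a -> a < 1 -> forall Q, cube Q ->
  exists2 T : R, 0 < T & (forall x, Q x -> `|coord x i0| <= T) /\
  (average Q (fun x => (`|coord x i0| `^ (- a))%:E) <= (power_constant a * T `^ (- a))%:E)%E.
Proof.
move=> a0 a1 Q cQ; have [l [I sQ]] := cubeP cQ; have [l0 QE hI] := sQ.
have mQ := measurable_cube cQ.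
have Qv : mu Q = (l ^+ n)%:E := lebesgue_cube sQ.
have vp : 0 < l ^+ n by rewrite exprn_gt0.
have [al [b1 [b2 IE]]] := hI i0.
(* the coordinate ranges over an interval with endpoints al and al + l *)
pose T := Num.max `|al| `|al + l|.
have Tl : T <= `|al| + l.
  by rewrite ge_max lerDl (ltW l0)/= (le_trans (ler_normD _ _))// lerD2l ger0_norm// ltW.
have T0 : 0 < T.
  rewrite lt_max !normr_gt0; have [al0|//] := eqVneq al 0.
  by rewrite al0 add0r (gt_eqF l0) orbT.
have Q_itv x : Q x -> al <= coord x i0 <= al + l.
  by rewrite QE => /(_ i0); rewrite IE; exact: mem_side.
have QT x : Q x -> `|coord x i0| <= T.
  move=> /Q_itv/andP[ax xl].
  have aT : `|al| <= T by rewrite le_max lexx.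
  have bT : `|al + l| <= T by rewrite le_max lexx orbT.
  move: aT bT; rewrite !ler_norml => /andP[? ?] /andP[? ?].
  by apply/andP; split; lra.
exists T => //; split => //.
have T2a : (T / 2) `^ (- a) = 2 `^ a * T `^ (- a).
  rewrite mulrC powRM ?invr_ge0 ?(ltW T0)//; congr (_ * _).
  by rewrite -powR_inv1// -powRrM mulN1r opprK.
have cst0 : 0 <= 4 * 2 `^ a / (1 - 2 `^ (a - 1)).
  have /andP[r0 r1] := power_ratio a0 a1.
  by rewrite divr_ge0 ?mulr_ge0 ?powR_ge0// subr_ge0 ltW.
rewrite /average Qv inver gt_eqF// lee_pdivrMl//.
have [lT|Tl2] := ltP l (T / 2).
  apply: (@le_trans _ _ (\int[mu]_(x in Q) (2 `^ a * T `^ (- a))%:E)%E).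
    apply: le_integral_pointwise => x Qx; rewrite lee_fin -T2a.
    have xT : T / 2 <= `|coord x i0|.
      have /andP[ax xl] := Q_itv x Qx.
      have Tal : T <= `|coord x i0| + l.
        rewrite ge_max; apply/andP; split.
          rewrite -[X in `|X| <= _](subrK (coord x i0)) addrC.
          rewrite (le_trans (ler_normD _ _))// lerD2l ler_norml.
          by apply/andP; split; lra.
        rewrite -[X in `|X| <= _](subrK (coord x i0)) addrC.
        rewrite (le_trans (ler_normD _ _))// lerD2l ler_norml.
        by apply/andP; split; lra.
      lra.
    rewrite !powRN lef_pV2 ?posrE ?powR_gt0 ?divr_gt0//; last first.
      by apply: lt_le_trans xT; rewrite divr_gt0.
    by apply: ge0_ler_powR; rewrite ?nnegrE ?(ltW a0) ?divr_ge0 ?(ltW T0).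
  have -> : (\int[mu]_(x in Q) (2 `^ a * T `^ (- a))%:E = (2 `^ a * T `^ (- a))%:E * (l ^+ n)%:E)%E.
    by rewrite -Qv; exact: integral_cst.
  rewrite -!EFinM lee_fin mulrC ler_pM2l//.
  by rewrite ler_wpM2r ?powR_ge0// /power_constant lerDr.
pose c k := (T / 2 ^+ k.+1) `^ (- a).
pose E k := slab `[- (T / 2 ^+ k), T / 2 ^+ k]%classic I.
have mE k : measurable (E k) by exact: measurable_slab.
have c0 k : 0 <= c k by exact: powR_ge0.
have f0 k x : (0 <= (c k)%:E * (\1_(E k) x)%:E)%E by rewrite mule_ge0 ?lee_fin.
have mf k : measurable_fun Q (fun x => (c k)%:E * (\1_(E k) x)%:E)%E.
  apply: measurable_funTS; apply: emeasurable_funM; first exact: measurable_cst.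
  by apply/measurable_EFinP; exact: measurable_indic.
apply: (@le_trans _ _ (\int[mu]_(x in Q) \sum_(0 <= k <oo) ((c k)%:E * (\1_(E k) x)%:E))%E).
  apply: le_integral_pointwise => x Qx.
  have [x0|x0] := eqVneq (coord x i0) 0.
    rewrite x0 normr0 powR0 ?oppr_eq0 ?gt_eqF//.
    by apply: nneseries_ge0.
  have tp : 0 < `|coord x i0| by rewrite normr_gt0.
  have [k [tk kt]] := dyadic_bracket tp (QT x Qx).
  apply: (@le_trans _ _ ((c k)%:E * (\1_(E k) x)%:E)%E).
    have Ekx : E k x.
      move=> i; case: eqP => [->|_]; last by move: Qx; rewrite QE; exact.
      by rewrite /= in_itv/= -ler_norml.
    rewrite indicE mem_set// mule1 lee_fin /c !powRN lef_pV2 ?posrE ?powR_gt0//; last first.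
      by rewrite divr_gt0// exprn_gt0.
    apply: ge0_ler_powR; rewrite ?nnegrE ?(ltW a0) ?(ltW tp) ?(ltW kt)//.
    by rewrite divr_ge0 ?exprn_ge0 ?(ltW T0).
  apply: le_trans (nneseries_lim_ge k.+1 (fun i _ _ => f0 i x)).
  rewrite big_nat_recr//= leeDr//; exact: sume_ge0.
rewrite (integral_nneseries mu mQ mf (fun k x _ => f0 k x)).
pose rho := 2 `^ (a - 1) : R.
have rho01 := power_ratio a0 a1; rewrite -/rho in rho01.
pose B := 2 * 2 `^ a * T `^ (- a) * T * l ^+ n.-1.
have B0 : 0 <= B by rewrite !mulr_ge0 ?powR_ge0 ?exprn_ge0 ?(ltW T0) ?(ltW l0).
have term k : (\int[mu]_(x in Q) ((c k)%:E * (\1_(E k) x)%:E) <= (B * rho ^+ k)%:E)%E.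
  rewrite (ge0_integralZl_EFin _ mQ); last 3 first.
  - by move=> x _; rewrite lee_fin.
  - by apply: measurable_funTS; apply/measurable_EFinP; exact: measurable_indic.
  - exact: c0.
  rewrite (integral_indic mu mQ (mE k)).
  apply: (@le_trans _ _ ((c k)%:E * mu (E k))%E).
    rewrite lee_wpmul2l ?lee_fin//; apply: le_measure; rewrite ?inE//.
    exact: measurableI.
  rewrite (lebesgue_slab _ sQ)// lebesgue_measure_itv/= lte_fin.
  have Tk : 0 < T / 2 ^+ k by rewrite divr_gt0// exprn_gt0.
  rewrite gtrN// -EFinB -!EFinM lee_fin opprK.
  rewrite /B /c /rho le_eqVlt; apply/orP; left; apply/eqP.
  have -> : (T / 2 ^+ k.+1) `^ (- a) = 2 `^ a * T `^ (- a) * (2 `^ a) ^+ k.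
    rewrite powRM ?invr_ge0 ?exprn_ge0 ?(ltW T0)//.
    have -> : (2 ^+ k.+1)^-1 `^ (- a) = 2 `^ a * (2 `^ a) ^+ k.
      rewrite -powR_inv1 ?exprn_ge0// -powRrM mulN1r opprK -exprS.
      by rewrite -powR_mulrn// -powRrM mulrC powRrM powR_mulrn ?powR_ge0.
    by ring.
  have -> : 2 `^ (a - 1) = 2 `^ a / 2 :> R.
    by rewrite powRB ?powRr1// pnatr_eq0 implybT.
  by rewrite expr_div_n; field; rewrite expf_neq0.
apply: (@le_trans _ _ (B / (1 - rho))%:E).
  apply: lime_le.
    by apply: is_cvg_nneseries => k _ _; apply: integral_ge0 => x _.
  apply: nearW => N; apply: (@le_trans _ _ (\sum_(0 <= k < N) (B * rho ^+ k)%:E)%E).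
    by apply: lee_sum => k _; exact: term.
  rewrite sumEFin lee_fin -mulr_sumr ler_wpM2l// big_mkord.
  exact: geometric_sum_le.
have r10 : 0 < 1 - rho by case/andP: rho01 => _; rewrite subr_gt0.
rewrite -EFinM lee_fin.
apply: (@le_trans _ _ (l ^+ n * (4 * 2 `^ a / (1 - rho) * T `^ (- a)))); last first.
  by rewrite ler_pM2l// ler_wpM2r ?powR_ge0// /power_constant lerDl powR_ge0.
have -> : l ^+ n = l * l ^+ n.-1 by rewrite -exprS prednK// (leq_ltn_trans _ (ltn_ord i0)).
rewrite /B.
have -> : l * l ^+ n.-1 * (4 * 2 `^ a / (1 - rho) * T `^ (- a)) =
    (2 * 2 `^ a * T `^ (- a) * l ^+ n.-1 / (1 - rho)) * (2 * l) by ring.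
have -> : 2 * 2 `^ a * T `^ (- a) * T * l ^+ n.-1 / (1 - rho) =
    (2 * 2 `^ a * T `^ (- a) * l ^+ n.-1 / (1 - rho)) * T by ring.
apply: ler_wpM2l; last by lra.
by rewrite divr_ge0 ?(ltW r10)// !mulr_ge0 ?powR_ge0 ?exprn_ge0 ?(ltW l0).
Qed.

End one_coordinate.

(** * Divergence of powers of one coordinate *)

Section divergence.
Context (R : realType) (n : nat) (i0 : 'I_n).
Local Notation Rn := (Rn R n).
Local Notation mu := (@lebesgue_Rn R n).
Local Open Scope ring_scope.

Definition unit_cube : set Rn := [set x | forall i, coord x i \in `[0, 1]].

Lemma side_unit_cube : has_sides unit_cube 1 (fun=> `[0, 1] : interval R).
Proof. by split => // i; exists 0, true, false; rewrite add0r. Qed.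

Lemma cube_unit_cube : cube unit_cube.
Proof.
exists (0 : Rn), 1, (fun=> true), (fun=> false); split => //.
have c0 i : coord (0 : Rn) i = 0 by rewrite /coord mxE.
by apply/seteqP; split => x /= Qx i; have := Qx i; rewrite c0 add0r.
Qed.

(** When the last indicator is 1, the whole sum is at most 2^(N+1) <= 2 del / t. *)
Lemma sum_pow2_indic_le (del t : R) N : 0 < t -> 0 < del ->
  \sum_(k < N) 2 ^+ k * (t <= del / 2 ^+ k)%R%:R <= 2 * del / t.
Proof.
move=> t0 d0; elim: N => [|N IH].
  by rewrite big_ord0 divr_ge0 ?mulr_ge0 ?ltW.
rewrite big_ord_recr/=; have [tN|_] := leP t (del / 2 ^+ N); last by rewrite mulr0 addr0.
have h : 2 ^+ N.+1 <= 2 * del / t.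
  rewrite exprS -mulrA ler_pM2l// ler_pdivlMr// mulrC -ler_pdivlMr ?exprn_gt0//.
apply: le_trans h; rewrite mulr1.
apply: (@le_trans _ _ (\sum_(k < N) 2 ^+ k + 2 ^+ N)).
  rewrite lerD2r; apply: ler_sum => k _.
  by rewrite ler_piMr ?exprn_ge0// lern1 leq_b1.
suff -> : \sum_(k < N) 2 ^+ k = 2 ^+ N - 1 :> R by rewrite exprS; lra.
elim: N {IH tN} => [|N IH]; first by rewrite big_ord0 expr0 subrr.
by rewrite big_ord_recr/= IH exprS; ring.
Qed.

(** Near the hyperplane u = |x_i0|^-b / t is at least 1, so u^s >= u^(1/b), which is a
    constant multiple of 1 / |x_i0|. By [sum_pow2_indic_le] this dominates a sum of N
    multiples of indicators that all have the same integral c / 2, for every N. *)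
Theorem vnorm_power_infty (s : Rn -> \bar R) (b : R) : exponent s -> 0 < b ->
  {ae mu, forall x, (s x < +oo)%E /\ 1 <= b * fine (s x)} ->
  vnorm s (fun x => (`|coord x i0| `^ (- b) * \1_unit_cube x)%:E) = +oo%E.
Proof.
move=> es b0 [Z [mZ Z0 hZ]]; apply/eqP; rewrite -leye_eq.
apply: le_ereal_inf_tmp => _ [t [t0 +] <-]; rewrite leNgt => /negP; case.
(* u >= 1 exactly when |x_i0| <= c, and u^(1/b) = c / |x_i0| *)
pose c := t `^ (- b^-1).
have c0 : 0 < c by rewrite powR_gt0.
pose del := Num.min 1 c.
have d0 : 0 < del by rewrite lt_min ltr01 c0.
pose N := (Num.bound (2 / c)).
pose B k := slab i0 `]0, del / 2 ^+ k]%classic (fun=> `[0, 1]).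
have mB k : measurable (B k) by exact: measurable_slab.
have mBZ k : measurable (B k `\` Z) by exact: measurableD.
have del2 k : 0 < del / 2 ^+ k by rewrite divr_gt0// exprn_gt0.
have BE k : mu (B k) = (del / 2 ^+ k)%:E.
  rewrite (lebesgue_slab i0 _ side_unit_cube)// expr1n mule1.
  by rewrite lebesgue_measure_itv/= lte_fin del2 oppr0 adde0.
pose g k x := ((c * 2 ^+ k / (2 * del))%:E * (\1_(B k `\` Z) x)%:E)%E.
have g0 k x : (0 <= g k x)%E.
  by rewrite mule_ge0 ?lee_fin// divr_ge0 ?mulr_ge0 ?exprn_ge0// ltW.
have mg k : measurable_fun setT (g k).
  apply: emeasurable_funM; first exact: measurable_cst.
  by apply/measurable_EFinP; exact: measurable_indic.
apply: (@lt_le_trans _ _ (\int[mu]_x (\sum_(k < N) g k x))%E).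
  rewrite (ge0_integral_sum mu measurableT (f := fun k : 'I_N => g k) (fun k => mg k)
    (fun k x _ => g0 k x)).
  rewrite (eq_bigr (fun _ => (c / 2)%:E)); last first.
    move=> k _; rewrite (ge0_integralZl_EFin _ measurableT); last 3 first.
    - by move=> x _; rewrite lee_fin.
    - by apply/measurable_EFinP; exact: measurable_indic.
    - by rewrite divr_ge0 ?mulr_ge0 ?exprn_ge0// ltW.
    rewrite (integral_indic mu measurableT (mBZ k)) setIT.
    rewrite [X in (_ * X)%E](measure_setD_null (mB k) mZ Z0).
    rewrite [X in (_ * X)%E](BE k) -EFinM; congr EFin.
    by field; rewrite expf_neq0//= gt_eqF.
  rewrite sumEFin lte_fin sumr_const card_ord -(mulr_natr (c / 2)).
  have c2 : 0 <= 2 / c by rewrite divr_ge0// ltW.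
  have := archi_boundP c2; rewrite -/N ltr_pdivrMr// => h.
  by rewrite mulrAC ltr_pdivlMr// mul1r mulrC.
rewrite modularE -[leLHS]adde0; apply: leeD; last first.
  by apply: ess_sup_gee; [exact: lebesgue_Rn_gt0|exact: nearW].
rewrite [leRHS]integral_mkcond; apply: le_integral_pointwise => x _; rewrite patchE.
have RHS0 : (0 <= if x \in [set x | s x < +oo] then
    `|(`|coord x i0| `^ (- b) * \1_unit_cube x)%:E / t%:E| `^ fine (s x) else 0)%E.
  by case: ifP => // _; exact: poweR_ge0.
have [[B0x nZx]|nB] := pselect ((B 0%N `\` Z) x); last first.
  rewrite big1// => k _; rewrite /g indicE memNset ?mule0// => -[Bx nZx]; apply: nB; split => // i.
  have := Bx i; case: eqP => // -> /=; rewrite !in_itv/= => /andP[-> /le_trans]; apply.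
  by rewrite expr0 ler_pM2l// lef_pV2 ?posrE ?exprn_gt0// exprn_ege1// ler1n.
have [sx bs] := contrapT (fun h => nZx (hZ x h)).
have Ux : unit_cube x.
  move=> i; have := B0x i; case: eqP => // -> /=; rewrite !in_itv/= => /andP[/ltW -> /le_trans]; apply.
  by rewrite expr0 divr1 ge_min lexx.
have := B0x i0; rewrite eqxx /= in_itv/= expr0 divr1 => /andP[x0 xdel].
rewrite mem_set// indicE mem_set// mulr1 divEFinE// -EFinM gtr0_norm//.
set u := t^-1 * _.
have u1 : 1 <= u.
  rewrite /u mulrC ler_pdivlMr// mul1r.
  have -> : t = c `^ (- b).
    by rewrite -powRrM mulNr mulrN opprK mulVf ?gt_eqF// powRr1// ltW.
  rewrite !powRN lef_pV2 ?posrE ?powR_gt0//.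
  apply: ge0_ler_powR; rewrite ?nnegrE ?(ltW b0) ?(ltW x0) ?(ltW c0)//.
  by rewrite (le_trans xdel)// ge_min lexx orbT.
have u0 : 0 < u by exact: lt_le_trans u1.
rewrite abse_EFin gtr0_norm// poweR_EFin.
apply: (@le_trans _ _ (c / coord x i0)%:E); last first.
  rewrite lee_fin; apply: (@le_trans _ _ (u `^ b^-1)).
    have tE : t^-1 `^ b^-1 = c.
      by rewrite /c -[t^-1]powR_inv1 ?(ltW t0)// -powRrM mulN1r.
    have xE : (coord x i0 `^ (- b)) `^ b^-1 = (coord x i0)^-1.
      by rewrite -powRrM mulNr mulfV ?gt_eqF// powR_inv1// ltW.
    by rewrite /u powRM ?invr_ge0 ?powR_ge0 ?(ltW t0)// tE xE.
  apply: ler_powR => //; rewrite -[leLHS]mulr1 ler_pdivrMl//.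
rewrite (eq_bigr (fun k : 'I_N => (c / (2 * del) * (2 ^+ k * (coord x i0 <= del / 2 ^+ k)%R%:R))%:E)).
  rewrite sumEFin lee_fin -mulr_sumr.
  apply: (@le_trans _ _ (c / (2 * del) * (2 * del / coord x i0))).
    by rewrite ler_pM2l ?divr_gt0 ?mulr_gt0//; exact: sum_pow2_indic_le.
  by rewrite le_eqVlt; apply/orP; left; apply/eqP; field; rewrite !gt_eqF.
move=> k _; rewrite /g -EFinM; congr EFin.
rewrite indicE (_ : (x \in B k `\` Z) = (coord x i0 <= del / 2 ^+ k)); last first.
  apply/idP/idP => [/set_mem[Bx _]|xk].
    by have := Bx i0; rewrite eqxx /= in_itv/= => /andP[].
  apply/mem_set; split => // i; have := B0x i; case: eqP => [-> _|//].
  by rewrite /= in_itv/= x0.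
by ring.
Qed.

End divergence.

(** * Power weights *)

Section scalar_weights.
Context (R : realType) (n m : nat) (i0 : 'I_n).
Hypothesis m0 : (0 < m)%N.
Local Notation Rn := (Rn R n).
Local Notation mu := (@lebesgue_Rn R n).
Local Notation C := R[i].
Local Notation normc := Normc.normc.
Local Open Scope ring_scope.

Definition power_weight (b : R) (x : Rn) : 'M[C]_m := ((`|coord x i0| `^ b)%:C)%C%:M.

Lemma opnorm_scalar (a : C) : opnorm (a%:M : 'M[C]_m) = normc a.
Proof.
apply/eqP; rewrite eq_le; apply/andP; split.
  apply: ge_sup.
    by exists (cvnorm (a%:M *m (0 : 'cV[C]_m))), 0 => //=; rewrite /cvnorm big1 ?sqrtr0// => i _;
      rewrite mxE Normc.normc0 expr0n.
  move=> _ [v v1 <-]; rewrite mul_scalar_mx.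
  have -> : cvnorm (a *: v) = normc a * cvnorm v.
    rewrite /cvnorm -[in RHS](ger0_norm (normc_ge0 a)) -sqrtr_sqr -sqrtrM ?sqr_ge0//.
    congr Num.sqrt; rewrite mulr_sumr; apply: eq_bigr => i _.
    by rewrite mxE Normc.normcM exprMn.
  by rewrite ler_piMr// normc_ge0.
have := normc_le_opnorm (a%:M : 'M[C]_m) (Ordinal m0) (Ordinal m0).
by rewrite mxE eqxx.
Qed.

(** On the hyperplane x_i0 = 0 too, since 0 is its own inverse in all the conventions
    involved. *)
Lemma opnorm_power_weight b x y : opnorm (power_weight b x *m invmx (power_weight b y)) =
  `|coord x i0| `^ b * `|coord y i0| `^ (- b).
Proof.
rewrite invmx_scalar -scalar_mxM opnorm_scalar Normc.normcM Normc.normcV !normc_real.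
by rewrite !(ger0_norm (powR_ge0 _ _)) powRN.
Qed.

Lemma measurable_power b : measurable_fun setT (fun x : Rn => `|coord x i0| `^ b).
Proof.
apply: measurable_powR2; last exact: measurable_cst.
by apply: measurableT_comp; [exact: normr_measurable|exact: measurable_coord].
Qed.

Lemma compact_sub_dyadic (K : set 'rV[R]_n) : compact K -> exists k, K `<=` @dyadic_cube R n k.
Proof.
move=> cK.
have bnd i : exists B : R, forall x, K x -> `|x ord0 i| <= B.
  have cKi : compact ((fun x : 'rV[R]_n => x ord0 i) @` K).
    apply: continuous_compact => //; apply: continuous_subspaceT => x.
    exact: coord_continuous.
  have [M [_ hM]] := compact_bounded cKi.
  by exists (M + 1) => x Kx; apply: (hM (M + 1)); [rewrite ltrDl|exists x].
have [B hB] := choice bnd.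
pose S := \sum_i `|B i|.
have S0 : 0 <= S by rewrite sumr_ge0.
exists (Num.bound S) => x Kx i.
rewrite in_itv/= -ler_norml; apply: (le_trans (hB i x Kx)).
apply: (@le_trans _ _ S); first by rewrite (le_trans (ler_norm _))// /S (bigD1 i)//= lerDl sumr_ge0.
apply: (le_trans (ltW (archi_boundP S0))).
by rewrite -natrX ler_nat ltnW// ltn_expl.
Qed.

Lemma cube_dyadic k : cube (@dyadic_cube R n k).
Proof.
exists (\row_i (- 2 ^+ k)), (2 * 2 ^+ k), (fun=> true), (fun=> false).
split; first by rewrite mulr_gt0// exprn_gt0.
have cE i : coord (\row_i (- 2 ^+ k) : Rn) i = - 2 ^+ k by rewrite /coord mxE.
have e2 : - 2 ^+ k + 2 * 2 ^+ k = 2 ^+ k :> R by ring.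
by apply/seteqP; split => x /= Qx i; have := Qx i; rewrite cE e2.
Qed.

Lemma power_weight_nonneg b x : nonneg_definite (power_weight b x).
Proof.
move=> v; rewrite mul_mx_scalar -scalemxAl mxE mulr_ge0//.
  by rewrite lecE /= eqxx powR_ge0.
rewrite mxE sumr_ge0// => i _; rewrite !mxE mulrC -sqr_normc.
by rewrite exprn_ge0// normr_ge0.
Qed.

Lemma matrix_weight_power b :
  (forall k, \int[mu]_(x in dyadic_cube k) (`|coord x i0| `^ b)%:E < +oo)%E ->
  matrix_weight (power_weight b).
Proof.
move=> bint; split.
  apply: filterS (ae_coord_neq0 R i0) => x x0; split; first exact: power_weight_nonneg.
  rewrite unitmxE det_scalar unitfE expf_neq0// eq_complex /= eqxx andbT gt_eqF// powR_gt0//.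
  by rewrite normr_gt0.
move=> i j.
have WE x : power_weight b x i j = (if i == j then ((`|coord x i0| `^ b)%:C)%C else 0).
  by rewrite mxE; case: eqP.
have mRe : measurable_fun setT (fun x => complex.Re (power_weight b x i j)).
  under [X in measurable_fun _ X]eq_fun do rewrite WE.
  by case: eqP => _; [exact: measurable_power|exact: measurable_cst].
have mIm : measurable_fun setT (fun x => complex.Im (power_weight b x i j)).
  under [X in measurable_fun _ X]eq_fun do rewrite WE.
  by case: eqP => _; exact: measurable_cst.
split => // K /compact_sub_dyadic[k Kk].
apply: le_lt_trans (bint k).
rewrite integral_mkcond [leRHS]integral_mkcond; apply: le_integral_pointwise => x _.
rewrite !patchE; case: ifPn => [/set_mem Kx|_]; last first.
  by case: ifP => // _; rewrite lee_fin powR_ge0.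
rewrite mem_set; last exact: Kk.
rewrite lee_fin WE; case: eqP => _; last by rewrite Normc.normc0 powR_ge0.
by rewrite normc_real ger0_norm// powR_ge0.
Qed.

Lemma integral_power_dyadic a k : 0 < a -> a < 1 ->
  (\int[mu]_(x in dyadic_cube k) (`|coord x i0| `^ (- a))%:E < +oo)%E.
Proof.
move=> a0 a1; have cQ := cube_dyadic k.
have [T T0 [_ +]] := average_power i0 a0 a1 cQ.
have Qv := cube_fin cQ; have Q0 := cube_gt0 cQ.
have v0 : 0 < fine (mu (dyadic_cube k)) by rewrite -lte_fin -Qv.
rewrite /average Qv inver gt_eqF// lee_pdivrMl// => /le_lt_trans; apply.
by rewrite -EFinM ltry.
Qed.

Lemma matrix_weight_power_neg a : 0 < a -> a < 1 -> matrix_weight (power_weight (- a)).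
Proof. by move=> a0 a1; apply: matrix_weight_power => k; exact: integral_power_dyadic. Qed.

Lemma matrix_weight_power1 : matrix_weight (power_weight 1).
Proof.
apply: matrix_weight_power => k; have cQ := cube_dyadic k.
apply: (@le_lt_trans _ _ (\int[mu]_(x in dyadic_cube k) (2 ^+ k)%:E)%E).
  apply: le_integral_pointwise => x Qx; rewrite powRr1// lee_fin ler_norml.
  by have := Qx i0; rewrite in_itv.
rewrite (_ : integral _ _ _ = (2 ^+ k)%:E * mu (dyadic_cube k))%E; last first.
  by apply: integral_cst; exact: measurable_cube.
by rewrite (cube_fin cQ) -EFinM ltry.
Qed.

Lemma average_le_cst (Q : set Rn) (f : Rn -> \bar R) (c : R) : cube Q ->
  (forall x, Q x -> f x <= c%:E)%E -> (average Q f <= c%:E)%E.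
Proof.
move=> cQ fc; have Qv := cube_fin cQ; have Q0 := cube_gt0 cQ.
have v0 : 0 < fine (mu Q) by rewrite -lte_fin -Qv.
rewrite /average {1}Qv inver gt_eqF// lee_pdivrMl//.
apply: (@le_trans _ _ (\int[mu]_(x in Q) c%:E)%E); first exact: le_integral_pointwise.
rewrite muleC -Qv le_eqVlt; apply/orP; left; apply/eqP.
by apply: integral_cst; exact: measurable_cube.
Qed.

(** The average of |x_i0|^-a is at most a multiple of T^-a, hence of |y_i0|^-a for every y
    in the cube: this is the A_1 condition, which is stronger. *)
Theorem power_weight_A1_infty a : 0 < a -> a < 1 -> matrix_A1_infty R n m (power_weight (- a)).
Proof.
move=> a0 a1; split; first exact: matrix_weight_power_neg.
apply: (@le_lt_trans _ _ (expeR (ln (power_constant a))%:E)); last by rewrite ltry.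
apply: ge_ereal_sup => _ [Q cQ <-]; rewrite lee_expeR.
have [T T0 [QT aT]] := average_power i0 a0 a1 cQ.
have Ca := power_constant_gt1 a0 a1.
have C0 : 0 < power_constant a by exact: lt_le_trans Ca.
apply: average_le_cst => // y Qy.
rewrite -lne_EFin//; apply: le_lne.
  rewrite mule_ge0 ?inve_ge0 ?measure_ge0//.
  by apply: integral_ge0 => x _; rewrite lee_fin opnorm_ge0.
have yT : `|coord y i0| `^ a <= T `^ a.
  by apply: ge0_ler_powR; rewrite ?nnegrE ?(ltW a0) ?(ltW T0)//; exact: QT.
apply: (@le_trans _ _ ((`|coord y i0| `^ a)%:E *
    average Q (fun x => (`|coord x i0| `^ (- a))%:E))%E).
  rewrite /average muleCA lee_wpmul2l ?inve_ge0 ?measure_ge0//.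
  rewrite -(ge0_integralZl_EFin _ (measurable_cube cQ)); last 3 first.
  - by move=> x _; rewrite lee_fin powR_ge0.
  - by apply: measurable_funTS; apply/measurable_EFinP; exact: measurable_power.
  - exact: powR_ge0.
  by apply: le_integral_pointwise => x _; rewrite opnorm_power_weight opprK -EFinM lee_fin mulrC.
apply: (@le_trans _ _ ((`|coord y i0| `^ a)%:E * (power_constant a * T `^ (- a))%:E)%E).
  by rewrite lee_wpmul2l// lee_fin powR_ge0.
rewrite -EFinM lee_fin mulrCA ler_piMr ?(ltW C0)//.
by rewrite powRN ler_pdivrMr ?powR_gt0// mul1r.
Qed.

(** As |x_i0| <= T on the cube, the normalised norm is at most T / |y_i0|. The logarithm of
    this number u is 2 ln (u^(1/2)) <= 2 u^(1/2), to which [average_power] applies. *)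
Theorem power_weight_Ap_infty (p : Rn -> \bar R) : exponent p -> LH p ->
  matrix_Ap_infty m p (power_weight 1).
Proof.
move=> ep hLH; split; first exact: matrix_weight_power1.
have [c c0 hc] := log_hoelder_average ep hLH.
pose a : R := 2^-1.
have a0 : 0 < a by rewrite invr_gt0.
have a1 : a < 1 by rewrite invf_lt1// ltr1n.
apply: (@le_lt_trans _ _ (expeR (2 * power_constant a)%:E)); last by rewrite ltry.
apply: ge_ereal_sup => _ [Q cQ <-]; rewrite lee_expeR.
have [T T0 [QT aT]] := average_power i0 a0 a1 cQ.
have [lam [lam0 Qlam] _] := hc Q cQ.
have Qv := cube_fin cQ; have Q0 := cube_gt0 cQ.
have v0 : 0 < fine (mu Q) by rewrite -lte_fin -Qv.
have Ta0 : 0 < T `^ a by rewrite powR_gt0.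
apply: (@le_trans _ _ ((2 * T `^ a)%:E * average Q (fun x => (`|coord x i0| `^ (- a))%:E))%E); last first.
  apply: (@le_trans _ _ ((2 * T `^ a)%:E * (power_constant a * T `^ (- a))%:E)%E).
    by rewrite lee_pmul2l ?lte_fin ?mulr_gt0.
  rewrite -EFinM lee_fin powRN le_eqVlt; apply/orP; left; apply/eqP.
  by field; rewrite gt_eqF.
rewrite /average muleCA lee_wpmul2l ?inve_ge0 ?measure_ge0//.
rewrite -(ge0_integralZl_EFin _ (measurable_cube cQ)); last 3 first.
- by move=> x _; rewrite lee_fin powR_ge0.
- by apply: measurable_funTS; apply/measurable_EFinP; exact: measurable_power.
- by rewrite mulr_ge0// ltW.
apply: le_integral_pointwise => y Qy; rewrite Qlam inver gt_eqF//.
have vn0 : (0 <= vnorm p (fun x => (opnorm (power_weight 1 x *m invmx (power_weight 1 y)))%:E *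
    (\1_Q x)%:E))%E by exact: vnorm_ge0.
have vle : (vnorm p (fun x => (opnorm (power_weight 1 x *m invmx (power_weight 1 y)))%:E *
    (\1_Q x)%:E) <= (T * `|coord y i0| `^ (-1) * lam)%:E)%E.
  have Ty : 0 <= T * `|coord y i0| `^ (-1) by rewrite mulr_ge0 ?powR_ge0 ?ltW.
  apply: (@le_trans _ _ (vnorm p (fun x => (T * `|coord y i0| `^ (-1))%:E * (\1_Q x)%:E)%E)).
    apply: le_vnorm => // x; apply/andP; split.
      by rewrite mule_ge0// lee_fin opnorm_ge0.
    rewrite -!EFinM lee_fin opnorm_power_weight.
    have [xQ|xQ] := boolP (x \in Q); last first.
      have -> : \1_Q x = 0 :> R by rewrite indicE (negbTE xQ).
      by rewrite !mulr0.
    rewrite ler_wpM2r// ler_wpM2r ?powR_ge0// powRr1//.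
    exact: QT (set_mem xQ).
  by apply: vnormZ_real => //; rewrite Qlam.
have [y0|y0] := eqVneq (coord y i0) 0.
  rewrite le0_lneNy ?leNye//.
  move: vle; rewrite y0 normr0 powR0 ?oppr_eq0// mulr0 mul0r => vle.
  by rewrite mule_ge0_le0// lee_fin invr_ge0 ltW.
have yp : 0 < `|coord y i0| by rewrite normr_gt0.
pose u := T / `|coord y i0|.
have u0 : 0 < u by rewrite divr_gt0.
apply: (@le_trans _ _ (lne u%:E)).
  apply: le_lne; first by rewrite mule_ge0// lee_fin invr_ge0 ltW.
  rewrite lee_pdivrMl//; apply: (le_trans vle); rewrite -EFinM lee_fin /u powR_inv1//.
  by rewrite mulrC.
have ua : 0 < u `^ a by rewrite powR_gt0.
rewrite lne_EFin// -EFinM lee_fin.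
have -> : ln u = 2 * ln (u `^ a) by rewrite ln_powR mulrA divff// mul1r.
rewrite -mulrA ler_pM2l//.
have -> : T `^ a * `|coord y i0| `^ (- a) = u `^ a.
  by rewrite /u powRM ?invr_ge0 ?(ltW T0)// -[X in _ = _ * X `^ _]powR_inv1// -powRrM mulN1r.
exact/ltW/ln_sublinear.
Qed.

Lemma lt_ess_inf_real (p : Rn -> \bar R) : (1 < ess_inf mu p)%E ->
  exists2 q : R, 1 < q & {ae mu, forall x, (q%:E <= p x)%E}.
Proof.
have [|] := eqVneq (ess_inf mu p) +oo%E.
  move=> e _; exists 2; first by rewrite ltr1n.
  by apply/ess_infP; rewrite e leey.
case E : (ess_inf mu p) => [q| |]// _ q1; exists q => //.
by apply/ess_infP; rewrite E.
Qed.

Local Notation U := (@unit_cube R n).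

Let mU : measurable U := measurable_cube (@cube_unit_cube R n).

Lemma vnorm_scale_infty (q f : Rn -> \bar R) (c : R) : 0 < c ->
  vnorm q f = +oo%E -> vnorm q (fun x => c%:E * f x)%E = +oo%E.
Proof.
move=> c0 finf; apply/eqP; rewrite -leye_eq -finf.
have c1 : 0 < c^-1 by rewrite invr_gt0.
have := vnormZ_le q (fun x => c%:E * f x)%E c1.
rewrite (_ : (fun x => _) = f); last first.
  by apply/funext => x; rewrite muleA -EFinM mulVf ?mul1e// gt_eqF.
rewrite finf leye_eq => /eqP cf.
rewrite leye_eq; apply/eqP; move: cf; have := vnorm_ge0 q (fun x => c%:E * f x)%E.
by case: (vnorm _ _).
Qed.

(** The power p of |x_i0|^(-1/q) is not integrable because p >= q. *)
Lemma power_weight_not_Ap_infty (p : Rn -> \bar R) q : exponent p -> LH p -> 1 < q ->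
  {ae mu, forall x, (q%:E <= p x)%E} -> ~ matrix_Ap_infty m p (power_weight (- q^-1)).
Proof.
move=> ep hLH q1 qp [_]; have q0 : 0 < q by exact: lt_trans q1.
have [c c0 hc] := log_hoelder_average ep hLH.
have py := LH_lty hLH.
apply/negP; rewrite -leNgt.
have cU := @cube_unit_cube R n.
have [lam [lam0 Qlam] _] := hc _ cU.
have Qv := cube_fin cU.
have [E [mE E0 EU UE Ec]] := conull_subset mU (cube_gt0 cU) (ae_coord_neq0 R i0).
have v0 : 0 < fine (mu U) by rewrite -lte_fin -Qv cube_gt0.
have qi0 : 0 < q^-1 by rewrite invr_gt0.
have vinf : vnorm p (fun x => (`|coord x i0| `^ (- q^-1) * \1_U x)%:E) = +oo%E.
  apply: vnorm_power_infty => //; apply: filterS qp => x qpx; split; first exact: py.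
  rewrite ler_pdivlMl// mulr1 -lee_fin.
  by have := py x; move: qpx; case: (p x).
apply: (@le_trans _ _ (expeR (average U (fun y => lne ((vnorm p (fun x => (\1_U x)%:E))^-1 *
        vnorm p (fun x => (opnorm (power_weight (- q^-1) x *m
          invmx (power_weight (- q^-1) y)))%:E * (\1_U x)%:E))))%E)); last first.
  by apply: ereal_sup_ubound; exists U.
rewrite Qlam /average (integral_eqy mU mE EU E0 UE); last first.
  move=> y /Ec y0.
  have yp : 0 < `|coord y i0| `^ q^-1 by rewrite powR_gt0// normr_gt0.
  rewrite (_ : (fun x => _) = (fun x => (`|coord y i0| `^ q^-1)%:E *
      (`|coord x i0| `^ (- q^-1) * \1_U x)%:E)%E); last first.
    apply/funext => x; rewrite opnorm_power_weight opprK -!EFinM; congr EFin.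
    by ring.
  by rewrite vnorm_scale_infty// inver gt_eqF// gt0_muley// lte_fin invr_gt0.
by rewrite Qv inver gt_eqF// gt0_muley// lte_fin invr_gt0.
Qed.

(** p' >= 1, so the power p' of 1 / |y_i0| is not integrable; p' is finite almost everywhere
    because p >= q > 1. *)
Lemma power_weight_not_Ap (p : Rn -> \bar R) q : exponent p -> LH p -> 1 < q ->
  {ae mu, forall x, (q%:E <= p x)%E} -> ~ matrix_Ap m p (power_weight 1).
Proof.
move=> ep hLH q1 qp [_].
have py := LH_lty hLH.
have ep' := exponent_conjugate ep py.
apply/negP; rewrite -leNgt.
have cU := @cube_unit_cube R n.
have Qv := cube_fin cU.
have [E [mE E0 EU UE Ec]] := conull_subset mU (cube_gt0 cU) (ae_coord_neq0 R i0).
have v0 : 0 < fine (mu U) by rewrite -lte_fin -Qv cube_gt0.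
have vinf : vnorm (conjugate_exponent p)
    (fun y => (`|coord y i0| `^ (- 1) * \1_U y)%:E) = +oo%E.
  apply: vnorm_power_infty => //; apply: filterS qp => x qpx.
  have p'y : (conjugate_exponent p x < +oo)%E.
    rewrite ltey; apply/eqP => /hoelder_conjugate_eqy p1.
    by move: qpx; rewrite p1 lee_fin leNgt q1.
  by split => //; rewrite mul1r; exact: fine_exponent_ge1.
apply: (@le_trans _ _ ((mu U)^-1 * vnorm p (fun x =>
    vnorm (conjugate_exponent p) (fun y => (opnorm (power_weight 1 x *m
      invmx (power_weight 1 y)))%:E * (\1_U y)%:E) * (\1_U x)%:E))%E); last first.
  by apply: ereal_sup_ubound; exists U.
rewrite (vnorm_eqy (E := E) ep)//; last 2 first.
- by move=> x; rewrite mule_ge0 ?vnorm_ge0// lee_fin.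
- move=> x Ex; have x0 := Ec x Ex; split; first exact: py.
  have xp : 0 < `|coord x i0| `^ 1 by rewrite powR_gt0// normr_gt0.
  rewrite (_ : (fun y => _) = (fun y => (`|coord x i0| `^ 1)%:E *
      (`|coord y i0| `^ (- 1) * \1_U y)%:E)%E); last first.
    apply/funext => y; rewrite opnorm_power_weight -!EFinM; congr EFin.
    by rewrite mulrA.
  have -> : \1_U x = 1 :> R by rewrite indicE mem_set//; exact: EU.
  by rewrite vnorm_scale_infty// mule1.
by rewrite Qv inver gt_eqF// gt0_muley// lte_fin invr_gt0.
Qed.

End scalar_weights.

Theorem proposition3p13 (R : realType) (m n : nat) (hm : (0 < m)%N)
    (hn : (0 < n)%N) (p : Rn R n -> \bar R) (hp : exponent p) (hLH : LH p) :
  (matrix_Ap m p `<=` matrix_Ap_infty m p /\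
   matrix_Ap_infty m p `<=` matrix_A1_infty R n m) /\
  (1 < ess_inf (@lebesgue_Rn R n) p ->
   matrix_Ap m p `<` matrix_Ap_infty m p /\
   matrix_Ap_infty m p `<` matrix_A1_infty R n m).
Proof.
have sub1 := sub_Ap_Ap_infty hm hp hLH.
have sub2 := sub_Ap_infty_A1_infty hm hp hLH.
split=> // /lt_ess_inf_real[q q1 qp].
pose i0 : 'I_n := Ordinal hn.
have qi0 : (0 < q^-1)%R by rewrite invr_gt0 (lt_trans ltr01).
have qi1 : (q^-1 < 1)%R by rewrite invf_lt1// (lt_trans ltr01).
split; split => // sub.
- exact: (power_weight_not_Ap hm hp hLH q1 qp (sub _ (power_weight_Ap_infty i0 hm hp hLH))).
- apply: (power_weight_not_Ap_infty hm hp hLH q1 qp (sub _ _)).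
  exact: (power_weight_A1_infty i0 hm qi0 qi1).
Qed.
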